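(* For $R\in(0,\pi]$ consider the Hegselmann--Krause interaction $W_R(\theta)=(R-2\pi|\theta|)_+^2$ on $\mathbb T$, and let $R_*\in(0,\pi)$ be the unique solution in $(0,\pi)$ of $R=(\sin R)(2-\cos R)$. Then: (1) if $R<R_*$, the phase transition of $\mathcal F_K$ (with $W=W_R$) is discontinuous and $K_c(R)<K_\#(R)$; (2) if $R\ge R_*$, the phase transition is continuous and occurs at $K_c(R)=K_\#(R)$.
   Context: $\mathbb T=[-\frac12,\frac12)$ with periodic boundary conditions; $x_+=\max(x,0)$; $\mathcal P(\mathbb T)$ denotes Borel probability measures, identified with densities when absolutely continuous; $q_u\equiv1$ is the uniform distribution. Fourier coefficients: $\widehat f(k)=\int_{\mathbb T}f(\theta)e^{-2\pi ik\theta}d\theta$. Free energy: for $K\ge0$, $\mathcal F_K(q)=\int_{\mathbb T}\log q\,dq-K\iint W(\theta-\theta')\,dq(\theta)dq(\theta')$ ($+\infty$ if $q$ is not absolutely continuous). A number $K_c\ge0$ is the critical coupling if for $K<K_c$, $q_u$ is the unique global minimizer of $\mathcal F_K$; at $K=K_c$, $q_u$ is a global minimizer; for $K>K_c$ there is a global minimizer $q\ne q_u$. The phase transition is continuous if at $K=K_c$ the global minimizer is unique and for every family $\{q_K:K>K_c\}$ of global minimizers, $\limsup_{K\to K_c^+}\|q_K-q_u\|_{L^1}=0$; otherwise discontinuous. The linear stability threshold is $K_\#=\big(2\max_{k\ge1,\widehat W(k)>0}\widehat W(k)\big)^{-1}$; $K_c(R),K_\#(R)$ denote these quantities for $W=W_R$.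 *)

(* Defs.v *)
From HB Require Import structures.
From mathcomp Require Import all_boot all_order all_algebra.
From mathcomp Require Import all_classical all_reals all_analysis.
Set Implicit Arguments. Unset Strict Implicit. Unset Printing Implicit Defensive.
Import Order.TTheory GRing.Theory Num.Theory.
Import numFieldNormedType.Exports.
Local Open Scope classical_set_scope.
Local Open Scope ring_scope.

Section HK.
Variable R : realType.

Definition leb := (@lebesgue_measure R).

Definition Tor : set R := `[(- (1/2)), (1/2)[%classic.

Definition trep (x : R) : R := x - (Num.floor (x + 1/2))%:~R.

Definition W_HK (r : R) (x : R) : R := (Num.max (r - 2 * pi * `|trep x|) 0) ^+ 2.

Definition is_density (q : R -> R) : Prop :=
  measurable_fun Tor q /\ (forall x, Tor x -> 0 <= q x) /\
  (\int[leb]_(x in Tor) (q x)%:E = 1%:E)%E.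

Definition q_u : R -> R := fun _ => 1.

(* Free energy F_K(q) = \int q log q - K \iint W(theta - theta') q q'
   (extended-real valued; ln 0 is irrelevant since multiplied by 0). *)
Definition free_energy (W : R -> R) (K : R) (q : R -> R) : \bar R :=
  (\int[leb]_(x in Tor) (q x * ln (q x))%:E
   - K%:E * \int[leb]_(x in Tor) \int[leb]_(y in Tor) (W (x - y) * q x * q y)%:E)%E.

(* global minimizer of F_K over P(T); non absolutely continuous measures
   have F_K = +oo and cannot be minimizers, so it suffices to range over densities *)
Definition global_min (W : R -> R) (K : R) (q : R -> R) : Prop :=
  is_density q /\ forall p, is_density p -> (free_energy W K q <= free_energy W K p)%E.

(* equality as elements of P(T): a.e. equality on T *)
Definition ae_eqT (q p : R -> R) : Prop := {ae leb, forall x, Tor x -> q x = p x}.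

Definition unique_min_uniform (W : R -> R) (K : R) : Prop :=
  global_min W K q_u /\ forall q, global_min W K q -> ae_eqT q q_u.

Definition critical_coupling (W : R -> R) (Kc : R) : Prop :=
  0 <= Kc /\
  (forall K, 0 <= K -> K < Kc -> unique_min_uniform W K) /\
  global_min W Kc q_u /\
  (forall K, Kc < K -> exists q, global_min W K q /\ ~ ae_eqT q q_u).

Definition L1dist_u (q : R -> R) : \bar R := (\int[leb]_(x in Tor) (`|q x - 1|)%:E)%E.

(* continuous phase transition at Kc; the limsup of the (nonnegative)
   L1 distances is written out with epsilon/delta *)
Definition continuous_PT (W : R -> R) (Kc : R) : Prop :=
  (exists q, global_min W Kc q /\ forall p, global_min W Kc p -> ae_eqT p q) /\
  forall qf : R -> R -> R, (forall K, Kc < K -> global_min W K (qf K)) ->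
    forall eps : R, 0 < eps -> exists delta : R, 0 < delta /\
      forall K, Kc < K < Kc + delta -> (L1dist_u (qf K) <= eps%:E)%E.

Definition discontinuous_PT (W : R -> R) (Kc : R) : Prop := ~ continuous_PT W Kc.

(* Fourier coefficient  \hat W(k) = \int W(theta) e^{-2 pi i k theta}
   = fcos W k - i * fsin W k *)
Definition fcos (W : R -> R) (k : nat) : R :=
  Rintegral leb Tor (fun x => W x * cos (2 * pi * k%:R * x)).
Definition fsin (W : R -> R) (k : nat) : R :=
  Rintegral leb Tor (fun x => W x * sin (2 * pi * k%:R * x)).

(* \hat W(k) > 0 (as a complex number) iff it is real and positive *)
Definition fhat_pos (W : R -> R) (k : nat) : Prop := fsin W k = 0 /\ 0 < fcos W k.

(* K_# = (2 max_{k>=1, \hat W(k) > 0} \hat W(k))^{-1}; the max is taken as a sup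
   (it is attained in the situations considered) *)
Definition Ksharp (W : R -> R) : R :=
  (2 * sup [set fcos W k | k in [set k : nat | (1 <= k)%N /\ fhat_pos W k]])^-1.

End HK.

(* Main.v *)
Require Import Defs.
From HB Require Import structures.
From mathcomp Require Import all_boot all_order all_algebra.
From mathcomp Require Import all_classical all_reals all_analysis.
From mathcomp Require Import measurable_realfun complex ring lra.
Import Order.TTheory GRing.Theory Num.Theory.
Import numFieldNormedType.Exports.
Set Implicit Arguments. Unset Strict Implicit. Unset Printing Implicit Defensive.
Local Open Scope classical_set_scope.
Local Open Scope ring_scope.

(* In Fourier variables, with W(k) and q(k) the k-th coefficients of W_R and q,
     F_K(q) - F_K(q_u) = int q log q - 2 K sum_(k >= 1) W(k) |q(k)|^2.
   Gibbs' variational principle turns the Lebedev-Milin inequality into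
     int q log q >= sum_(k >= 1) |q(k)|^2 / k,
   a logarithmic Hardy-Littlewood-Sobolev inequality.  Explicitly,
   W(k) = 2 (k R - sin (k R)) / (pi k^3), so that R >= R_* means W(2) <= W(1) / 2,
   and then W(k) <= (8 / 9) W(1) / k for k >= 3.  Hence at K_# = 1 / (2 W(1)) the
   uniform density is a minimizer, and any near-minimizer q has small q(k) for
   k >= 3.  For the modes 1 and 2, which may be marginal, the coefficient of z^4 in
   the Lebedev-Milin inequality leaves a positive gap, so q has small entropy and is
   L^1-close to q_u: the transition is continuous at K_#.

   If R < R_*, the density 1 + 2 rho cos(2 pi x) + 2 rho^2 cos(4 pi x) has entropy
   rho^2 + rho^4 / 2 + O(rho^5) and beats q_u already at K_#, so K_c < K_#, where K_c
   is the supremum of the K at which q_u is a minimizer.  For K < K_# the uniform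
   density is the only minimizer in some L^1-neighbourhood of itself, so the
   nonuniform minimizers above K_c cannot converge to it. *)

(** * Expectations of bounded measurable functions *)

(** The kernel enters through coefficients that are positive and O(1/k^2). Hence its Fourier series
    converges uniformly with error O(1/N), and statements about the interaction are proved for
    trigonometric polynomials and passed to the limit. Likewise the exponential is replaced by its
    Taylor polynomials, which turns Lebedev-Milin into a recurrence between coefficients and
    Parseval into a finite sum.

    The obstacle is R = R_*, where W(1) = 2 W(2): at K_# the interaction then cancels the weights of
    the logarithmic inequality on modes 1 and 2 exactly. Equality in Lebedev-Milin means g_k = z^k /
    k for all k, that is, q a Poisson kernel; a nonzero g with two modes is never of this form, so
    coercivity survives at higher order. The test density for R < R_* is a truncated Poisson kernel
    for the same reason.

    Positivity of the coefficients also gives minimizers above K_c: the interaction is a convex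
    quadratic form, hence a supremum of linear functionals, and for each of these the optimal
    density is an explicit Gibbs density. What remains is to minimize a continuous function of
    Fourier coefficients over a compact cube. *)

Section BoundedMeasurable.
Variable R : realType.
Implicit Types (f g q : R -> R).
Local Notation Tor := (@Defs.Tor R).
Local Notation leb := (@Defs.leb R).
Local Notation q_u := (@Defs.q_u R).

Lemma measurable_Tor : measurable (Tor : set (measurableTypeR R)).
Proof. exact: measurable_itv. Qed.

Lemma leb_Tor : leb Tor = 1%:E.
Proof.
rewrite /leb /Tor lebesgue_measure_itv /= lte_fin ifT; last by lra.
by rewrite -EFinD; congr EFin; lra.
Qed.

(** The class of test functions: boundedness makes [q * f] integrable for every density [q]. *)
Definition bmeas f := measurable_fun (Tor : set (measurableTypeR R)) f /\
  exists M, forall x, Tor x -> `|f x| <= M.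

Lemma bmeas_cst c : bmeas (fun=> c).
Proof. by split; [exact: measurable_cst | exists `|c|]. Qed.

Lemma bmeasD f g : bmeas f -> bmeas g -> bmeas (fun x => f x + g x).
Proof.
move=> [mf [M Mf]] [mg [N Ng]]; split; first exact: measurable_funD.
exists (M + N) => x Tx; apply: le_trans (ler_normD _ _) _.
by rewrite lerD// ?Mf ?Ng.
Qed.

Lemma bmeasM f g : bmeas f -> bmeas g -> bmeas (fun x => f x * g x).
Proof.
move=> [mf [M Mf]] [mg [N Ng]]; split; first exact: measurable_funM.
by exists (M * N) => x Tx; rewrite normrM ler_pM// ?Mf ?Ng.
Qed.

Lemma bmeasZ c f : bmeas f -> bmeas (fun x => c * f x).
Proof. by move=> bf; apply: bmeasM => //; exact: bmeas_cst. Qed.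

Lemma bmeasN f : bmeas f -> bmeas (fun x => - f x).
Proof.
move=> [mf [M Mf]]; split; first exact: measurable_funN.
by exists M => x Tx; rewrite normrN Mf.
Qed.

Lemma bmeasB f g : bmeas f -> bmeas g -> bmeas (fun x => f x - g x).
Proof. by move=> bf bg; apply: bmeasD => //; exact: bmeasN. Qed.

Lemma bmeasX n f : bmeas f -> bmeas (fun x => f x ^+ n).
Proof.
move=> bf; elim: n => [|n IH].
  by apply: (eq_ind _ bmeas (bmeas_cst 1)); apply/funext => x; rewrite expr0.
apply: (eq_ind _ bmeas (bmeasM bf IH)).
by apply/funext => x; rewrite exprS.
Qed.

Lemma bmeas_sum (I : Type) (s : seq I) (P : pred I) (F : I -> R -> R) :
  (forall i, P i -> bmeas (F i)) -> bmeas (fun x => \sum_(i <- s | P i) F i x).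
Proof.
move=> bF; elim: s => [|i s IH].
  by apply: (eq_ind _ bmeas (bmeas_cst 0)); apply/funext => x; rewrite big_nil.
case: (boolP (P i)) => Pi; last first.
  by apply: (eq_ind _ bmeas IH); apply/funext => x; rewrite big_cons (negPf Pi).
apply: (eq_ind _ bmeas (bmeasD (bF i Pi) IH)).
by apply/funext => x; rewrite big_cons Pi.
Qed.

Lemma bmeas_continuous_comp f (h : R -> R) : continuous h ->
  (forall M, 0 <= M -> exists N, forall y, `|y| <= M -> `|h y| <= N) ->
  bmeas f -> bmeas (fun x => h (f x)).
Proof.
move=> ch hb [mf [M Mf]]; split.
  apply: (measurableT_comp _ mf); exact: continuous_measurable_fun.
have [N hN] := hb `|M| (normr_ge0 _).
by exists N => x Tx; apply: hN; rewrite (le_trans (Mf x Tx))// ler_norm.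
Qed.

Lemma bmeas_expR f : bmeas f -> bmeas (fun x => expR (f x)).
Proof.
apply: bmeas_continuous_comp; first exact: continuous_expR.
move=> M M0; exists (expR M) => y yM; rewrite ger0_norm ?expR_ge0// ler_expR.
by rewrite (le_trans _ yM)// ler_norm.
Qed.

Lemma bmeas_cos f : measurable_fun (Tor : set (measurableTypeR R)) f -> bmeas (fun x => cos (f x)).
Proof.
move=> mf; split; last by exists 1 => x _; exact: cos_max.
apply: (measurableT_comp _ mf); apply: continuous_measurable_fun; exact: continuous_cos.
Qed.

Lemma bmeas_sin f : measurable_fun (Tor : set (measurableTypeR R)) f -> bmeas (fun x => sin (f x)).
Proof.
move=> mf; split; last by exists 1 => x _; exact: sin_max.
apply: (measurableT_comp _ mf); apply: continuous_measurable_fun; exact: continuous_sin.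
Qed.

Definition cs (k : nat) (x : R) := cos (2 * pi * k%:R * x).
Definition sn (k : nat) (x : R) := sin (2 * pi * k%:R * x).

Lemma bmeas_cs k : bmeas (cs k).
Proof. by apply: bmeas_cos; apply: measurable_funM. Qed.

Lemma bmeas_sn k : bmeas (sn k).
Proof. by apply: bmeas_sin; apply: measurable_funM. Qed.

Lemma density_integrable q : is_density q -> leb.-integrable Tor (EFin \o q).
Proof.
move=> [mq [q0 q1]]; apply/integrableP; split; first exact/measurable_EFinP.
rewrite (_ : (\int[leb]_(x in Tor) `|(EFin \o q) x| = \int[leb]_(x in Tor) (q x)%:E)%E).
  by rewrite q1 ltry.
by apply: eq_integral => x /set_mem Tx /=; rewrite ger0_norm// q0.
Qed.

Lemma densityM_integrable q f : is_density q -> bmeas f ->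
  leb.-integrable Tor (EFin \o (fun x => q x * f x)).
Proof.
move=> dq [mf [M Mf]].
have iq := density_integrable dq.
apply: (le_integrable measurable_Tor _ _ (integrableZl measurable_Tor `|M| iq)).
- apply/measurable_EFinP; apply: measurable_funM => //; exact: dq.1.
- move=> x Tx /=; rewrite lee_fin !normrM mulrC ler_wpM2r// normr_id.
  by rewrite (le_trans (Mf x Tx))// ler_norm.
Qed.

Definition Ex q f : R := Rintegral leb Tor (fun x => q x * f x).

Lemma Ex_D q f g : is_density q -> bmeas f -> bmeas g ->
  Ex q (fun x => f x + g x) = Ex q f + Ex q g.
Proof.
move=> dq bf bg; rewrite /Ex -RintegralD//; try exact: densityM_integrable.
  by apply: eq_Rintegral => x _; rewrite mulrDr.
exact: measurable_Tor.
Qed.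

Lemma Ex_Z q c f : is_density q -> bmeas f -> Ex q (fun x => c * f x) = c * Ex q f.
Proof.
move=> dq bf; rewrite /Ex -RintegralZl//; last exact: densityM_integrable.
  by apply: eq_Rintegral => x _; rewrite mulrCA.
exact: measurable_Tor.
Qed.

Lemma Ex_N q f : is_density q -> bmeas f -> Ex q (fun x => - f x) = - Ex q f.
Proof.
move=> dq bf; rewrite -mulN1r -Ex_Z//; congr Ex.
by apply/funext => x; rewrite mulN1r.
Qed.

Lemma Ex_B q f g : is_density q -> bmeas f -> bmeas g ->
  Ex q (fun x => f x - g x) = Ex q f - Ex q g.
Proof. by move=> dq bf bg; rewrite Ex_D ?Ex_N//; exact: bmeasN. Qed.

Lemma Ex_cst q c : is_density q -> Ex q (fun=> c) = c.
Proof.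
move=> dq; rewrite (_ : (fun=> c) = fun x : R => c * (fun=> 1) x); last first.
  by apply/funext => x; rewrite mulr1.
rewrite Ex_Z//; last exact: bmeas_cst.
rewrite /Ex (_ : Rintegral _ _ _ = Rintegral leb Tor q).
  by rewrite /Rintegral dq.2.2 /= mulr1.
by apply: eq_Rintegral => x _; rewrite mulr1.
Qed.

Lemma Ex_sum q (I : Type) (s : seq I) (P : pred I) (F : I -> R -> R) :
  is_density q -> (forall i, P i -> bmeas (F i)) ->
  Ex q (fun x => \sum_(i <- s | P i) F i x) = \sum_(i <- s | P i) Ex q (F i).
Proof.
move=> dq bF; elim: s => [|i s IH].
  rewrite big_nil -[RHS](Ex_cst 0 dq); congr Ex.
  by apply/funext => x; rewrite big_nil.
case: (boolP (P i)) => Pi; last first.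
  rewrite big_cons (negPf Pi) -IH; congr Ex.
  by apply/funext => x; rewrite big_cons (negPf Pi).
rewrite big_cons Pi -IH -Ex_D//; [|exact: bF|exact: bmeas_sum].
by congr Ex; apply/funext => x; rewrite big_cons Pi.
Qed.

Lemma Ex_le q f g : is_density q -> bmeas f -> bmeas g ->
  (forall x, Tor x -> f x <= g x) -> Ex q f <= Ex q g.
Proof.
move=> dq bf bg fg; apply: le_Rintegral; try exact: densityM_integrable.
  exact: measurable_Tor.
by move=> x Tx; rewrite ler_wpM2l ?fg// dq.2.1.
Qed.

Lemma Ex_eq q f g : (forall x, Tor x -> f x = g x) -> Ex q f = Ex q g.
Proof. by move=> fg; apply: eq_Rintegral => x /set_mem Tx; rewrite fg. Qed.

Lemma Ex_dist q f g e : is_density q -> bmeas f -> bmeas g ->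
  (forall x, Tor x -> `|f x - g x| <= e) -> `|Ex q f - Ex q g| <= e.
Proof.
move=> dq bf bg fg; rewrite -Ex_B// ler_norml -{1}[- e](Ex_cst _ dq).
rewrite -{2}[e](Ex_cst _ dq); apply/andP; split; apply: Ex_le => //;
  try exact: bmeas_cst; try exact: bmeasB.
  by move=> x /fg; rewrite ler_norml => /andP[].
by move=> x /fg; rewrite ler_norml => /andP[].
Qed.

Lemma q_u_density : is_density q_u.
Proof.
split; first exact: measurable_cst.
split; first by move=> x _; rewrite ler01.
transitivity (1%:E * leb Tor)%E; last by rewrite leb_Tor mul1e.
exact: (integral_cst leb measurable_Tor 1).
Qed.

Definition E1 f := Ex q_u f.

Lemma E1E f : E1 f = Rintegral leb Tor f.
Proof. by apply: eq_Rintegral => x _; rewrite /q_u mul1r. Qed.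

End BoundedMeasurable.

(** * Trigonometric integrals and orthogonality *)

Section TrigIntegrals.
Variable R : realType.
Local Notation Tor := (@Defs.Tor R).
Local Notation leb := (@Defs.leb R).
Local Notation E1 := (@E1 R).

Lemma continuous_integrable_itv (f : R -> R) (a b : R) : continuous f ->
  leb.-integrable (`[a, b]%classic) (EFin \o f).
Proof.
move=> cf; apply: continuous_compact_integrable; first exact: segment_compact.
by apply: continuous_subspaceT.
Qed.

Lemma Rintegral_FTC (F f : R -> R) (a b : R) : a < b ->
  {within `[a, b], continuous f} ->
  (forall x : R, is_derive x 1 F (f x)) ->
  Rintegral leb (`[a, b]%classic) f = F b - F a.
Proof.
move=> ab cf dF; rewrite /Rintegral (@continuous_FTC2 _ f F a b ab)//.
  split.
  - by move=> x _; exact: ex_derive.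
  - by apply: cvg_at_right_filter; apply: differentiable_continuous; apply/derivable1_diffP; exact: ex_derive.
  - by apply: cvg_at_left_filter; apply: differentiable_continuous; apply/derivable1_diffP; exact: ex_derive.
by move=> x _; rewrite derive1E; exact: derive_val.
Qed.

Lemma bmeas_integrable (f : R -> R) : bmeas f -> leb.-integrable Tor (EFin \o f).
Proof.
move=> bf; have := densityM_integrable (q_u_density R) bf.
apply: eq_integrable; first exact: measurable_Tor.
by move=> x _; rewrite /= /q_u mul1r.
Qed.

Lemma Rintegral_Tor (f : R -> R) : bmeas f ->
  Rintegral leb Tor f = Rintegral leb (`[(- (1/2)), (1/2)]%classic) f.
Proof. by move=> bf; apply: Rintegral_itv_bndo_bndc; exact: bmeas_integrable.
Qed.

Lemma is_derive_sinZ (c x : R) : is_derive x 1 (fun x => sin (c * x)) (c * cos (c * x)).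
Proof.
have -> : (fun x => sin (c * x)) = sin \o (fun x => c * x) by [].
have h : is_derive x 1 (fun x : R => c * x) c.
  by apply: is_derive_eq; rewrite /GRing.scale /= mulr1.
have := @is_derive1_comp _ sin (fun x => c * x) x _ _ (is_derive_sin (c * x)) h.
by rewrite mulrC.
Qed.

Lemma is_derive_cosZ (c x : R) : is_derive x 1 (fun x => cos (c * x)) (- (c * sin (c * x))).
Proof.
have -> : (fun x => cos (c * x)) = cos \o (fun x => c * x) by [].
have h : is_derive x 1 (fun x : R => c * x) c.
  by apply: is_derive_eq; rewrite /GRing.scale /= mulr1.
have := @is_derive1_comp _ cos (fun x => c * x) x _ _ (is_derive_cos (c * x)) h.
by rewrite mulNr mulrC.
Qed.

Lemma continuous_sinZ (c : R) : continuous (fun x => sin (c * x)).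
Proof.
move=> x; apply: differentiable_continuous; apply/derivable1_diffP.
by apply: ex_derive; exact: is_derive_sinZ.
Qed.

Lemma continuous_cosZ (c : R) : continuous (fun x => cos (c * x)).
Proof.
move=> x; apply: differentiable_continuous; apply/derivable1_diffP.
by apply: ex_derive; exact: is_derive_cosZ.
Qed.

Lemma sin_natpi k : sin (pi * k%:R) = 0 :> R.
Proof.
elim: k => [|k IH]; first by rewrite mulr0 sin0.
by rewrite -natr1 mulrDr mulr1 sinDpi IH oppr0.
Qed.

Lemma sin_intpi (m : int) : sin (pi * m%:~R) = 0 :> R.
Proof.
case: m => k; first exact: sin_natpi.
by rewrite NegzE mulrNz mulrN sinN sin_natpi oppr0.
Qed.

(** Integer frequencies absorb the differences [i - j] produced by the product formulas, without a
    case split on their sign. *)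
Lemma E1_cosz (m : int) : E1 (fun x => cos (2 * pi * m%:~R * x)) = (m == 0)%:R.
Proof.
have [->|m0] := eqVneq m 0.
  rewrite [LHS](@Ex_eq _ _ _ (fun=> 1)); first exact/Ex_cst/q_u_density.
  by move=> x _; rewrite mulr0 mul0r cos0.
rewrite E1E Rintegral_Tor; last by apply: bmeas_cos; apply: measurable_funM.
have c0 : 2 * pi * m%:~R != 0 :> R.
  by rewrite !mulf_neq0// ?intr_eq0// gt_eqF// pi_gt0.
set c := 2 * pi * m%:~R in c0 *.
have dF (x : R) : is_derive x 1 (fun x => c^-1 * sin (c * x)) (cos (c * x)).
  have h := is_derive_sinZ c x.
  by apply: is_derive_eq; rewrite /GRing.scale /= mulKf.
rewrite (Rintegral_FTC _ _ dF).
- have h : c * (1/2) = pi * m%:~R by rewrite /c; field.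
  by rewrite mulrN sinN h sin_intpi oppr0 subrr.
- by lra.
- by apply: continuous_subspaceT; exact: continuous_cosZ.
Qed.

Lemma E1_sinz (m : int) : E1 (fun x => sin (2 * pi * m%:~R * x)) = 0.
Proof.
have [->|m0] := eqVneq m 0.
  rewrite [LHS](@Ex_eq _ _ _ (fun=> 0)); first exact/Ex_cst/q_u_density.
  by move=> x _; rewrite mulr0 mul0r sin0.
rewrite E1E Rintegral_Tor; last by apply: bmeas_sin; apply: measurable_funM.
have c0 : 2 * pi * m%:~R != 0 :> R.
  by rewrite !mulf_neq0// ?intr_eq0// gt_eqF// pi_gt0.
set c := 2 * pi * m%:~R in c0 *.
have dF (x : R) : is_derive x 1 (fun x => - c^-1 * cos (c * x)) (sin (c * x)).
  have h := is_derive_cosZ c x.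
  by apply: is_derive_eq; rewrite /GRing.scale /= mulNr mulrN opprK mulKf.
rewrite (Rintegral_FTC _ _ dF).
- by rewrite mulrN cosN subrr.
- by lra.
- by apply: continuous_subspaceT; exact: continuous_sinZ.
Qed.

Lemma E1_cs k : (0 < k)%N -> E1 (@cs R k) = 0.
Proof. by case: k => // k _; have := E1_cosz k.+1%:Z. Qed.

Lemma E1_sn k : E1 (@sn R k) = 0.
Proof. exact: (E1_sinz k%:Z). Qed.

Lemma cosMcos (a b : R) : cos a * cos b = (cos (a - b) + cos (a + b)) / 2.
Proof. by rewrite cosB cosD; field. Qed.

Lemma sinMsin (a b : R) : sin a * sin b = (cos (a - b) - cos (a + b)) / 2.
Proof. by rewrite cosB cosD; field. Qed.

Lemma sinMcos (a b : R) : sin a * cos b = (sin (a - b) + sin (a + b)) / 2.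
Proof. by rewrite sinB sinD; field. Qed.

Let bmc (m : int) : bmeas (fun x : R => cos (2 * pi * m%:~R * x)).
Proof. by apply: bmeas_cos; apply: measurable_funM. Qed.

Let bms (m : int) : bmeas (fun x : R => sin (2 * pi * m%:~R * x)).
Proof. by apply: bmeas_sin; apply: measurable_funM. Qed.

Lemma E1_cscs i j : (0 < i)%N -> (0 < j)%N ->
  E1 (fun x => cs i x * cs j x) = (i == j)%:R / 2.
Proof.
move=> i0 j0; pose f (x : R) := 2^-1 * (cos (2 * pi * (i%:Z - j%:Z)%:~R * x)
  + cos (2 * pi * (i%:Z + j%:Z)%:~R * x)).
transitivity (E1 f).
  apply: Ex_eq => x _; rewrite /cs /f cosMcos mulrC; congr (_ * (cos _ + cos _)).
    by rewrite intrB -!pmulrn; ring.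
  by rewrite intrD -!pmulrn; ring.
rewrite /E1 Ex_Z ?Ex_D//; [|exact: q_u_density..|exact: bmeasD].
rewrite -!/(E1 _) !E1_cosz subr_eq0 eqz_nat mulrC; congr (_ / _).
have -> : (i%:Z + j%:Z == 0) = false by rewrite -PoszD eqz_nat addn_eq0 (gtn_eqF i0).
by rewrite addr0.
Qed.

Lemma E1_snsn i j : (0 < i)%N -> (0 < j)%N ->
  E1 (fun x => sn i x * sn j x) = (i == j)%:R / 2.
Proof.
move=> i0 j0; pose f (x : R) := 2^-1 * (cos (2 * pi * (i%:Z - j%:Z)%:~R * x)
  - cos (2 * pi * (i%:Z + j%:Z)%:~R * x)).
transitivity (E1 f).
  apply: Ex_eq => x _; rewrite /sn /f sinMsin mulrC; congr (_ * (cos _ - cos _)).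
    by rewrite intrB -!pmulrn; ring.
  by rewrite intrD -!pmulrn; ring.
rewrite /E1 Ex_Z ?Ex_B//; [|exact: q_u_density..|exact: bmeasB].
rewrite -!/(E1 _) !E1_cosz subr_eq0 eqz_nat mulrC; congr (_ / _).
have -> : (i%:Z + j%:Z == 0) = false by rewrite -PoszD eqz_nat addn_eq0 (gtn_eqF i0).
by rewrite subr0.
Qed.

Lemma E1_sncs i j : E1 (fun x => sn i x * cs j x) = 0.
Proof.
pose f (x : R) := 2^-1 * (sin (2 * pi * (i%:Z - j%:Z)%:~R * x)
  + sin (2 * pi * (i%:Z + j%:Z)%:~R * x)).
transitivity (E1 f).
  apply: Ex_eq => x _; rewrite /sn /cs /f sinMcos mulrC; congr (_ * (sin _ + sin _)).
    by rewrite intrB -!pmulrn; ring.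
  by rewrite intrD -!pmulrn; ring.
rewrite /E1 Ex_Z ?Ex_D//; [|exact: q_u_density..|exact: bmeasD].
by rewrite -!/(E1 _) !E1_sinz addr0 mulr0.
Qed.

End TrigIntegrals.

(** * The threshold equation *)

Section Calculus.
Variable R : realType.
Implicit Types (a b x : R) (f df : R -> R).

Lemma derive_within f df a b : (forall x, is_derive x 1 f (df x)) ->
  {within `[a, b], continuous f}.
Proof.
move=> dF; apply: continuous_subspaceT => x.
apply: differentiable_continuous; apply/derivable1_diffP.
exact: ex_derive.
Qed.

Lemma derive_ge0_le f df a b : a <= b -> (forall x, is_derive x 1 f (df x)) ->
  (forall x, a < x < b -> 0 <= df x) -> f a <= f b.
Proof.
rewrite le_eqVlt => /predU1P[->//|ab] dF df0.
have [c cab E] := MVT ab (fun x _ => dF x) (derive_within dF).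
rewrite -subr_ge0 E mulr_ge0// ?subr_ge0 ?(ltW ab)//.
by apply: df0; move: cab; rewrite in_itv.
Qed.

Lemma derive_gt0_lt f df a b : a < b -> (forall x, is_derive x 1 f (df x)) ->
  (forall x, a < x < b -> 0 < df x) -> f a < f b.
Proof.
move=> ab dF df0.
have [c cab E] := MVT ab (fun x _ => dF x) (derive_within dF).
rewrite -subr_gt0 E mulr_gt0// ?subr_gt0//.
by apply: df0; move: cab; rewrite in_itv.
Qed.

Lemma cos_lt1 x : 0 < x <= pi -> cos x < 1.
Proof.
move=> /andP[x0 xpi]; rewrite -(@cos0 R) ltr_cos// in_itv /= ?lexx ?pi_ge0//.
by rewrite (ltW x0).
Qed.

Lemma sin_le x : 0 <= x -> sin x <= x.
Proof.
move=> x0; rewrite -subr_ge0.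
have dF (y : R) : is_derive y 1 (fun y : R => y - sin y) (1 - cos y).
  by apply: is_derive_eq.
have := derive_ge0_le x0 dF; rewrite sin0 subr0; apply => y _.
by rewrite subr_ge0 cos_le1.
Qed.

Lemma sin_lt x : 0 < x -> sin x < x.
Proof.
move=> x0; have [xpi|pix] := leP x pi.
  rewrite -subr_gt0.
  have dF (y : R) : is_derive y 1 (fun y : R => y - sin y) (1 - cos y).
    by apply: is_derive_eq.
  have := derive_gt0_lt x0 dF; rewrite sin0 subr0; apply => y /andP[y0 yx].
  by rewrite subr_gt0 cos_lt1// y0 (le_trans (ltW yx)).
apply: le_lt_trans (sin_le1 x) _; apply: lt_le_trans (ltW pix).
by apply: lt_le_trans (@pi_ge2 R); lra.
Qed.

Lemma abs_sin_le x : `|sin x| <= `|x|.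
Proof.
wlog x0 : x / 0 <= x.
  move=> H; have [/H//|x0] := leP 0 x.
  by rewrite -normrN -sinN -(normrN x) H// oppr_ge0 ltW.
rewrite (ger0_norm x0) ler_norml sin_le// andbT lerNl -sinN.
have dF (y : R) : is_derive y 1 (fun y : R => y + sin y) (1 + cos y).
  by apply: is_derive_eq.
have := derive_ge0_le x0 dF; rewrite sin0 addr0 sinN => H.
by rewrite lerNl -subr_ge0 opprK addrC; apply: H => y _; have := cos_geN1 y; lra.
Qed.

Lemma one_sub_cos x : 1 - cos x = 2 * sin (x / 2) ^+ 2.
Proof.
have {1}-> : x = (x / 2) *+ 2 by rewrite mulr2n; field.
by rewrite cos_mulr2n cos2sin2; ring.
Qed.

Lemma sin_ge_cubic x : 0 <= x -> x - x ^+ 3 / 6 <= sin x.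
Proof.
move=> x0; rewrite -subr_ge0.
have dF (y : R) : is_derive y 1 (fun y : R => sin y - (y - y ^+ 3 / 6)) (cos y - (1 - y ^+ 2 / 2)).
  by apply: is_derive_eq; rewrite /GRing.scale /=; field.
have := derive_ge0_le x0 dF; rewrite sin0 expr0n /= mul0r !subr0; apply => y _.
have h := one_sub_cos y.
have : sin (y / 2) ^+ 2 <= (y / 2) ^+ 2.
  by rewrite -[leLHS]real_normK ?num_real// -[leRHS]real_normK ?num_real// lerXn2r ?nnegrE// abs_sin_le.
by move: h; set s := sin _; nra.
Qed.

(** Trades a squared distance on the circle for a trigonometric polynomial of degree 1, which
    integrates exactly against the Fejér kernel. *)
Lemma sqr_le_one_sub_cos x : `|x| <= 1 / 2 -> x ^+ 2 <= 2 * (1 - cos (2 * pi * x)).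
Proof.
wlog x0 : x / 0 <= x.
  move=> H; have [/H//|x0] := leP 0 x.
  rewrite -normrN => /H; rewrite oppr_ge0 sqrrN mulrN cosN; apply; exact: ltW.
rewrite ger0_norm// => x12.
rewrite one_sub_cos (_ : 2 * pi * x / 2 = pi * x); last by field.
have pi2 := @pi_ge2 R; have pi4 := @pihalf_lt2 R.
have hs : 0 <= pi * x by rewrite mulr_ge0 ?pi_ge0.
have h2 : pi * x <= 2 by nra.
have := sin_ge_cubic hs; set y := pi * x in hs h2 *; set s := sin y => hc.
(* On [0, 2] the cubic term [y ^+ 3 / 6] is at most [2 * y / 3]. *)
have h3 : y / 3 <= s by apply: le_trans hc; nra.
have h4 : x <= y / 2 by rewrite /y; nra.
have : (2 / 3 * x) ^+ 2 <= s ^+ 2 by rewrite lerXn2r ?nnegrE//; lra.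
by nra.
Qed.

Lemma abs_sin_natM k x : `|sin (k%:R * x)| <= k%:R * `|sin x|.
Proof.
elim: k => [|k IH]; first by rewrite !mul0r sin0 normr0.
rewrite -natr1 mulrDl mul1r sinD (le_trans (ler_normD _ _))// mulrDl mul1r !normrM.
by rewrite lerD// ?ler_piMr// ?ler_piMl// ?cos_max//; apply: le_trans IH; rewrite ler_piMr// cos_max.
Qed.

End Calculus.

Section Threshold.
Variable R : realType.
Implicit Types (x r : R).

(* Up to a positive factor, [thr r] is [\hat W(1) / 2 - \hat W(2)]. *)
Definition thr x : R := x - sin x * (2 - cos x).

(** The factor [cos x] gives the shape of [thr]: it decreases from 0 up to [pi / 2] and increases
    from there to [pi], so its only sign change inside (0, pi) is at its zero on the increasing
    branch. *)
Lemma is_derive_thr x : is_derive x 1 thr (2 * cos x * (cos x - 1)).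
Proof.
rewrite /thr; apply: is_derive_eq; rewrite /GRing.scale /=.
by have := cos2Dsin2 x; move: (cos x) (sin x) => c s h; nra.
Qed.

Lemma thr_lt0_pihalf x : 0 < x <= pi / 2 -> thr x < 0.
Proof.
move=> /andP[x0 xp]; have t0 : thr 0 = 0 by rewrite /thr sin0 mul0r subr0.
rewrite -t0 -ltrN2.
have dF (y : R) : is_derive y 1 (fun y : R => - thr y) (- (2 * cos y * (cos y - 1))).
  by have h := is_derive_thr y; apply: is_derive_eq.
apply: (derive_gt0_lt x0 dF) => y /andP[y0 yx].
have c0 : 0 < cos y.
  apply: cos_gt0_pihalf; rewrite (lt_le_trans yx xp) andbT.
  by apply: lt_trans y0; rewrite oppr_lt0 divr_gt0// pi_gt0.
have c1 : cos y < 1.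
  apply: cos_lt1; rewrite y0 /= (le_trans (ltW yx))// (le_trans xp)//.
  by have := pi_ge0 R; lra.
by nra.
Qed.

Lemma cos_lt0_pihalf x : pi / 2 < x <= pi -> cos x < 0.
Proof.
move=> /andP[x0 xp]; rewrite -(@cos_pihalf R) ltr_cos// in_itv /=; have := pi_ge0 R; lra.
Qed.

Lemma thr_lt x y : pi / 2 <= x -> x < y -> y <= pi -> thr x < thr y.
Proof.
move=> px xy yp; apply: (derive_gt0_lt xy (@is_derive_thr)) => z /andP[xz zy].
have := @cos_lt0_pihalf z; rewrite (le_lt_trans px xz) (le_trans (ltW zy) yp) => /(_ isT).
by nra.
Qed.

Variables (Rstar : R) (HRstar : 0 < Rstar < pi)
  (HRstar_eq : Rstar = sin Rstar * (2 - cos Rstar)).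

Lemma thr_Rstar : thr Rstar = 0.
Proof. by rewrite /thr -HRstar_eq subrr. Qed.

Lemma pihalf_lt_Rstar : pi / 2 < Rstar.
Proof.
rewrite ltNge; apply/negP => h; have := @thr_lt0_pihalf Rstar.
by case/andP: HRstar => -> _; rewrite h thr_Rstar ltxx => /(_ isT).
Qed.

Lemma thr_lt0 r : 0 < r < Rstar -> thr r < 0.
Proof.
case/andP=> r0 rR; have [h|h] := leP r (pi / 2).
  by apply: thr_lt0_pihalf; rewrite r0.
by rewrite -thr_Rstar thr_lt// ?(ltW h)//; case/andP: HRstar => _ /ltW.
Qed.

Lemma thr_ge0 r : Rstar <= r <= pi -> 0 <= thr r.
Proof.
case/andP; rewrite le_eqVlt => /predU1P[<- _|h rp]; first by rewrite thr_Rstar.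
by rewrite -thr_Rstar ltW// thr_lt// ltW// pihalf_lt_Rstar.
Qed.

Lemma cos_lt0_Rstar r : Rstar <= r <= pi -> cos r < 0.
Proof.
case/andP=> h rp; apply: cos_lt0_pihalf; rewrite rp andbT.
exact: lt_le_trans pihalf_lt_Rstar h.
Qed.

End Threshold.

(** * The Hegselmann-Krause kernel and its Fourier coefficients *)

Section Kernel.
Variable R : realType.
Local Notation Tor := (@Defs.Tor R).
Local Notation leb := (@Defs.leb R).
Implicit Types (x y r : R).

(* [W_HK] without the periodization; continuous on the whole line, unlike [trep]. *)
Definition Wt r y := Num.max (r - 2 * pi * `|y|) 0 ^+ 2.

Lemma trepE x : exists n : int, trep x = x - n%:~R.
Proof. by exists (Num.floor (x + 1/2)). Qed.

Lemma trep_bound x : - (1/2) <= trep x < 1/2.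
Proof.
rewrite /trep; have := floor_itv (x + 1/2); rewrite intrD.
move: (Num.floor _)%:~R => n; lra.
Qed.

Lemma trep_abs x : `|trep x| <= 1/2.
Proof. by rewrite ler_norml; have := trep_bound x; lra. Qed.

(** So [|trep x|] is the distance from [x] to the integers: two distinct integers are at least 1
    apart and the chosen one is within 1/2. *)
Lemma trep_min x (n : int) : `|trep x| <= `|x - n%:~R|.
Proof.
have [m mE] := trepE x; have := trep_bound x; rewrite mE.
have [->//|nm] := eqVneq n m.
have : (1 : R) <= `|m%:~R - n%:~R|.
  by rewrite -intrB norm_intr_ge1// intr_eq0 subr_eq0 eq_sym.
move=> h1 h2.
have h3 : `|x - m%:~R| <= 1/2 by rewrite ler_norml; lra.
have := ler_normD (x - n%:~R) (- (x - m%:~R)); rewrite normrN.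
rewrite (_ : x - n%:~R + - (x - m%:~R) = m%:~R - n%:~R); last by ring.
by lra.
Qed.

Lemma trep_Tor x : Tor x -> trep x = x.
Proof.
rewrite /Defs.Tor /= in_itv /= => h; rewrite /trep.
have -> : Num.floor (x + 1/2) = 0; last by rewrite subr0.
by apply: floor_def; rewrite add0r; lra.
Qed.

Lemma trepN_abs x : `|trep (- x)| = `|trep x|.
Proof.
apply/eqP; rewrite eq_le; apply/andP; split.
  have [m ->] := trepE x; rewrite (_ : `|x - m%:~R| = `|- x - (- m)%:~R|); first exact: trep_min.
  by rewrite -normrN; congr `|_|; rewrite intrN; ring.
have [m ->] := trepE (- x); rewrite (_ : `|- x - m%:~R| = `|x - (- m)%:~R|); first exact: trep_min.
by rewrite -normrN; congr `|_|; rewrite intrN; ring.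
Qed.

Lemma trep_dist x y : `|(`|trep x| - `|trep y|)| <= `|trep (x - y)|.
Proof.
have main (u v : R) : `|trep u| <= `|trep v| + `|trep (u - v)|.
  have [m mE] := trepE v; have [n nE] := trepE (u - v).
  apply: le_trans (trep_min u (m + n)) _; rewrite mE nE.
  apply: le_trans (ler_normD _ _); rewrite intrD le_eqVlt; apply/orP; left.
  by apply/eqP; congr `|_|; ring.
have h1 := main x y; have h2 := main y x.
rewrite -(trepN_abs (y - x)) opprB in h2.
by rewrite ler_norml; lra.
Qed.

Lemma cos_trep x : cos (2 * pi * trep x) = cos (2 * pi * x).
Proof.
have [n ->] := trepE x.
rewrite mulrBr cosB (_ : 2 * pi * n%:~R = pi * (n * 2)%:~R); last first.
  by rewrite intrM; ring.
rewrite sin_intpi mulr0 addr0 (_ : cos (pi * _) = 1) ?mulr1//.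
rewrite (_ : pi * (n * 2)%:~R = (pi * n%:~R) *+ 2); last by rewrite intrM mulr2n; ring.
by rewrite cos_mulr2n cos2sin2 sin_intpi; lra.
Qed.

Lemma WtE r x : W_HK r x = Wt r (trep x).
Proof. by []. Qed.

Lemma Wt_ge0 r y : 0 <= Wt r y. Proof. exact: sqr_ge0. Qed.

Lemma Wt_le r y : 0 < r -> Wt r y <= r ^+ 2.
Proof.
move=> r0; rewrite /Wt lerXn2r ?nnegrE ?le_max ?lexx ?orbT ?(ltW r0)//.
by rewrite ge_max (ltW r0) andbT gerBl !mulr_ge0// pi_ge0.
Qed.

Lemma Wt_lip r x y : 0 < r ->
  `|Wt r x - Wt r y| <= 2 * r * (2 * pi * `|(`|x| - `|y|)|).
Proof.
move=> r0; rewrite /Wt subr_sqr normrM mulrC.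
have b (z : R) : 0 <= Num.max (r - 2 * pi * `|z|) 0 <= r.
  rewrite le_max lexx orbT /= ge_max (ltW r0) andbT gerBl !mulr_ge0//.
  exact: pi_ge0.
have := b x; have := b y.
have h : `|Num.max (r - 2 * pi * `|x|) 0 - Num.max (r - 2 * pi * `|y|) 0|
    <= 2 * pi * `|(`|x| - `|y|)|.
  have -> : 2 * pi * `|(`|x| - `|y|)| = `|(r - 2 * pi * `|x|) - (r - 2 * pi * `|y|)|.
    rewrite (_ : r - 2 * pi * `|x| - (r - 2 * pi * `|y|) = - (2 * pi * (`|x| - `|y|))); last by ring.
    by rewrite normrN normrM (ger0_norm (mulr_ge0 _ (pi_ge0 _))).
  move: (r - _) (r - _) => u v.
  have h1 := ler_norm (u - v); have h2 := ler_norm (v - u).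
  have h3 := distrC v u; rewrite !maxElt.
  case: (ltP u 0) => hu; case: (ltP v 0) => hv; rewrite ?subrr ?normr0//.
    by rewrite ler_norml; lra.
  by rewrite ler_norml; lra.
move: h; move: (Num.max _ _) (Num.max _ _) => u v h hv hu.
apply: ler_pM => //; rewrite ger0_norm; lra.
Qed.

Lemma bmeas_eq (f g : R -> R) : (forall x, Tor x -> f x = g x) -> bmeas g -> bmeas f.
Proof.
move=> fg [mg [M Mg]]; split.
  by apply: eq_measurable_fun mg => x /set_mem Tx; rewrite fg.
by exists M => x Tx; rewrite fg// Mg.
Qed.

Lemma continuous_Wt r : continuous (Wt r).
Proof.
pose u y := r - 2 * pi * `|y|.
have uc : continuous u.
  move=> x; apply: cvgB; first exact: cvg_cst.
  by apply: cvgM; [exact: cvg_cst|exact: norm_continuous].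
have -> : Wt r = fun y => ((u y + `|u y|) / 2) * ((u y + `|u y|) / 2).
  apply/funext => y; rewrite /Wt -/(u y) -expr2; congr (_ ^+ 2).
  by case: leP => h; [rewrite ler0_norm//|rewrite gtr0_norm//]; lra.
have vc : continuous (fun y => (u y + `|u y|) / 2).
  move=> x; apply: cvgM; last exact: cvg_cst.
  by apply: cvgD; [exact: uc|apply: continuous_comp; [exact: uc|exact: norm_continuous]].
by move=> x; apply: cvgM; exact: vc.
Qed.

Lemma bmeas_W r : 0 < r -> bmeas (W_HK r).
Proof.
move=> r0; apply: (@bmeas_eq _ (Wt r)).
  by move=> x Tx; rewrite WtE trep_Tor.
split; first by apply: measurable_funTS; apply: continuous_measurable_fun; exact: continuous_Wt.
by exists (r ^+ 2) => x _; rewrite ger0_norm ?Wt_ge0 ?Wt_le.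
Qed.

Lemma WtN r y : Wt r (- y) = Wt r y.
Proof. by rewrite /Wt normrN. Qed.

End Kernel.

Section FourierCoefficients.
Variable R : realType.
Local Notation Tor := (@Defs.Tor R).
Local Notation leb := (@Defs.leb R).
Local Notation E1 := (@E1 R).
Variables (r : R) (Hr : 0 < r <= pi).

Let r0 : 0 < r. Proof. by case/andP: Hr. Qed.

Definition wh (k : nat) : R := 2 * (k%:R * r - sin (k%:R * r)) / (pi * k%:R ^+ 3).

Lemma Rintegral_split (f : R -> R) (a b c : R) : continuous f -> a <= b -> b <= c ->
  Rintegral leb (`[a, c]%classic) f =
  Rintegral leb (`[a, b]%classic) f + Rintegral leb (`[b, c]%classic) f.
Proof.
move=> cf ab bc; have := @Rintegral_itvB R f (BLeft a) (BRight c) b (continuous_integrable_itv a c cf).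
rewrite !bnd_simp => /(_ ab bc).
rewrite Rintegral_itv_obnd_cbnd; last first.
  apply: (integrableS _ _ _ (continuous_integrable_itv b c cf)); try exact: measurable_itv.
  by move=> x /=; rewrite !in_itv /= => /andP[/ltW -> ->].
by move=> <-; rewrite addrCA subrr addr0.
Qed.

Lemma Rintegral_opp (f : R -> R) (a : R) : continuous f -> 0 <= a ->
  Rintegral leb (`[- a, 0]%classic) f = Rintegral leb (`[0, a]%classic) (fun x => f (- x)).
Proof.
move=> cf a0; have := @integration_by_substitution_oppr R f 0 a a0.
rewrite oppr0 => /(_ (continuous_subspaceT cf)) h.
by rewrite /Rintegral h.
Qed.

Lemma Rintegral_Tor_cont (f : R -> R) : continuous f -> bmeas f ->
  Rintegral leb Tor f = Rintegral leb (`[0, 1/2]%classic) (fun x => f (- x) + f x).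
Proof.
move=> cf bf; rewrite Rintegral_Tor// (@Rintegral_split _ _ 0)//; try lra.
have h0 : 0 <= 1/2 :> R by lra.
rewrite (Rintegral_opp cf h0) -RintegralD//; last exact: continuous_integrable_itv.
apply: (@continuous_integrable_itv _ (fun x => f (- x))).
by move=> x; apply: continuous_comp; [exact: oppr_continuous|exact: cf].
Qed.

Lemma bmeas_Wt : bmeas (Wt r).
Proof.
apply: bmeas_eq (bmeas_W r0) => x Tx.
by rewrite WtE trep_Tor.
Qed.

Lemma continuous_Wtcs k : continuous (fun x => Wt r x * cs k x).
Proof. by move=> x; apply: cvgM; [exact: continuous_Wt|exact: continuous_cosZ]. Qed.

Lemma continuous_Wtsn k : continuous (fun x => Wt r x * sn k x).
Proof. by move=> x; apply: cvgM; [exact: continuous_Wt|exact: continuous_sinZ]. Qed.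

Lemma fcosE' k : fcos (W_HK r) k = E1 (fun x => W_HK r x * cs k x).
Proof. by rewrite E1E. Qed.

Lemma fsinE' k : fsin (W_HK r) k = E1 (fun x => W_HK r x * sn k x).
Proof. by rewrite E1E. Qed.

Lemma fsinE k : fsin (W_HK r) k = 0.
Proof.
rewrite fsinE' (_ : E1 _ = E1 (fun x => Wt r x * sn k x)); last first.
  by apply: Ex_eq => x Tx; rewrite WtE trep_Tor.
rewrite E1E Rintegral_Tor_cont; [|exact: continuous_Wtsn|].
  rewrite (_ : (fun x => _) = cst 0) ?Rintegral_cst ?mul0r//.
  by apply/funext => x; rewrite WtN /sn mulrN sinN mulrN addNr.
by apply: bmeasM; [exact: bmeas_Wt|exact: bmeas_sn].
Qed.

Lemma fcosE k : (0 < k)%N -> fcos (W_HK r) k = wh k.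
Proof.
move=> k0; rewrite fcosE' (_ : E1 _ = E1 (fun x => Wt r x * cs k x)); last first.
  by apply: Ex_eq => x Tx; rewrite WtE trep_Tor.
rewrite E1E Rintegral_Tor_cont; [|exact: continuous_Wtcs|]; last first.
  by apply: bmeasM; [exact: bmeas_Wt|exact: bmeas_cs].
rewrite (_ : (fun x => _) = fun x => 2 * (Wt r x * cs k x)); last first.
  by apply/funext => x; rewrite WtN /cs mulrN cosN; ring.
have cg := @continuous_Wtcs k.
rewrite RintegralZl//; last exact: continuous_integrable_itv.
have pi0 := pi_gt0 R.
(* Half-width of the support of [Wt r]; [r <= pi] keeps the support inside the torus. *)
pose rho := r / (2 * pi).
have rho0 : 0 < rho by rewrite divr_gt0// mulr_gt0.
have rhoE : 2 * pi * rho = r by rewrite /rho; field; lra.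
have rho12 : rho <= 1/2.
  by rewrite /rho ler_pdivrMr ?mulr_gt0//; case/andP: Hr; lra.
rewrite (@Rintegral_split _ _ rho)//; last exact: ltW.
rewrite [X in _ + X](_ : _ = 0); last first.
  rewrite (_ : 0 = Rintegral leb (`[rho, 1/2]%classic) (cst 0)); last first.
    by rewrite Rintegral_cst// mul0r.
  apply: eq_Rintegral => x /set_mem /=; rewrite in_itv /= => /andP[rx _].
  rewrite /Wt (_ : Num.max _ _ = 0) ?expr0n ?mul0r//.
  apply/max_idPr; rewrite ger0_norm; last by lra.
  have : 2 * pi * rho <= 2 * pi * x by rewrite ler_wpM2l// mulr_ge0// ltW.
  by rewrite rhoE subr_le0.
rewrite addr0.
pose c : R := 2 * pi * k%:R.
pose f (x : R) := (r - 2 * pi * x) ^+ 2 * cos (c * x).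
rewrite (_ : Rintegral _ _ _ = Rintegral leb (`[0, rho]%classic) f); last first.
  apply: eq_Rintegral => x /set_mem /=; rewrite in_itv /= => /andP[x0 xr].
  rewrite /Wt /f /cs ger0_norm// max_l//.
  by rewrite subr_ge0 -rhoE ler_wpM2l// mulr_ge0// ltW.
have kn0 : k%:R != 0 :> R by rewrite pnatr_eq0 -lt0n.
have c0 : c != 0 by rewrite !mulf_neq0// gt_eqF.
(* Antiderivative of [f] from two integrations by parts. At [rho] the factor [r - 2 * pi * x]
   vanishes and only the last sine term survives; at 0 only the middle term does. *)
pose F (x : R) := (r - 2 * pi * x) ^+ 2 * (c^-1 * sin (c * x))
  + (- (4 * pi / c ^+ 2)) * ((r - 2 * pi * x) * cos (c * x))
  + (- (8 * pi ^+ 2 / c ^+ 3)) * sin (c * x).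
have dF (x : R) : is_derive x 1 F (f x).
  have h1 := is_derive_sinZ c x; have h2 := is_derive_cosZ c x.
  rewrite /F /f; apply: is_derive_eq; rewrite /GRing.scale /=; field.
  by [].
rewrite (Rintegral_FTC rho0 _ dF); last first.
  apply: continuous_subspaceT => x; rewrite /f; apply: cvgM; last exact: continuous_cosZ.
  have h : continuous (fun x : R => r - 2 * pi * x).
    move=> y; apply: cvgB; first exact: cvg_cst.
    by apply: cvgM; [exact: cvg_cst|exact: cvg_id].
  exact: (@cvgM _ _ _ _ _ _ _ _ (h x) (h x)).
rewrite /F rhoE subrr !mulr0 sin0 cos0 (_ : c * rho = k%:R * r); last first.
  by rewrite /c -rhoE; ring.
have pin0 : pi != 0 :> R by rewrite gt_eqF.
rewrite /wh /c; move: pin0; move: (pi : R) => p pin0.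
by field; rewrite kn0 pin0.
Qed.

Lemma wh_gt0 k : (0 < k)%N -> 0 < wh k.
Proof.
move=> k0; have k0' : 0 < k%:R :> R by rewrite ltr0n.
rewrite /wh divr_gt0 ?mulr_gt0 ?exprn_gt0 ?pi_gt0// subr_gt0.
by apply: sin_lt; rewrite mulr_gt0.
Qed.

Lemma wh_le k : (0 < k)%N -> wh k <= 4 / k%:R ^+ 2.
Proof.
move=> k0; have k0' : 0 < k%:R :> R by rewrite ltr0n.
rewrite /wh ler_pdivrMr ?mulr_gt0 ?exprn_gt0 ?pi_gt0//.
have -> : 4 / k%:R ^+ 2 * (pi * k%:R ^+ 3) = 4 * (k%:R * pi) :> R.
  by field; rewrite gt_eqF.
have h := abs_sin_le (k%:R * r); rewrite (ger0_norm (mulr_ge0 (ltW k0') (ltW r0))) in h.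
have h1 : k%:R * r <= k%:R * pi by rewrite ler_wpM2l ?(ltW k0')//; case/andP: Hr.
move: h; rewrite ler_norml => /andP[]; lra.
Qed.

(** After multiplication by [k ^ 3] both sides vanish at [r = 0], and their derivatives in [r]
    compare by [|sin (k x / 2)| <= k |sin (x / 2)|]. Hence the maximum in [Ksharp] is attained at
    mode 1. *)
Lemma wh_le_wh1 k : (0 < k)%N -> wh k <= wh 1.
Proof.
move=> k0; have k0' : 0 < k%:R :> R by rewrite ltr0n.
have piP := pi_gt0 R.
rewrite /wh expr1n mulr1 mul1r ler_pdivrMr ?mulr_gt0 ?exprn_gt0//.
have -> : 2 * (r - sin r) / pi * (pi * k%:R ^+ 3) = 2 * ((r - sin r) * k%:R ^+ 3).
  by have := gt_eqF piP; move: (pi : R) => p p0; field; rewrite p0.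
rewrite ler_pM2l//.
have dF (x : R) : is_derive x 1 (fun x : R => (x - sin x) * k%:R ^+ 3 - (k%:R * x - sin (k%:R * x)))
   ((1 - cos x) * k%:R ^+ 3 - (k%:R - k%:R * cos (k%:R * x))).
  by have h := is_derive_sinZ k%:R x; apply: is_derive_eq; rewrite /GRing.scale /=; ring.
have := derive_ge0_le (ltW r0) dF.
rewrite mulr0 sin0 !subr0 mul0r subr_ge0; apply => x _.
rewrite -{2}[k%:R]mulr1 -mulrBr exprS mulrCA -mulrBr mulr_ge0 ?(ltW k0')//.
rewrite !one_sub_cos.
have -> : k%:R * x / 2 = k%:R * (x / 2) by ring.
have := abs_sin_natM k (x / 2); set a := sin (x / 2); set b := sin _ => h.
have : `|b| ^+ 2 <= (k%:R * `|a|) ^+ 2 by rewrite lerXn2r ?nnegrE ?mulr_ge0// ltW.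
rewrite exprMn !real_normK ?num_real//; nra.
Qed.

Lemma KsharpE : Ksharp (W_HK r) = (2 * wh 1)^-1.
Proof.
rewrite /Ksharp; congr (_ * _)^-1.
set A := image _ _.
have A1 : A (wh 1).
  by exists 1%N; rewrite ?fcosE//; split=> //; split; rewrite ?fsinE// fcosE// wh_gt0.
apply/eqP; rewrite eq_le; apply/andP; split.
  apply: ge_sup; first by exists (wh 1).
  by move=> _ [k [k1 _] <-]; rewrite fcosE// wh_le_wh1.
apply: ub_le_sup => //; exists (wh 1).
by move=> _ [k [k1 _] <-]; rewrite fcosE// wh_le_wh1.
Qed.

Section Compare.
Variables (Rstar : R) (HRstar : 0 < Rstar < pi)
  (HRstar_eq : Rstar = sin Rstar * (2 - cos Rstar)).

Let wh1E : wh 1 * pi = 2 * (r - sin r).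
Proof.
rewrite /wh expr1n mul1r mulr1; have := gt_eqF (pi_gt0 R).
by move: (pi : R) => p p0; field; rewrite p0.
Qed.

Let wh2E : wh 2 * pi = (r - sin r * cos r) / 2.
Proof.
rewrite /wh (mulr_natl r 2) sin_mulr2n; have := gt_eqF (pi_gt0 R).
by move: (pi : R) => p p0; field; rewrite p0.
Qed.

Lemma wh2_gt : r < Rstar -> wh 1 / 2 < wh 2.
Proof.
move=> rR; have := thr_lt0 HRstar HRstar_eq (r := r); rewrite r0 rR => /(_ isT).
rewrite /thr => h; have piP := pi_gt0 R.
by rewrite -(ltr_pM2r piP) (mulrAC (wh 1)) wh1E wh2E; lra.
Qed.

Hypothesis rR : Rstar <= r.
Let rRpi : Rstar <= r <= pi. Proof. by rewrite rR; case/andP: Hr. Qed.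

Lemma wh2_le : wh 2 <= wh 1 / 2.
Proof.
have := thr_ge0 HRstar HRstar_eq rRpi.
rewrite /thr => h; have piP := pi_gt0 R.
by rewrite -(ler_pM2r piP) (mulrAC (wh 1)) wh1E wh2E; lra.
Qed.

(** What matters about 8/9 is that it is below 1: the modes from 3 on then keep a fixed share of the
    entropy. With [s] and [c] the sine and cosine of [r], the input [0 <= thr r] reads
    [s (1 - c) <= r - s]. For [k = 3] it bounds [s ^ 3] in [sin (3 r) = 3 s - 4 s ^ 3]; for [k >= 4]
    it gives [2 s <= r], since [c < 0], and [|sin (k r)| <= k s] suffices. *)
Lemma whk_le k : (3 <= k)%N -> wh k <= 8 / 9 * (wh 1 / k%:R).
Proof.
move=> k3; have k0' : 3 <= k%:R :> R by rewrite ler_nat.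
have h := thr_ge0 HRstar HRstar_eq rRpi; have c0 := cos_lt0_Rstar HRstar HRstar_eq rRpi.
have s0 : 0 <= sin r by apply: sin_ge0_pi; rewrite (ltW r0); case/andP: Hr.
have c1 := cos_geN1 r; have piP := pi_gt0 R.
have knz : k%:R != 0 :> R by rewrite gt_eqF//; lra.
rewrite -(ler_pM2r piP) (_ : 8 / 9 * _ * pi = 8 / 9 * (wh 1 * pi) / k%:R); last by ring.
rewrite wh1E /wh (_ : _ / (pi * _) * pi = 2 * (k%:R * r - sin (k%:R * r)) / k%:R ^+ 3); last first.
  by have := gt_eqF piP; move: (pi : R) => p p0; field; rewrite knz p0.
rewrite ler_pdivrMr; last by rewrite exprn_gt0//; lra.
rewrite (_ : _ / k%:R * k%:R ^+ 3 = 8 / 9 * (2 * (r - sin r)) * k%:R ^+ 2); last by field.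
move: h; rewrite /thr => h.
have [k3E|k4] : k = 3 \/ (4 <= k)%N.
  by move: k3; rewrite leq_eqVlt => /predU1P[<-|]; [left|right].
  rewrite k3E (_ : 3 * r = r *+ 2 + r); last by rewrite mulr2n; ring.
  rewrite sinD sin_mulr2n cos_mulr2n.
  have sc := cos2Dsin2 r; move: (sin r) (cos r) h c0 s0 c1 sc => s c h c0 s0 c1 sc.
  have -> : c * s *+ 2 * c + (c ^+ 2 *+ 2 - 1) * s = 3 * s - 4 * s * s ^+ 2.
    have -> : c ^+ 2 = 1 - s ^+ 2 by lra.
    have -> : c * s *+ 2 * c = c ^+ 2 * s * 2 by ring.
    have -> : c ^+ 2 = 1 - s ^+ 2 by lra.
    by ring.
  have -> : s ^+ 2 = (1 - c) * (1 + c) by move: sc; nra.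
  have h1 : 0 <= s * (1 - c) by rewrite mulr_ge0//; lra.
  have h2 : s * (1 - c) * (1 + c) <= s * (1 - c) by rewrite ler_piMr//; lra.
  have h3 : s * (1 - c) <= r - s by lra.
  by rewrite mulrA; nra.
have k4' : 4 <= k%:R :> R by rewrite ler_nat.
have hs := abs_sin_natM k r; rewrite (ger0_norm s0) ler_norml in hs.
have h1 : 2 * sin r <= r.
  have : 0 <= sin r * - cos r by rewrite mulr_ge0//; lra.
  by lra.
have h2 : k%:R * (2 * sin r) <= k%:R * r by rewrite ler_pM2l//; lra.
have h3 : 2 * (k%:R * r - sin (k%:R * r)) <= 3 * (k%:R * r).
  by case/andP: hs; lra.
apply: le_trans h3 _.
have h4 : r / 2 <= r - sin r by lra.
have h5 : 4 * (k%:R * r) <= k%:R ^+ 2 * r.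
  by rewrite expr2 -mulrA ler_wpM2r// mulr_ge0// (ltW r0).
have h6 : k%:R ^+ 2 * (r / 2) <= k%:R ^+ 2 * (r - sin r) by rewrite ler_wpM2l// sqr_ge0.
have h7 : 0 < k%:R * r by rewrite mulr_gt0//; lra.
by lra.
Qed.

End Compare.
End FourierCoefficients.

(** * Uniform convergence of the Fourier series of the kernel *)

Section Fejer.
Variable R : realType.
Local Notation Tor := (@Defs.Tor R).
Local Notation leb := (@Defs.leb R).
Local Notation E1 := (@E1 R).
Implicit Types (t x y : R).

Lemma cs_sub k x y : cs k (x - y) = cs k x * cs k y + sn k x * sn k y.
Proof. by rewrite /cs /sn mulrBr cosB. Qed.

Lemma abs_cs k t : `|cs k t| <= 1. Proof. exact: cos_max. Qed.

Lemma abs_sn k t : `|sn k t| <= 1. Proof. exact: sin_max. Qed.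

(** The cross term in the step from [N] to [N + 1] of [fejer_square]; reversing the summation turns
    [N - i] into [k]. *)
Lemma cs_sum N t :
  cs N t * (\sum_(i < N) cs i t) + sn N t * (\sum_(i < N) sn i t) =
  \sum_(1 <= k < N.+1) cs k t.
Proof.
rewrite !mulr_sumr -big_split /= big_add1 /= big_mkord.
rewrite (reindex_inj rev_ord_inj) /=; apply: eq_bigr => i _.
have iN : (i.+1 <= N)%N := ltn_ord i.
rewrite /cs /sn -cosB natrB//; congr cos.
by rewrite -natr1; ring.
Qed.

(** The left side is the squared modulus of a sum of [N] consecutive powers of [exp (2 pi i t)],
    which makes the Fejér kernel nonnegative. *)
Lemma fejer_square N t :
  (\sum_(i < N) cs i t) ^+ 2 + (\sum_(i < N) sn i t) ^+ 2 =
  N%:R + 2 * \sum_(1 <= k < N) (N%:R - k%:R) * cs k t.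
Proof.
elim: N => [|N IH]; first by rewrite !big_ord0 big_geq// mulr0 expr0n addr0.
rewrite !big_ord_recr /=.
have -> : \sum_(1 <= k < N.+1) (N.+1%:R - k%:R) * cs k t =
    \sum_(1 <= k < N) (N%:R - k%:R) * cs k t + \sum_(1 <= k < N.+1) cs k t.
  transitivity (\sum_(1 <= k < N.+1) ((N%:R - k%:R) * cs k t + cs k t)).
    by apply: eq_bigr => k _; rewrite -natr1; ring.
  rewrite big_split /=; congr (_ + _); case: N IH => [|N] IH.
    by rewrite !big_geq.
  by rewrite big_nat_recr//= subrr mul0r addr0.
have := cs_sum N t; have := cos2Dsin2 (2 * pi * N%:R * t).
rewrite -/(cs N t) -/(sn N t) -natr1 => h1 h2.
move: IH; rewrite -h2; move: h1; move: (cs N t) (sn N t) => c s h1.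
move: (\sum_(_ < _) _) (\sum_(_ < _) _) (\sum_(_ <= _ < _) _) => S C T h.
have -> : (C + c) ^+ 2 + (S + s) ^+ 2 = (C ^+ 2 + S ^+ 2) + (c ^+ 2 + s ^+ 2) + 2 * (c * C + s * S) by ring.
by rewrite h1 h; ring.
Qed.

Definition fejer N t : R := 1 + 2 * \sum_(1 <= k < N) (1 - k%:R / N%:R) * cs k t.

Lemma fejer_ge0 N t : (0 < N)%N -> 0 <= fejer N t.
Proof.
move=> N0; have N0' : 0 < N%:R :> R by rewrite ltr0n.
rewrite -(pmulr_rge0 _ N0') (_ : N%:R * _ = (\sum_(i < N) cs i t) ^+ 2 + (\sum_(i < N) sn i t) ^+ 2).
  by rewrite addr_ge0// sqr_ge0.
rewrite fejer_square /fejer.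
have -> : \sum_(1 <= k < N) (N%:R - k%:R) * cs k t =
    N%:R * \sum_(1 <= k < N) (1 - k%:R / N%:R) * cs k t.
  rewrite mulr_sumr; apply: eq_bigr => k _; field.
  by rewrite gt_eqF.
by ring.
Qed.

Lemma E1_cosz_shift (m : int) t :
  E1 (fun y => cos (2 * pi * m%:~R * (t - y))) = (m == 0)%:R.
Proof.
pose a := cos (2 * pi * m%:~R * t); pose b := sin (2 * pi * m%:~R * t).
rewrite [LHS](@Ex_eq _ _ _ (fun y => a * cos (2 * pi * m%:~R * y) + b * sin (2 * pi * m%:~R * y))); last first.
  by move=> y _; rewrite mulrBr cosB.
have h1 : bmeas (fun y : R => cos (2 * pi * m%:~R * y)) by apply: bmeas_cos; apply: measurable_funM.
have h2 : bmeas (fun y : R => sin (2 * pi * m%:~R * y)) by apply: bmeas_sin; apply: measurable_funM.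
rewrite Ex_D ?Ex_Z//; [|exact: q_u_density..|exact: bmeasZ|exact: bmeasZ].
rewrite -!/(E1 _) E1_cosz E1_sinz mulr0 addr0 /a.
case: eqP => [->|_]; last by rewrite mulr0.
by rewrite mulr1 (_ : 2 * pi * 0%:~R * t = 0) ?cos0//; ring.
Qed.

Lemma bmeas_cs_shift k t : bmeas (fun y => cs k (t - y)).
Proof. by apply: bmeas_cos; apply: measurable_funM => //; apply: measurable_funB. Qed.

Lemma E1_cs_shift k t : (0 < k)%N -> E1 (fun y => cs k (t - y)) = 0.
Proof. by case: k => // k _; exact: (E1_cosz_shift k.+1%:Z t). Qed.

Lemma E1_cscs1_shift k t : (0 < k)%N ->
  E1 (fun y => cs k (t - y) * cs 1 (t - y)) = (k == 1)%:R / 2.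
Proof.
move=> k0.
have h (m : int) : bmeas (fun y : R => cos (2 * pi * m%:~R * (t - y))).
  by apply: bmeas_cos; apply: measurable_funM => //; apply: measurable_funB.
rewrite [LHS](@Ex_eq _ _ _ (fun y => 2^-1 * (cos (2 * pi * (k%:Z - 1)%:~R * (t - y))
  + cos (2 * pi * (k%:Z + 1)%:~R * (t - y))))); last first.
  move=> y _; rewrite /cs cosMcos mulrC; congr (_ * (cos _ + cos _)).
    by rewrite intrB -!pmulrn; ring.
  by rewrite intrD -!pmulrn; ring.
rewrite Ex_Z ?Ex_D//; [|exact: q_u_density..|exact: bmeasD].
rewrite -!/(E1 _) !E1_cosz_shift subr_eq0 mulrC; congr (_ / _).
have -> : (k%:Z + 1 == 0) = false by rewrite -PoszD eqz_nat addn_eq0 andbF.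
by rewrite addr0.
Qed.

Lemma bmeas_fejer N t : bmeas (fun y => fejer N (t - y)).
Proof.
apply: bmeasD; first exact: bmeas_cst.
by apply: bmeasZ; apply: bmeas_sum => k _; apply: bmeasZ; exact: bmeas_cs_shift.
Qed.

Lemma E1_fejer N t : E1 (fun y => fejer N (t - y)) = 1.
Proof.
have d1 := q_u_density R.
have bS : bmeas (fun y => \sum_(1 <= k < N) (1 - k%:R / N%:R) * cs k (t - y)).
  by apply: bmeas_sum => k _; apply: bmeasZ; exact: bmeas_cs_shift.
rewrite /fejer /E1 Ex_D//; [|exact: bmeas_cst|exact: bmeasZ].
rewrite Ex_cst// Ex_Z// Ex_sum//; last first.
  by move=> k _; apply: bmeasZ; exact: bmeas_cs_shift.
rewrite big_nat_cond big1 ?mulr0 ?addr0// => k /andP[/andP[k1 _] _].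
by rewrite Ex_Z//; [rewrite -/(E1 _) E1_cs_shift// mulr0|exact: bmeas_cs_shift].
Qed.

(** Only mode 1 of the kernel survives. Thus [1 - cs 1] has mean [1 / N] under the Fejér kernel,
    which measures its concentration at [t]. *)
Lemma E1_fejer_cos N t : (0 < N)%N ->
  E1 (fun y => fejer N (t - y) * cs 1 (t - y)) = 1 - N%:R^-1.
Proof.
move=> N0; have d1 := q_u_density R; have bc := bmeas_cs_shift.
rewrite [LHS](@Ex_eq _ _ _ (fun y => cs 1 (t - y) + 2 *
  \sum_(1 <= k < N) (1 - k%:R / N%:R) * (cs k (t - y) * cs 1 (t - y)))); last first.
  move=> y _; rewrite /fejer mulrDl mul1r -mulrA mulr_suml; congr (_ + _ * _).
  by apply: eq_bigr => k _; rewrite mulrA.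
have bM k : bmeas (fun y => cs k (t - y) * cs 1 (t - y)) by apply: bmeasM.
have bS : bmeas (fun y => \sum_(1 <= k < N) (1 - k%:R / N%:R) * (cs k (t - y) * cs 1 (t - y))).
  by apply: bmeas_sum => k _; apply: bmeasZ.
rewrite Ex_D//; last exact: bmeasZ.
rewrite -/(E1 _) E1_cs_shift// add0r Ex_Z// Ex_sum//; last by move=> k _; apply: bmeasZ.
case: N N0 {bS} => // -[_|N _]; first by rewrite big_geq// mulr0 invr1 subrr.
rewrite big_ltn// big_nat_cond big1 => [|k /andP[/andP[k1 _] _]].
  rewrite Ex_Z// -/(E1 _) E1_cscs1_shift// eqxx addr0.
  by rewrite (_ : true%:R = 1 :> R)// mul1r; move: (N.+2%:R^-1 : R) => u; lra.
by rewrite Ex_Z// -/(E1 _) E1_cscs1_shift 1?(leq_trans _ k1)// (gtn_eqF k1) mul0r mulr0.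
Qed.

Lemma sum_inv_sqr_tail N M : (0 < N)%N ->
  \sum_(N <= k < M) (k%:R ^+ 2)^-1 <= 2 / N%:R :> R.
Proof.
move=> N0; have [MN|NM] := leqP M N; first by rewrite big_geq// divr_ge0.
have : \sum_(N <= k < M) (k%:R ^+ 2)^-1 <= 2 * (N%:R^-1 - M%:R^-1) :> R.
  have -> : N%:R^-1 - M%:R^-1 = \sum_(N <= k < M) (- k.+1%:R^-1 - - k%:R^-1) :> R.
    by rewrite (telescope_sumr (fun k => - k%:R^-1) (ltnW NM)) opprK addrC.
  rewrite mulr_sumr !big_nat; apply: ler_sum => k /andP[Nk _].
  have k1 : 1 <= k%:R :> R by rewrite ler1n (leq_trans N0).
  rewrite opprK -natr1 (_ : 2 * _ = 2 / (k%:R * (k%:R + 1))); last by field; lra.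
  rewrite ler_pdivlMr ?mulr_gt0//; try lra.
  rewrite mulrC ler_pdivrMr ?exprn_gt0//; try lra.
  by nra.
move/le_trans; apply; rewrite ler_wpM2l// lerBlDr lerDl invr_ge0.
exact: ler0n.
Qed.

Lemma sumr_abs_le (I : Type) (s : seq I) (P : pred I) (F G : I -> R) :
  (forall i, P i -> `|F i| <= G i) -> `|\sum_(i <- s | P i) F i| <= \sum_(i <- s | P i) G i.
Proof. by move=> h; apply: le_trans (ler_norm_sum _ _ _) _; apply: ler_sum. Qed.

Section Approx.
Variables (r : R) (Hr : 0 < r <= pi).
Let r0 : 0 < r. Proof. by case/andP: Hr. Qed.
Local Notation W := (W_HK r).
Local Notation wh := (wh r).

Definition W0 : R := E1 W.

Lemma W_lip t y : `|W t - W y| <= 4 * pi * r * `|trep (t - y)|.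
Proof.
rewrite !WtE; apply: le_trans (Wt_lip _ _ r0) _.
rewrite (_ : 2 * r * _ = 4 * pi * r * `|(`|trep t| - `|trep y|)|); last by ring.
rewrite ler_wpM2l ?trep_dist// !mulr_ge0 ?pi_ge0//.
exact: ltW.
Qed.

(** Young's inequality [u <= d + u ^ 2 / d] with a scale [d] left free, followed by
    [sqr_le_one_sub_cos]. *)
Lemma W_lip_cos t y d : 0 < d ->
  `|W t - W y| <= 4 * pi * r * (d + 2 / d * (1 - cs 1 (t - y))).
Proof.
move=> d0; apply: le_trans (W_lip _ _) _.
rewrite ler_wpM2l ?mulr_ge0 ?pi_ge0 ?(ltW r0)//.
have h := sqr_le_one_sub_cos (trep_abs (t - y)); rewrite cos_trep in h.
rewrite /cs mulr1; move: h; rewrite -(real_normK (num_real (trep _))).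
set u := `|trep _|; set c := 1 - cos _ => h.
have u0 : 0 <= u by exact: normr_ge0.
have -> : d + 2 / d * c = (d ^+ 2 + 2 * c) / d by field; rewrite gt_eqF.
rewrite ler_pdivlMr//.
have : 0 <= (u - d / 2) ^+ 2 by exact: sqr_ge0.
nra.
Qed.

(** Cesàro mean of the Fourier series of [W]; there are no sines because [W] is even. *)
Definition sigW N t : R := W0 + 2 * \sum_(1 <= k < N) (1 - k%:R / N%:R) * (wh k * cs k t).

Lemma bW : bmeas W. Proof. exact: bmeas_W. Qed.

Lemma E1_W_cs_shift k t : (0 < k)%N -> E1 (fun y => cs k (t - y) * W y) = wh k * cs k t.
Proof.
move=> k0; have d1 := q_u_density R.
have h1 : bmeas (fun y => W y * cs k y) by apply: bmeasM; [exact: bW|exact: bmeas_cs].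
have h2 : bmeas (fun y => W y * sn k y) by apply: bmeasM; [exact: bW|exact: bmeas_sn].
rewrite [LHS](@Ex_eq _ _ _ (fun y => cs k t * (W y * cs k y) + sn k t * (W y * sn k y))); last first.
  by move=> y _; rewrite cs_sub; ring.
rewrite Ex_D ?Ex_Z//; [|exact: bmeasZ..].
by rewrite -!/(E1 _) -fcosE' -fsinE' fsinE// fcosE// mulr0 addr0 mulrC.
Qed.

Lemma sigWE N t : sigW N t = E1 (fun y => fejer N (t - y) * W y).
Proof.
have d1 := q_u_density R.
have bM k : bmeas (fun y => cs k (t - y) * W y).
  by apply: bmeasM; [exact: bmeas_cs_shift|exact: bW].
rewrite [RHS](@Ex_eq _ _ _ (fun y => W y + 2 *
  \sum_(1 <= k < N) (1 - k%:R / N%:R) * (cs k (t - y) * W y))); last first.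
  move=> y _; rewrite /fejer mulrDl mul1r -mulrA mulr_suml; congr (_ + _ * _).
  by apply: eq_bigr => k _; rewrite (mulrA (1 - k%:R / N%:R)).
have bS : bmeas (fun y => \sum_(1 <= k < N) (1 - k%:R / N%:R) * (cs k (t - y) * W y)).
  by apply: bmeas_sum => k _; apply: bmeasZ.
rewrite Ex_D//; [|exact: bW|exact: bmeasZ].
rewrite Ex_Z// Ex_sum//; last by move=> k _; apply: bmeasZ.
rewrite /sigW /W0 /E1; apply: (f_equal (fun u => _ + 2 * u)).
rewrite big_nat_cond [RHS]big_nat_cond; apply: eq_bigr => k /andP[/andP[k1 _] _].
by rewrite Ex_Z//; apply: (f_equal (fun u => _ * u)); rewrite -(E1_W_cs_shift t k1).
Qed.

Lemma sigW_approx N t d : (0 < N)%N -> 0 < d ->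
  `|W t - sigW N t| <= 4 * pi * r * (d + 2 / d / N%:R).
Proof.
move=> N0 d0; have d1 := q_u_density R.
have bF := bmeas_fejer N t.
have b1 : bmeas (fun y => fejer N (t - y) * (W t - W y)).
  by apply: bmeasM => //; apply: bmeasB; [exact: bmeas_cst|exact: bW].
have -> : W t - sigW N t = E1 (fun y => fejer N (t - y) * (W t - W y)).
  have -> : W t = W t * E1 (fun y => fejer N (t - y)) by rewrite E1_fejer mulr1.
  rewrite sigWE /E1 -Ex_Z// -Ex_B//; [|exact: bmeasZ|by apply: bmeasM => //; exact: bW].
  by apply: Ex_eq => y _; rewrite Ex_Z// -/(E1 _) E1_fejer; ring.
pose L := 4 * pi * r.
pose g y := L * (d + 2 / d) * fejer N (t - y) - L * (2 / d) * (fejer N (t - y) * cs 1 (t - y)).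
have bFc : bmeas (fun y => fejer N (t - y) * cs 1 (t - y)).
  by apply: bmeasM => //; exact: bmeas_cs_shift.
have bg : bmeas g by apply: bmeasB; exact: bmeasZ.
have Eg : E1 g = L * (d + 2 / d / N%:R).
  rewrite /E1 Ex_B ?Ex_Z//; [|exact: bmeasZ..].
  rewrite -!/(E1 _) E1_fejer E1_fejer_cos//.
  have Nn : N%:R != 0 :> R by rewrite pnatr_eq0 -lt0n.
  have dn : d != 0 by rewrite gt_eqF.
  by move: (L) (N%:R : R) Nn => l n Nn; field; rewrite dn Nn.
rewrite -/L -Eg.
have hb y : `|fejer N (t - y) * (W t - W y)| <= g y.
  rewrite normrM (ger0_norm (fejer_ge0 _ N0)).
  have := ler_wpM2l (fejer_ge0 (t - y) N0) (W_lip_cos t y d0).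
  move/le_trans; apply; rewrite /g -/L le_eqVlt; apply/orP; left; apply/eqP; ring.
rewrite ler_norml; apply/andP; split.
  rewrite -Ex_N//; apply: Ex_le => //; first exact: bmeasN.
  by move=> y _; have := hb y; rewrite ler_norml => /andP[].
by apply: Ex_le => // y _; have := hb y; rewrite ler_norml => /andP[].
Qed.

Definition SW N t : R := W0 + 2 * \sum_(1 <= k < N) wh k * cs k t.

Lemma sum_wh_tail N M : (0 < N)%N -> \sum_(N <= k < M) wh k <= 8 / N%:R.
Proof.
move=> N0; apply: (@le_trans _ _ (4 * \sum_(N <= k < M) (k%:R ^+ 2)^-1)).
  rewrite mulr_sumr big_nat_cond [leRHS]big_nat_cond; apply: ler_sum => k /andP[/andP[Nk _] _].
  exact/(wh_le Hr)/(leq_trans N0).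
have := @sum_inv_sqr_tail N M N0; lra.
Qed.

Lemma SW_sigW N M t : (0 < N)%N -> (N <= M)%N ->
  `|sigW M t - SW N t| <= 16 / N%:R + 8 * N%:R / M%:R.
Proof.
move=> N0 NM; have M0 := leq_trans N0 NM.
have M0' : 0 < M%:R :> R by rewrite ltr0n.
rewrite /sigW /SW (big_cat_nat (n := N))//=.
have -> : W0 + 2 * (\sum_(1 <= k < N) (1 - k%:R / M%:R) * (wh k * cs k t) +
      \sum_(N <= k < M) (1 - k%:R / M%:R) * (wh k * cs k t)) -
    (W0 + 2 * \sum_(1 <= k < N) wh k * cs k t) =
  2 * (\sum_(1 <= k < N) - (k%:R / M%:R * (wh k * cs k t)) +
   \sum_(N <= k < M) (1 - k%:R / M%:R) * (wh k * cs k t)).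
  have -> : \sum_(1 <= k < N) - (k%:R / M%:R * (wh k * cs k t)) =
    \sum_(1 <= k < N) (1 - k%:R / M%:R) * (wh k * cs k t) - \sum_(1 <= k < N) wh k * cs k t.
    by rewrite -sumrB; apply: eq_bigr => k _; ring.
  by ring.
rewrite normrM ger0_norm//.
have h1 : `|\sum_(1 <= k < N) - (k%:R / M%:R * (wh k * cs k t))| <= 4 * N%:R / M%:R.
  rewrite big_nat_cond; apply: (@le_trans _ _ (\sum_(1 <= k < N | (1 <= k < N)%N && true) 4 / M%:R)).
    apply: sumr_abs_le => k /andP[/andP[k1 _] _]; rewrite normrN normrM (normrM k%:R) (normrM (wh k)).
    have k0' : 0 < k%:R :> R by rewrite ltr0n.
    have w0 := wh_gt0 Hr k1.
    have M1 : 0 < M%:R^-1 :> R by rewrite invr_gt0.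
    rewrite (gtr0_norm k0') (gtr0_norm M1) (gtr0_norm w0).
    rewrite mulrAC ler_wpM2r ?invr_ge0 ?(ltW M0')//.
    apply: (@le_trans _ _ (k%:R * wh k)).
      by rewrite ler_wpM2l ?(ltW k0')// ler_piMr ?(ltW w0)// abs_cs.
    apply: (@le_trans _ _ (k%:R * (4 / k%:R ^+ 2))).
      by rewrite ler_wpM2l ?(ltW k0')// wh_le.
    rewrite (_ : _ * _ = 4 / k%:R); last by field; rewrite gt_eqF.
    by rewrite ler_pdivrMr// -{1}[4]mulr1 ler_wpM2l// ler1n.
  rewrite -big_nat_cond sumr_const_nat -[leLHS]mulr_natr mulrAC ler_wpM2r ?invr_ge0 ?(ltW M0')//.
  by rewrite ler_wpM2l// ler_nat leq_subr.
have h2 : `|\sum_(N <= k < M) (1 - k%:R / M%:R) * (wh k * cs k t)| <= 8 / N%:R.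
  apply: le_trans (sum_wh_tail M N0).
  rewrite big_nat_cond [leRHS]big_nat_cond; apply: sumr_abs_le => k /andP[/andP[Nk kM] _].
  have w0 := wh_gt0 Hr (leq_trans N0 Nk).
  rewrite normrM (normrM (wh k)) (gtr0_norm w0).
  have : `|1 - k%:R / M%:R| <= 1 :> R.
    rewrite ger0_norm; first by rewrite gerBl divr_ge0.
    by rewrite subr_ge0 ler_pdivrMr// mul1r ler_nat ltnW.
  move=> h; rewrite mulrCA ler_piMr ?(ltW w0)//.
  by apply: mulr_ile1 => //; exact: abs_cs.
have := ler_normD (\sum_(1 <= k < N) - (k%:R / M%:R * (wh k * cs k t))) (\sum_(N <= k < M) (1 - k%:R / M%:R) * (wh k * cs k t)).
rewrite (_ : 8 * N%:R / M%:R = 2 * (4 * N%:R / M%:R)); last by ring.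
lra.
Qed.

(** Summable coefficients strengthen Fejér's theorem: the partial sum of order [N] is within
    [16 / N] of Cesàro means of very large order [M], up to an error vanishing with [1 / M], and
    these means tend to [W]. The bound is uniform in [t] and drives the later limits of the
    interaction. *)
Lemma SW_approx N t : (0 < N)%N -> `|W t - SW N t| <= 16 / N%:R.
Proof.
move=> N0; rewrite leNgt; apply/negP => h.
pose e := `|W t - SW N t| - 16 / N%:R.
have e0 : 0 < e by rewrite subr_gt0.
pose L := 4 * pi * r.
have L0 : 0 < L by rewrite !mulr_gt0// pi_gt0.
(* [d] and then [M] bring the remaining errors, [L * d] and [C / M], to at most [e / 4] each, so
   they do not exhaust the surplus [e]. *)
pose d := e / (4 * L).
have d0 : 0 < d by rewrite divr_gt0// mulr_gt0.
pose C := L * (2 / d) + 8 * N%:R.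
have C0 : 0 <= C.
  apply: addr_ge0; last exact: mulr_ge0.
  by apply: mulr_ge0; [exact: ltW|apply: divr_ge0 => //; exact: ltW].
pose M := maxn N (Num.bound (4 * C / e)).+1.
have NM : (N <= M)%N := leq_maxl _ _.
have M0 : (0 < M)%N := leq_trans N0 NM.
have M0' : 0 < M%:R :> R by rewrite ltr0n.
have CM : C / M%:R <= e / 4.
  rewrite ler_pdivrMr// mulrC -ler_pdivrMr ?divr_gt0//.
  rewrite invf_div (_ : C * (4 / e) = 4 * C / e); last by ring.
  apply: ltW; apply: lt_le_trans (archi_boundP _) _.
    by apply: divr_ge0; [exact: mulr_ge0|exact: ltW].
  by rewrite ler_nat (leq_trans _ (leq_maxr _ _)).
have h1 := sigW_approx t M0 d0; have h2 := SW_sigW t N0 NM.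
have h3 := ler_normD (W t - sigW M t) (sigW M t - SW N t).
have Ld : L * d = e / 4 by rewrite /d; field; rewrite !gt_eqF.
have h4 : L * (d + 2 / d / M%:R) + 8 * N%:R / M%:R = e / 4 + C / M%:R.
  by rewrite /C -Ld; ring.
rewrite -/L in h1; rewrite addrA subrK in h3.
have eE : `|W t - SW N t| = e + 16 / N%:R by rewrite /e subrK.
have h5 := le_trans h3 (lerD h1 h2).
move: h5 CM e0; rewrite eE addrCA h4; clear; lra.
Qed.

End Approx.
End Fejer.

(** * Entropy *)

Section Entropy.
Variable R : realType.
Local Notation Tor := (@Defs.Tor R).
Local Notation leb := (@Defs.leb R).
Local Notation q_u := (@Defs.q_u R).
Local Notation E1 := (@E1 R).
Implicit Types (f g q : R -> R) (s t x y : R).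

Lemma ln_ge_1subV t : 0 < t -> 1 - t^-1 <= ln t.
Proof.
move=> t0; have := @le_ln1Dx _ (t^-1 - 1); rewrite addrCA subrr addr0 lnV ?posrE//.
have h : 0 < t^-1 by rewrite invr_gt0.
have h2 : -1 < t^-1 - 1 by lra.
by move=> /(_ h2); lra.
Qed.

(** Legendre duality between [s ln s - s] and the exponential: the pointwise form of Gibbs'
    inequality. *)
Lemma xlnx_ge s c : 0 <= s -> s * c + s - expR c <= s * ln s.
Proof.
rewrite le_eqVlt => /predU1P[<-|s0].
  by rewrite !mul0r !add0r oppr_le0 expR_ge0.
have -> : expR c = s * expR (c - ln s) by rewrite expRD expRN lnK ?posrE// mulrCA divff ?mulr1// gt_eqF.
have := expR_ge1Dx (c - ln s); rewrite -(ler_pM2l s0); lra.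
Qed.

(** [D = s ln s - s + 1] dominates the Hellinger term [(sqrt s - 1) ^ 2], and
    [|s - 1| = |sqrt s - 1| (sqrt s + 1)] is split by Young's inequality. Integrated, with [l] of
    the order of the square root of the entropy, this gives a Pinsker-type bound. *)
Lemma abs_sub1_le s l : 0 <= s -> 0 < l ->
  `|s - 1| <= l * (s + 1) + (s * ln s - s + 1) / l.
Proof.
move=> s0 l0; set D := s * ln s - s + 1.
have hD : (Num.sqrt s - 1) ^+ 2 <= D.
  rewrite /D; move: s0; rewrite le_eqVlt => /predU1P[<-|s0].
    by rewrite sqrtr0 mul0r; lra.
  have t0 : 0 < Num.sqrt s by rewrite sqrtr_gt0.
  have sE : s = Num.sqrt s ^+ 2 by rewrite sqr_sqrtr// ltW.
  rewrite {2 3 4}sE lnXn// -mulr_natr; have := ln_ge_1subV t0.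
  move: (Num.sqrt s) t0 => t t0; rewrite -(ler_pM2l t0) mulrBr mulr1 divff ?gt_eqF//.
  move=> h; have := ler_wpM2l (ltW t0) h; move: (ln t) => u; lra.
have : 0 <= Num.sqrt s by exact: sqrtr_ge0.
have : s = Num.sqrt s ^+ 2 by rewrite sqr_sqrtr.
move: hD; move: (D) (Num.sqrt s) => d t hD sE t0.
have h : `|s - 1| = `|t - 1| * (t + 1).
  rewrite sE (_ : t ^+ 2 - 1 = (t - 1) * (t + 1)); last by ring.
  by rewrite normrM (ger0_norm (addr_ge0 t0 ler01)).
have h2 : `|t - 1| ^+ 2 <= d by rewrite real_normK ?num_real.
rewrite h; move: (normr_ge0 (t - 1)) h2; move: `|t - 1| => a a0 h2.
rewrite -(ler_pM2r l0) mulrDl divfK ?gt_eqF// sE.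
have := sqr_ge0 (a - l * (t + 1) / 2).
have := sqr_ge0 (l * (t - 1)).
nra.
Qed.

Definition entropy q : \bar R := (\int[leb]_(x in Tor) (q x * ln (q x))%:E)%E.

Lemma measurable_density q : is_density q -> measurable_fun (Tor : set (measurableTypeR R)) q.
Proof. by case. Qed.

Lemma measurable_xlnx q : is_density q ->
  measurable_fun (Tor : set (measurableTypeR R)) (fun x => q x * ln (q x)).
Proof.
move=> /measurable_density mq; apply: measurable_funM => //.
exact: (measurableT_comp (@measurable_ln R) mq).
Qed.

(** Since [s ln s >= s - 1], the negative part of the integrand is at most 1; only the positive part
    can have infinite integral. *)
Lemma entropy_cases q : is_density q ->
  entropy q = +oo%E \/ leb.-integrable Tor (EFin \o (fun x => q x * ln (q x))).
Proof.
move=> dq; have mx := measurable_xlnx dq; have mT := @measurable_Tor R.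
set f := EFin \o (fun x => q x * ln (q x)).
have mf : measurable_fun (Tor : set (measurableTypeR R)) f by exact/measurable_EFinP.
have hneg : (\int[leb]_(x in Tor) f^\- x < +oo)%E.
  apply: (@le_lt_trans _ _ (\int[leb]_(x in Tor) (cst 1%:E) x)%E).
    apply: ge0_le_integral => //; first exact: measurable_funeneg.
    move=> x Tx; rewrite /f funenegE /= ge_max; apply/andP; split; last by rewrite lee_fin.
    rewrite lee_fin.
    have := xlnx_ge 0 (dq.2.1 x Tx); rewrite expR0 mulr0 add0r.
    by have := dq.2.1 x Tx; lra.
  rewrite integral_cst// mul1e; have lT : (leb Tor < +oo)%E by rewrite leb_Tor ltry.
  exact: lT.
have [hpos|] := ltP (\int[leb]_(x in Tor) f^\+ x)%E +oo%E; last first.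
  rewrite leye_eq => /eqP hpos; left.
  rewrite /entropy integralE -/f hpos addye//.
  by apply/eqP => h; move: hneg; rewrite -[X in (X < _)%E]oppeK h.
right; apply/integrableP; split => //.
have -> : (fun x => `|f x|)%E = (f^\+ \+ f^\-)%E.
  by apply/funext => x; rewrite -/((abse \o f) x) fune_abse.
rewrite ge0_integralD//; first exact: lte_add_pinfty.
  exact: measurable_funepos.
exact: measurable_funeneg.
Qed.

Lemma entropyE q : leb.-integrable Tor (EFin \o (fun x => q x * ln (q x))) ->
  entropy q = (Rintegral leb Tor (fun x => q x * ln (q x)))%:E.
Proof. by move=> h; rewrite /Rintegral fineK//; apply: integrable_fin_num h; exact: measurable_Tor. Qed.

(** Integrate [xlnx_ge] with exponent [f - ln Z], whose exponential has total mass 1 and cancels the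
    mass of [q]. *)
Lemma gibbs q f : is_density q -> bmeas f ->
  ((Ex q f - ln (E1 (fun x => expR (f x))))%:E <= entropy q)%E.
Proof.
move=> dq bf; have mT := @measurable_Tor R.
have [->|ix] := entropy_cases dq; first exact: leey.
rewrite entropyE// lee_fin.
have be := bmeas_expR bf; have d1 := q_u_density R.
set Z := E1 _; have Z0 : 0 < Z.
  have [M Mf] := bf.2; apply: (@lt_le_trans _ _ (expR (- M))); first exact: expR_gt0.
  rewrite -(Ex_cst (expR (- M)) d1); apply: Ex_le => //; first exact: bmeas_cst.
  by move=> x /Mf; rewrite ler_norml ler_expR => /andP[].
pose g x := f x - ln Z.
have bg : bmeas g by apply: bmeasB => //; exact: bmeas_cst.
have bge := bmeas_expR bg.
have -> : Ex q f - ln Z = Ex q g by rewrite Ex_B ?Ex_cst//; exact: bmeas_cst.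
have i1 : leb.-integrable Tor (EFin \o (fun x => q x * (g x + 1))).
  by apply: densityM_integrable => //; apply: bmeasD => //; exact: bmeas_cst.
have i2 := bmeas_integrable bge.
have Eg : Rintegral leb Tor (fun x => expR (g x)) = 1.
  rewrite -E1E [LHS](@Ex_eq _ _ _ (fun x => Z^-1 * expR (f x))); last first.
    by move=> x _; rewrite /g expRD expRN lnK ?posrE// mulrC.
  by rewrite Ex_Z// mulVf// gt_eqF.
have -> : Ex q g = Rintegral leb Tor (fun x => q x * (g x + 1) - expR (g x)).
  rewrite RintegralB// Eg -/(Ex q (fun x => g x + 1)) Ex_D ?Ex_cst//; last exact: bmeas_cst.
  by rewrite addrK.
apply: le_Rintegral => //.
  apply: (integrableB mT i1 i2).
move=> x Tx; have := xlnx_ge (g x) (dq.2.1 x Tx).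
by rewrite (_ : q x * (g x + 1) = q x * g x + q x)//; ring.
Qed.

Lemma entropy_ge0 q : is_density q -> (0 <= entropy q)%E.
Proof.
move=> dq; have := gibbs dq (@bmeas_cst R 0).
by rewrite expR0 /E1 !Ex_cst ?ln1 ?subr0//; exact: q_u_density.
Qed.

Lemma entropy_uniform : entropy q_u = 0%E.
Proof.
rewrite /entropy /q_u; under eq_integral do rewrite ln1 mulr0.
by rewrite integral0.
Qed.

Lemma integrable_sub1 q : is_density q -> leb.-integrable Tor (EFin \o (fun x => `|q x - 1|)).
Proof.
move=> dq; have mT := @measurable_Tor R.
apply: integrable_norm.
exact: (integrableB mT (density_integrable dq) (bmeas_integrable (@bmeas_cst R 1))).
Qed.

Lemma L1dist_uE q : is_density q ->
  L1dist_u q = (Rintegral leb Tor (fun x => `|q x - 1|))%:E.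
Proof.
move=> dq; rewrite /Rintegral fineK//; apply: integrable_fin_num (integrable_sub1 dq).
exact: measurable_Tor.
Qed.

Lemma L1dist_le_entropy q h l : is_density q -> 0 < l -> (entropy q <= h%:E)%E ->
  (L1dist_u q <= (2 * l + h / l)%:E)%E.
Proof.
move=> dq l0; have mT := @measurable_Tor R.
have [->|ix] := entropy_cases dq; first by rewrite leye_eq.
rewrite entropyE// L1dist_uE// !lee_fin => hh.
have iq := density_integrable dq.
have i1 := bmeas_integrable (@bmeas_cst R 1).
have ia : leb.-integrable Tor (EFin \o (fun x => l * (q x + 1))).
  exact: (integrableZl mT l (integrableD mT iq i1)).
have ib' : leb.-integrable Tor (EFin \o (fun x => q x * ln (q x) - q x + 1)).
  exact: (integrableD mT (integrableB mT ix iq) i1).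
have ib : leb.-integrable Tor (EFin \o (fun x => l^-1 * (q x * ln (q x) - q x + 1))).
  exact: (integrableZl mT l^-1 ib').
have q1 : Rintegral leb Tor q = 1 by rewrite /Rintegral dq.2.2.
have c1 : Rintegral leb Tor (fun=> 1) = 1.
  by rewrite -E1E /E1 Ex_cst//; exact: q_u_density.
apply: (@le_trans _ _ (Rintegral leb Tor (fun x => l * (q x + 1) + l^-1 * (q x * ln (q x) - q x + 1)))).
  apply: le_Rintegral => //; first exact: integrable_sub1.
    exact: (integrableD mT ia ib).
  by move=> x Tx; have := abs_sub1_le (dq.2.1 x Tx) l0; rewrite [_ / l]mulrC.
rewrite RintegralD// !RintegralZl//; last exact: (integrableD mT iq i1).
rewrite RintegralD// RintegralD//; last exact: (integrableB mT ix iq).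
rewrite RintegralB// q1 c1 subrK mulrC lerD2l mulrC ler_wpM2r// invr_ge0.
exact: ltW.
Qed.

Lemma ae_eqT_L1dist q : is_density q -> (L1dist_u q <= 0)%E -> ae_eqT q q_u.
Proof.
move=> dq h; have mT := @measurable_Tor R.
have h0 : (\int[leb]_(x in Tor) `|(EFin \o (fun x => q x - 1)%R) x| = 0)%E.
  apply/eqP; rewrite eq_le; apply/andP; split; first exact: h.
  by apply: integral_ge0 => x _; exact: abse_ge0.
have mq : measurable_fun (Tor : set (measurableTypeR R)) (EFin \o (fun x => q x - 1)).
  apply/measurable_EFinP; apply: measurable_funB; [exact: measurable_density|exact: measurable_cst].
have /(ae_eq_integral_abs leb mT mq) := h0.
apply: filterS => x /= H Tx; have := H Tx => /eqP; rewrite eqe subr_eq0 => /eqP ->.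
by [].
Qed.

Lemma ae_eqT_entropy q : is_density q -> (entropy q <= 0)%E -> ae_eqT q q_u.
Proof.
move=> dq h; apply: ae_eqT_L1dist => //; apply/lee_addgt0Pr => e e0.
have e2 : 0 < e / 2 by rewrite divr_gt0.
have := L1dist_le_entropy dq e2 h; rewrite mul0r addr0 add0e.
by rewrite mulrC divfK.
Qed.

Lemma L1dist_ae_eqT q : is_density q -> ae_eqT q q_u -> L1dist_u q = 0%E.
Proof.
move=> dq h; have mT := @measurable_Tor R.
have mq : measurable_fun (Tor : set (measurableTypeR R)) (EFin \o (fun x => q x - 1)).
  apply/measurable_EFinP; apply: measurable_funB; [exact: measurable_density|exact: measurable_cst].
apply/(ae_eq_integral_abs leb mT mq); move: h; apply: (@filterS _ (almost_everywhere leb)) => x /= H Tx.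
by rewrite H// /Defs.q_u subrr.
Qed.

Lemma Ex_L1dist q f l M : is_density q -> bmeas f -> (L1dist_u q <= l%:E)%E ->
  0 <= M -> (forall x, Tor x -> `|f x| <= M) -> `|Ex q f - E1 f| <= M * l.
Proof.
move=> dq bf; rewrite L1dist_uE// lee_fin => hl M0 fM.
have mT := @measurable_Tor R.
have iqf := densityM_integrable dq bf; have i1f := bmeas_integrable bf.
rewrite E1E /Ex -RintegralB//.
apply: le_trans (le_normr_Rintegral mT _) _; first exact: (integrableB mT iqf i1f).
apply: (@le_trans _ _ (M * Rintegral leb Tor (fun x => `|q x - 1|))); last by rewrite ler_wpM2l.
rewrite -RintegralZl//; last exact: integrable_sub1.
apply: le_Rintegral => //.
- apply: integrable_norm; exact: (integrableB mT iqf i1f).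
- exact: (integrableZl mT M (integrable_sub1 dq)).
- move=> x Tx; rewrite (_ : q x * f x - f x = f x * (q x - 1)); last by ring.
  by rewrite normrM ler_wpM2r// fM.
Qed.

End Entropy.

(** * The interaction energy *)

Section Interaction.
Variable R : realType.
Local Notation Tor := (@Defs.Tor R).
Local Notation leb := (@Defs.leb R).
Local Notation q_u := (@Defs.q_u R).
Local Notation E1 := (@E1 R).
Implicit Types (f g q : R -> R) (s t x y : R).

Lemma cvg_rate (u : nat -> R) (l C : R) :
  (forall n, `|u n - l| <= C / n.+1%:R) -> u @ \oo --> l.
Proof.
move=> h; apply/cvgrPdist_le => e e0; near=> n.
rewrite distrC (le_trans (h n))// ler_pdivrMr// mulrC -ler_pdivrMr//.
apply: le_trans (ler_norm _) _; apply: ltW; apply: lt_le_trans (archi_boundP (normr_ge0 _)) _.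
rewrite ler_nat; apply: leqW; near: n; exact: nbhs_infty_ge.
Unshelve. all: by end_near. Qed.

Lemma le_rate (a b C : R) : (forall n, a <= b + C / n.+1%:R) -> a <= b.
Proof.
move=> h; rewrite leNgt; apply/negP => ab.
have e0 : 0 < a - b by rewrite subr_gt0.
have := h (Num.bound (`|C| / (a - b))); apply/negP; rewrite -ltNge -ltrBrDl.
rewrite ltr_pdivrMr// mulrC -ltr_pdivrMr//.
apply: (@le_lt_trans _ _ (`|C| / (a - b))).
  by rewrite ler_wpM2r ?ler_norm// invr_ge0 ltW.
apply: lt_le_trans (archi_boundP _) _; first by rewrite divr_ge0// ltW.
by rewrite ler_nat.
Qed.

(** Source of measurability for translates of the kernel, its convolutions and the potentials below:
    all are uniform limits of trigonometric polynomials. *)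
Lemma bmeas_lim f (h : nat -> R -> R) (C : R) : (forall n, bmeas (h n)) ->
  (forall n x, Tor x -> `|f x - h n x| <= C / n.+1%:R) -> bmeas f.
Proof.
move=> bh fh; split.
  apply: (@measurable_fun_cvg _ _ _ _ h) => [n|x Tx]; first exact: (bh n).1.
  by apply: (@cvg_rate _ _ C) => n; rewrite distrC; exact: fh.
have [M hM] := (bh 0%N).2; exists (M + C / 1%:R) => x Tx.
have := fh 0%N x Tx; have := hM x Tx; have := ler_normD (h 0%N x) (f x - h 0%N x).
by rewrite addrC subrK; lra.
Qed.

Definition cq q k : R := Ex q (cs k).
Definition sq q k : R := Ex q (sn k).
(** Squared modulus of the Fourier coefficient [cq q k - i * sq q k]. *)
Definition m2 q k : R := cq q k ^+ 2 + sq q k ^+ 2.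

Lemma m2_ge0 q k : 0 <= m2 q k. Proof. by rewrite addr_ge0// sqr_ge0. Qed.

Lemma cq_abs q k : is_density q -> `|cq q k| <= 1.
Proof.
move=> dq; have := @Ex_dist R q (@cs R k) (fun=> 0) 1 dq (@bmeas_cs R k) (@bmeas_cst R 0).
by rewrite Ex_cst// subr0; apply => x _; rewrite subr0; exact: abs_cs.
Qed.

Lemma sq_abs q k : is_density q -> `|sq q k| <= 1.
Proof.
move=> dq; have := @Ex_dist R q (@sn R k) (fun=> 0) 1 dq (@bmeas_sn R k) (@bmeas_cst R 0).
by rewrite Ex_cst// subr0; apply => x _; rewrite subr0; exact: abs_sn.
Qed.

Lemma m2_le2 q k : is_density q -> m2 q k <= 2.
Proof.
move=> dq; rewrite /m2 -(real_normK (num_real (cq q k))) -(real_normK (num_real (sq q k))).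
have := cq_abs k dq; have := sq_abs k dq.
have := normr_ge0 (cq q k); have := normr_ge0 (sq q k).
nra.
Qed.

Section Energy.
Variables (r : R) (Hr : 0 < r <= pi).
Let r0 : 0 < r. Proof. by case/andP: Hr. Qed.
Local Notation W := (W_HK r).
Local Notation wh := (wh r).
Local Notation W0 := (W0 r).
Local Notation SW := (SW r).

Lemma bmeas_SW_shift N x : bmeas (fun y => SW N (x - y)).
Proof.
apply: bmeasD; first exact: bmeas_cst.
by apply: bmeasZ; apply: bmeas_sum => k _; apply: bmeasZ; exact: bmeas_cs_shift.
Qed.

Lemma bmeas_W_shift x : bmeas (fun y => W (x - y)).
Proof.
apply: (@bmeas_lim _ (fun n y => SW n.+1 (x - y)) 16) => [n|n y _].
  exact: bmeas_SW_shift.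
exact: SW_approx.
Qed.

Definition conv q x : R := Ex q (fun y => W (x - y)).
Definition convN q N x : R :=
  W0 + 2 * \sum_(1 <= k < N) wh k * (cs k x * cq q k + sn k x * sq q k).

Lemma bmeas_convN q N : bmeas (convN q N).
Proof.
apply: bmeasD; first exact: bmeas_cst.
apply: bmeasZ; apply: bmeas_sum => k _; apply: bmeasZ.
by apply: bmeasD; (apply: bmeasM; last exact: bmeas_cst); [exact: bmeas_cs|exact: bmeas_sn].
Qed.

Lemma convNE q N x : is_density q -> convN q N x = Ex q (fun y => SW N (x - y)).
Proof.
move=> dq; have bc := bmeas_cs_shift.
rewrite /convN /SW Ex_D//; [|exact: bmeas_cst|]; last first.
  by apply: bmeasZ; apply: bmeas_sum => k _; apply: bmeasZ.
rewrite Ex_cst// Ex_Z//; last by apply: bmeas_sum => k _; apply: bmeasZ.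
rewrite Ex_sum//; last by move=> k _; apply: bmeasZ.
apply: (f_equal (fun u => _ + 2 * u)); apply: eq_bigr => k _.
rewrite Ex_Z//; apply: (f_equal (fun u => _ * u)).
rewrite [RHS](@Ex_eq _ _ _ (fun y => cs k x * cs k y + sn k x * sn k y)); last first.
  by move=> y _; rewrite cs_sub.
have b1 := @bmeas_cs R k; have b2 := @bmeas_sn R k.
by rewrite Ex_D ?Ex_Z//; exact: bmeasZ.
Qed.

Lemma conv_approx q N x : is_density q -> (0 < N)%N ->
  `|conv q x - convN q N x| <= 16 / N%:R.
Proof.
move=> dq N0; rewrite convNE//; apply: Ex_dist => //.
- exact: bmeas_W_shift.
- exact: bmeas_SW_shift.
- by move=> y _; exact: SW_approx.
Qed.

Lemma bmeas_conv q : is_density q -> bmeas (conv q).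
Proof.
move=> dq; apply: (@bmeas_lim _ (fun n => convN q n.+1) 16) => [n|n x _].
  exact: bmeas_convN.
exact: conv_approx.
Qed.

Definition AN q N : R := \sum_(1 <= k < N) wh k * m2 q k.

Lemma Ex_convN q N : is_density q -> Ex q (convN q N) = W0 + 2 * AN q N.
Proof.
move=> dq; have b1 := @bmeas_cs R; have b2 := @bmeas_sn R.
have bk k : bmeas (fun x => cs k x * cq q k + sn k x * sq q k).
  by apply: bmeasD; apply: bmeasM => //; exact: bmeas_cst.
rewrite /convN Ex_D//; [|exact: bmeas_cst|]; last first.
  by apply: bmeasZ; apply: bmeas_sum => k _; apply: bmeasZ.
rewrite Ex_cst// Ex_Z//; last by apply: bmeas_sum => k _; apply: bmeasZ.
rewrite Ex_sum//; last by move=> k _; apply: bmeasZ.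
apply: (f_equal (fun u => _ + 2 * u)); apply: eq_bigr => k _.
rewrite Ex_Z//; apply: (f_equal (fun u => _ * u)).
rewrite [LHS](@Ex_eq _ _ _ (fun x => cq q k * cs k x + sq q k * sn k x)); last first.
  by move=> y _; ring.
by rewrite Ex_D ?Ex_Z//; exact: bmeasZ.
Qed.

(* The sum over [k >= 1] of [\hat W(k) * |\hat q(k)|^2]. *)
Definition Aq q : R := (Ex q (conv q) - W0) / 2.

Lemma Aq_approx q N : is_density q -> (0 < N)%N -> `|Aq q - AN q N| <= 8 / N%:R.
Proof.
move=> dq N0.
have : `|Ex q (conv q) - Ex q (convN q N)| <= 16 / N%:R.
  apply: Ex_dist => //; [exact: bmeas_conv|exact: bmeas_convN|].
  by move=> x _; exact: conv_approx.
rewrite Ex_convN// /Aq !ler_norml; lra.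
Qed.

Lemma AN_mono q N M : (N <= M)%N -> AN q N <= AN q M.
Proof.
move=> NM; rewrite /AN; have [N1|N1] := leqP 1 N; last first.
  rewrite [leLHS]big_geq; last exact: ltnW.
  rewrite big_nat_cond; apply: sumr_ge0 => k /andP[/andP[k1 _] _].
  by apply: mulr_ge0; [apply: ltW; exact: wh_gt0|exact: m2_ge0].
rewrite (big_cat_nat N1 NM) /= lerDl big_nat_cond.
apply: sumr_ge0 => k /andP[/andP[k1 _] _].
by apply: mulr_ge0; [apply: ltW; apply: wh_gt0 => //; exact: leq_trans N1 k1|exact: m2_ge0].
Qed.

(** The coefficients [wh k] are positive, so the truncated energies increase to [Aq]. *)
Lemma AN_le_Aq q N : is_density q -> AN q N <= Aq q.
Proof.
move=> dq; apply: (@le_rate _ _ 8) => n.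
have := @Aq_approx q (maxn N n.+1) dq; rewrite (leq_trans _ (leq_maxr _ _))// => /(_ isT).
have h1 := AN_mono q (leq_maxl N n.+1).
have h2 : 8 / (maxn N n.+1)%:R <= 8 / n.+1%:R :> R.
  rewrite ler_wpM2l// lef_pV2 ?posrE ?ltr0n ?ler_nat ?leq_maxr//.
  by rewrite (leq_trans _ (leq_maxr _ _)).
rewrite ler_norml => /andP[h3 _]; apply: le_trans h1 _.
by move: h2 h3; move: (8 / _) (8 / _) (AN q _) => a b c; lra.
Qed.

Lemma Aq_le q N : is_density q -> (0 < N)%N -> Aq q <= AN q N + 8 / N%:R.
Proof. by move=> dq N0; have := Aq_approx dq N0; rewrite ler_norml; lra. Qed.

Lemma Aq_ge0 q : is_density q -> 0 <= Aq q.
Proof. by move=> dq; have := AN_le_Aq 0 dq; rewrite /AN big_geq. Qed.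

Lemma Aq_le_bound q C : is_density q -> (forall N, AN q N <= C) -> Aq q <= C.
Proof.
move=> dq h; apply: (@le_rate _ _ 8) => n.
by apply: le_trans (Aq_le dq (ltn0Sn n)) _; rewrite lerD2r.
Qed.

Lemma Aq_uniform : Aq q_u = 0.
Proof.
have d1 := q_u_density R.
apply/eqP; rewrite eq_le Aq_ge0// andbT; apply: Aq_le_bound => // N.
rewrite /AN big_nat_cond big1// => k /andP[/andP[k1 _] _].
by rewrite /m2 /cq /sq -!/(E1 _) E1_cs// E1_sn expr0n addr0 mulr0.
Qed.

Lemma interactionE q : is_density q ->
  (\int[leb]_(x in Tor) \int[leb]_(y in Tor) (W (x - y) * q x * q y)%:E)%E
  = (W0 + 2 * Aq q)%:E.
Proof.
move=> dq; have mT := @measurable_Tor R.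
have inner x : (\int[leb]_(y in Tor) (W (x - y) * q x * q y)%:E)%E = (q x * conv q x)%:E.
  have i1 := densityM_integrable dq (bmeas_W_shift x).
  rewrite [LHS](_ : _ = (\int[leb]_(y in Tor) ((q x)%:E * (q y * W (x - y))%:E))%E).
    rewrite integralZl// EFinM /conv /Ex /Rintegral fineK//.
    by apply: integrable_fin_num i1.
  by apply: eq_integral => y _; rewrite -EFinM; congr EFin; ring.
under eq_integral do rewrite inner.
rewrite /Aq (_ : W0 + _ = Ex q (conv q)); last by rewrite mulrC divfK// addrC subrK.
rewrite /Ex /Rintegral fineK//; apply: integrable_fin_num => //.
exact: densityM_integrable (bmeas_conv dq).
Qed.

Lemma free_energyE K q : is_density q ->
  free_energy W K q = (entropy q - (K * (W0 + 2 * Aq q))%:E)%E.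
Proof. by move=> dq; rewrite /free_energy interactionE. Qed.

(** Free energy relative to the uniform density: the constant [K * W0], common to all densities, is
    left out. *)
Definition excess K q : \bar R := (entropy q - (2 * K * Aq q)%:E)%E.

Lemma free_energy_excess K q : is_density q ->
  free_energy W K q = (excess K q + (- (K * W0))%:E)%E.
Proof.
move=> dq; rewrite free_energyE// /excess.
rewrite (_ : K * (W0 + 2 * Aq q) = 2 * K * Aq q + K * W0); last by ring.
by rewrite EFinD oppeD// addeA EFinN.
Qed.

Lemma free_energy_le K q p : is_density q -> is_density p ->
  (free_energy W K q <= free_energy W K p)%E = (excess K q <= excess K p)%E.
Proof. by move=> dq dp; rewrite !free_energy_excess// leeD2rE. Qed.

Lemma excess_uniform K : excess K q_u = 0%E.
Proof. by rewrite /excess entropy_uniform Aq_uniform mulr0 sube0. Qed.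

Lemma global_minP K q : global_min W K q <->
  is_density q /\ forall p, is_density p -> (excess K q <= excess K p)%E.
Proof.
split=> -[dq h]; (split; first exact: dq) => p dp.
  by rewrite -(free_energy_le K dq dp); exact: h.
by rewrite (free_energy_le K dq dp); exact: h.
Qed.

Lemma global_min_uniformP K : global_min W K q_u <->
  forall p, is_density p -> ((2 * K * Aq p)%:E <= entropy p)%E.
Proof.
rewrite global_minP; split=> [[_ h] p dp|h].
  by have := h p dp; rewrite excess_uniform /excess sube_ge0.
split; first exact: q_u_density.
by move=> p dp; rewrite excess_uniform /excess sube_ge0// h.
Qed.

Lemma global_min_entropy_le K q : global_min W K q -> (entropy q <= (2 * K * Aq q)%:E)%E.
Proof.
move=> /global_minP[dq h]; have := h _ (q_u_density R).
by rewrite excess_uniform /excess sube_le0.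
Qed.

End Energy.
End Interaction.

(** * The Lebedev-Milin inequality *)

Section TruncatedExp.
Variable F : numFieldType.
Implicit Types (a b x : F) (p : {poly F}).

(** Taylor polynomial of the exponential. It is used over the reals and the complex numbers, and its
    composite with a polynomial is again a polynomial, with finitely many coefficients to sum. *)
Definition texp M x : F := \sum_(j < M.+1) x ^+ j / j`!%:R.

Lemma fact_neq0 j : j`!%:R != 0 :> F.
Proof. by rewrite pnatr_eq0 -lt0n fact_gt0. Qed.

Lemma texpM M a b : texp M a * texp M b =
  \sum_(j < M.+1) \sum_(l < M.+1) (a ^+ j / j`!%:R) * (b ^+ l / l`!%:R).
Proof. by rewrite mulr_suml; apply: eq_bigr => j _; rewrite mulr_sumr. Qed.

Lemma exp_add_fact n a b : (a + b) ^+ n / n`!%:R =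
  \sum_(j < n.+1) (a ^+ j / j`!%:R) * (b ^+ (n - j) / (n - j)`!%:R).
Proof.
rewrite addrC exprDn mulr_suml; apply: eq_bigr => j _.
have jn : (j <= n)%N by rewrite -ltnS.
have h : 'C(n, j)%:R = n`!%:R / (j`!%:R * (n - j)`!%:R) :> F.
  by rewrite -(bin_fact jn) natrM natrM mulfK// mulf_neq0// fact_neq0.
rewrite -mulr_natr h; field.
by rewrite !fact_neq0.
Qed.

(** The triangle [j + l <= M] of the full square in [texpM]. The missing corner is the failure of
    [texp] to be multiplicative, estimated in [sqm_texp_ge]. *)
Lemma texpD M a b : texp M (a + b) =
  \sum_(j < M.+1) \sum_(l < M.+1 | (j + l <= M)%N) (a ^+ j / j`!%:R) * (b ^+ l / l`!%:R).
Proof.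
pose f (j l : nat) : F := (a ^+ j / j`!%:R) * (b ^+ l / l`!%:R).
transitivity (\sum_(n < M.+1) \sum_(j < M.+1) \sum_(l < M.+1 | (j + l == n)%N) f j l).
  apply: eq_bigr => n _; rewrite exp_add_fact.
  have nM : (n < M.+1)%N := ltn_ord n.
  rewrite (big_ord_widen M.+1 (fun j => f j (n - j)%N) nM) big_mkcond /=.
  apply: eq_bigr => j _; case: ifP => [jn|/negbT]; last first.
    rewrite -leqNgt => nj; rewrite big1// => l /eqP jl.
    by move: nj; rewrite -jl ltnNge leq_addr.
  have lM : (n - j < M.+1)%N by rewrite (leq_ltn_trans (leq_subr _ _)).
  rewrite (big_pred1 (Ordinal lM))// => l /=.
  by rewrite -val_eqE /= -[RHS](eqn_add2l j) subnKC// -ltnS.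
rewrite exchange_big /=; apply: eq_bigr => j _.
rewrite (exchange_big_dep (fun=> true))//= [RHS]big_mkcond /=; apply: eq_bigr => l _.
case: ifP => [jl|/negbT jl].
  have jl' : (j + l < M.+1)%N by [].
  by rewrite (big_pred1 (Ordinal jl'))// => n /=; rewrite -val_eqE /= eq_sym.
rewrite big1// => n /eqP E; exfalso; move/negP: jl; apply; rewrite E -ltnS.
exact: ltn_ord.
Qed.

Definition ptexp M p : {poly F} := \sum_(j < M.+1) j`!%:R^-1 *: p ^+ j.

Lemma horner_ptexp M p x : (ptexp M p).[x] = texp M p.[x].
Proof.
rewrite horner_sum; apply: eq_bigr => j _.
by rewrite hornerZ horner_exp mulrC.
Qed.

Lemma ptexp0 p : ptexp 0 p = 1.
Proof. by rewrite /ptexp big_ord1 expr0 invr1 scale1r. Qed.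

Lemma deriv_ptexp M p : (ptexp M.+1 p)^`() = p^`() * ptexp M p.
Proof.
rewrite /ptexp raddf_sum big_ord_recl /= expr0 derivZ derivC scaler0 add0r mulr_sumr.
apply: eq_bigr => j _; rewrite derivZ deriv_exp /bump /= add1n /=.
rewrite -[X in _ *: X]scaler_nat scalerA -scalerAr; congr (_ *: _).
by rewrite factS natrM invfM mulrAC mulVf ?mul1r.
Qed.

Lemma ptexp_coef0 M p : p`_0 = 0 -> (ptexp M p)`_0 = 1.
Proof.
move=> p0; rewrite -horner_coef0 horner_ptexp horner_coef0 p0 /texp big_ord_recl /=.
rewrite expr0 divr1 big1 ?addr0// => j _.
by rewrite /bump /= add1n exprS !mul0r.
Qed.

(** Coefficients of [y' = p' y] for [y = exp p], with the truncation order dropping by one. This is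
    why the inductions on coefficients below run over [M], for all [n] at once. *)
Lemma ptexp_coefS M p n : n.+1%:R * (ptexp M.+1 p)`_n.+1 =
  \sum_(i < n.+1) (i.+1%:R * p`_i.+1) * (ptexp M p)`_(n - i).
Proof.
have := congr1 (fun q : {poly F} => q`_n) (deriv_ptexp M p).
rewrite coef_deriv coefM mulr_natl => ->; apply: eq_bigr => i _.
by rewrite coef_deriv mulr_natl.
Qed.

End TruncatedExp.

Section ComplexModulus.
Variable R : realType.
Local Notation C := (R[i]).
Local Notation Re := complex.Re.
Local Notation Im := complex.Im.
Implicit Types (z w : C).

Definition sqm z : R := Re z ^+ 2 + Im z ^+ 2.

Lemma sqm_ge0 z : 0 <= sqm z. Proof. by rewrite addr_ge0// sqr_ge0. Qed.

Lemma sqmM z w : sqm (z * w) = sqm z * sqm w.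
Proof. by case: z w => a b [c d]; rewrite /sqm /=; ring. Qed.

Lemma sqmX z n : sqm (z ^+ n) = sqm z ^+ n.
Proof.
elim: n => [|n IH]; first by rewrite !expr0 /sqm /=; ring.
by rewrite !exprS sqmM IH.
Qed.

Lemma ReD z w : Re (z + w) = Re z + Re w. Proof. by case: z w => a b []. Qed.

Lemma ImD z w : Im (z + w) = Im z + Im w. Proof. by case: z w => a b []. Qed.

Lemma Re_sum (I : Type) (s : seq I) (P : pred I) (G : I -> C) :
  Re (\sum_(i <- s | P i) G i) = \sum_(i <- s | P i) Re (G i).
Proof. by apply: (big_morph (@Re R)) => // z w; exact: ReD. Qed.

Lemma Im_sum (I : Type) (s : seq I) (P : pred I) (G : I -> C) :
  Im (\sum_(i <- s | P i) G i) = \sum_(i <- s | P i) Im (G i).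
Proof. by apply: (big_morph (@Im R)) => // z w; exact: ImD. Qed.

Lemma sqr_sum_le n (u : 'I_n -> R) : (\sum_i u i) ^+ 2 <= n%:R * \sum_i u i ^+ 2.
Proof.
case: n u => [|n] u; first by rewrite !big_ord0 expr0n mul0r.
set S := \sum_i u i; set Q := \sum_i u i ^+ 2.
have n0 : 0 < n.+1%:R :> R by rewrite ltr0n.
pose c := S / n.+1%:R.
have : 0 <= \sum_(i < n.+1) (u i - c) ^+ 2 by apply: sumr_ge0 => i _; exact: sqr_ge0.
have -> : \sum_(i < n.+1) (u i - c) ^+ 2 = Q - 2 * c * S + n.+1%:R * c ^+ 2.
  rewrite /Q /S mulr_sumr -sumrB.
  rewrite (_ : n.+1%:R * c ^+ 2 = \sum_(i < n.+1) c ^+ 2); last first.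
    by rewrite sumr_const card_ord mulr_natl.
  by rewrite -big_split /=; apply: eq_bigr => i _; ring.
have -> : Q - 2 * c * S + n.+1%:R * c ^+ 2 = Q - S ^+ 2 / n.+1%:R.
  by rewrite /c; field; rewrite gt_eqF.
by rewrite subr_ge0 ler_pdivrMr// mulrC.
Qed.

Lemma sqm_sum_le n (G : 'I_n -> C) : sqm (\sum_i G i) <= n%:R * \sum_i sqm (G i).
Proof.
rewrite /sqm Re_sum Im_sum big_split /= mulrDr.
by apply: lerD; exact: sqr_sum_le.
Qed.

Lemma sqm_natM (n : nat) z : sqm (n%:R * z) = n%:R ^+ 2 * sqm z.
Proof.
rewrite sqmM; congr (_ * _); rewrite /sqm.
have -> : (n%:R : C) = (n%:R)%:C%C by rewrite rmorph_nat.
by rewrite /=; ring.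
Qed.

Lemma abs_Re_le z (rho : R) : 0 <= rho -> sqm z <= rho ^+ 2 -> `|Re z| <= rho.
Proof.
move=> r0 h; rewrite -(@ler_pXn2r _ 2)// ?nnegrE// real_normK ?num_real//.
by apply: le_trans h; rewrite lerDl sqr_ge0.
Qed.

End ComplexModulus.

Section LebedevMilin.
Variable R : realType.
Local Notation C := (R[i]).
Local Notation Re := complex.Re.
Local Notation Im := complex.Im.
Variables (g : {poly C}) (h : {poly R}).
Hypotheses (g0 : g`_0 = 0) (h0 : h`_0 = 0)
  (gh : forall k, h`_k = k%:R * sqm g`_k).

Lemma ptexp_coef_ge0 M n : 0 <= (ptexp M h)`_n.
Proof.
elim: M n => [|M IH] [|n].
- by rewrite ptexp0 coef1.
- by rewrite ptexp0 coef1.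
- by rewrite ptexp_coef0.
rewrite -(@pmulr_rge0 _ n.+1%:R) ?ltr0n// ptexp_coefS.
by apply: sumr_ge0 => i _; rewrite gh !mulr_ge0// sqm_ge0.
Qed.

(** Cauchy-Schwarz on the recurrence [ptexp_coefS] for [g] costs a factor [n + 1]. Since [(i + 1) ^
    2 |g_(i+1)| ^ 2 = (i + 1) h_(i+1)], what is left is [n + 1] times the recurrence for [h]. *)
Lemma lebedev_milin_coef M n : sqm (ptexp M g)`_n <= (ptexp M h)`_n.
Proof.
elim: M n => [|M IH] [|n].
- by rewrite !ptexp0 !coef1 /sqm /= expr1n expr0n addr0.
- by rewrite !ptexp0 !coef1 /sqm /= expr0n addr0.
- by rewrite !ptexp_coef0// /sqm /= expr1n expr0n addr0.
have n0 : 0 < n.+1%:R :> R by rewrite ltr0n.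
rewrite -(@ler_pM2l _ (n.+1%:R ^+ 2)) ?exprn_gt0// -sqm_natM ptexp_coefS.
apply: le_trans (sqm_sum_le _) _.
rewrite expr2 -mulrA ler_pM2l// ptexp_coefS; apply: ler_sum => i _.
rewrite sqmM sqm_natM gh mulrA -expr2 ler_wpM2l ?IH//.
by rewrite mulr_ge0 ?sqm_ge0// exprn_ge0.
Qed.

(* When [g] has only modes 1 and 2, Cauchy-Schwarz runs over two terms instead
   of four, which halves the bound on the coefficient of [X^4]. *)
Lemma lebedev_milin_coef4 M : (forall k, (3 <= k)%N -> g`_k = 0) ->
  sqm (ptexp M g)`_4 <= (ptexp M h)`_4 / 2.
Proof.
move=> g3; case: M => [|M].
  by rewrite !ptexp0 !coef1 /sqm /= expr0n addr0 mul0r.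
rewrite -(@ler_pM2l _ (4%:R ^+ 2)) ?exprn_gt0// -sqm_natM ptexp_coefS.
have h3 k : (3 <= k)%N -> h`_k = 0 by move=> k3; rewrite gh g3// /sqm /= expr0n addr0 mulr0.
have -> : 4%:R ^+ 2 * ((ptexp M.+1 h)`_4 / 2) = 2 * (4%:R * (ptexp M.+1 h)`_4) by field.
rewrite ptexp_coefS !(big_ord_recr 3) !(big_ord_recr 2) /=.
rewrite !g3// !h3// !mulr0 !mul0r !addr0.
apply: le_trans (sqm_sum_le _) _.
rewrite ler_pM2l//; apply: ler_sum => i _.
rewrite sqmM sqm_natM gh mulrA -expr2 ler_wpM2l ?lebedev_milin_coef//.
by rewrite mulr_ge0 ?sqm_ge0// exprn_ge0.
Qed.

Lemma ptexp_coef_step M n i : (i <= n)%N ->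
  i.+1%:R * h`_i.+1 * (ptexp M h)`_(n - i) <= n.+1%:R * (ptexp M.+1 h)`_n.+1.
Proof.
move=> iN; rewrite ptexp_coefS (bigD1 (Ordinal (iN : (i < n.+1)%N)))//= lerDl.
by apply: sumr_ge0 => j _; rewrite gh !mulr_ge0 ?sqm_ge0// ptexp_coef_ge0.
Qed.

(** Keeping only the term with h_1 in four steps of the recurrence gives the coefficient of X^4 in
    exp(h_1 X); each step consumes one truncation order. *)
Lemma ptexp_coef4_ge1 M : h`_1 ^+ 4 / 24 <= (ptexp M.+4 h)`_4.
Proof.
have h1 : 0 <= h`_1 by rewrite gh mulr_ge0// sqm_ge0.
have s4 := @ptexp_coef_step M.+3 3 0 isT.
have s3 := @ptexp_coef_step M.+2 2 0 isT.
have s2 := @ptexp_coef_step M.+1 1 0 isT.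
have s1 := @ptexp_coef_step M 0 0 isT.
rewrite /= subn0 in s1 s2 s3 s4; rewrite ptexp_coef0// in s1.
move: s1 s2 s3 s4.
move: (ptexp _ _)`_1 (ptexp _ _)`_2 (ptexp _ _)`_3 (ptexp _ _)`_4 h`_1 h1 => c1 c2 c3 c4 x x0.
move=> s1 s2 s3 s4.
have e1 : x <= c1 by lra.
have e2 : x * x <= 2 * c2 by apply: le_trans s2; rewrite mul1r ler_wpM2l.
have e3 : x * (x * x) <= 6 * c3.
  have := ler_wpM2l x0 e2; lra.
have := ler_wpM2l x0 e3; rewrite (_ : x ^+ 4 = x * (x * (x * x))); last by ring.
lra.
Qed.

(** The same with h_2, which reaches X^4 in two steps. *)
Lemma ptexp_coef4_ge2 M : h`_2 ^+ 2 / 2 <= (ptexp M.+2 h)`_4.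
Proof.
have h2 : 0 <= h`_2 by rewrite gh mulr_ge0// sqm_ge0.
have s2 := @ptexp_coef_step M.+1 3 1 isT.
have s1 := @ptexp_coef_step M 1 1 isT.
rewrite /= in s1 s2; rewrite ptexp_coef0// in s1.
move: s1 s2; rewrite (_ : (3 - 1)%N = 2)//.
move: (ptexp _ _)`_2 (ptexp _ _)`_4 h`_2 h2 => c1 c2 x x0 s1 s2.
have e1 : x <= c1 by lra.
have := ler_wpM2l x0 e1; rewrite expr2; lra.
Qed.

End LebedevMilin.

(** * Parseval's identity for polynomials on the unit circle *)

Section Parseval.
Variable R : realType.
Local Notation C := (R[i]).
Local Notation Re := complex.Re.
Local Notation Im := complex.Im.
Local Notation E1 := (@E1 R).
Local Notation Tor := (@Defs.Tor R).

Definition ecis (x : R) : C := Complex (cos (2 * pi * x)) (sin (2 * pi * x)).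

Lemma ecisX n x : ecis x ^+ n = Complex (cs n x) (sn n x).
Proof.
elim: n => [|n IH].
  by rewrite expr0 /cs /sn mulr0 mul0r cos0 sin0.
rewrite exprS IH /cs /sn (_ : 2 * pi * n.+1%:R * x = 2 * pi * n%:R * x + 2 * pi * x); last first.
  by rewrite -natr1; ring.
rewrite cosD sinD /ecis.
move: (2 * pi * n%:R * x) (2 * pi * x) => t s.
by apply/eqP; rewrite eq_complex /=; apply/andP; split; apply/eqP; ring.
Qed.

Lemma Re_coef_ecis (c : C) n x : Re (c * ecis x ^+ n) = Re c * cs n x - Im c * sn n x.
Proof. by rewrite ecisX; case: c. Qed.

Lemma Im_coef_ecis (c : C) n x : Im (c * ecis x ^+ n) = Re c * sn n x + Im c * cs n x.
Proof. by rewrite ecisX; case: c. Qed.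

Lemma Re_horner_ecis (p : {poly C}) N x : (size p <= N)%N ->
  Re p.[ecis x] = \sum_(n < N) (Re p`_n * cs n x - Im p`_n * sn n x).
Proof.
move=> pN; rewrite (horner_coef_wide _ pN) Re_sum; apply: eq_bigr => n _.
exact: Re_coef_ecis.
Qed.

Lemma Im_horner_ecis (p : {poly C}) N x : (size p <= N)%N ->
  Im p.[ecis x] = \sum_(n < N) (Re p`_n * sn n x + Im p`_n * cs n x).
Proof.
move=> pN; rewrite (horner_coef_wide _ pN) Im_sum; apply: eq_bigr => n _.
exact: Im_coef_ecis.
Qed.

Lemma bmeas_Re_horner (p : {poly C}) : bmeas (fun x => Re p.[ecis x]).
Proof.
apply: (@bmeas_eq _ _ (fun x => \sum_(n < size p) (Re p`_n * cs n x - Im p`_n * sn n x))).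
  by move=> x _; exact: Re_horner_ecis.
by apply: bmeas_sum => k _; apply: bmeasB; apply: bmeasZ; [exact: bmeas_cs|exact: bmeas_sn].
Qed.

Lemma bmeas_Im_horner (p : {poly C}) : bmeas (fun x => Im p.[ecis x]).
Proof.
apply: (@bmeas_eq _ _ (fun x => \sum_(n < size p) (Re p`_n * sn n x + Im p`_n * cs n x))).
  by move=> x _; exact: Im_horner_ecis.
by apply: bmeas_sum => k _; apply: bmeasD; apply: bmeasZ; [exact: bmeas_sn|exact: bmeas_cs].
Qed.

Lemma bmeas_sqm_horner (p : {poly C}) : bmeas (fun x => sqm p.[ecis x]).
Proof.
by apply: bmeasD; apply: bmeasX; [exact: bmeas_Re_horner|exact: bmeas_Im_horner].
Qed.

Lemma parseval (p : {poly C}) N : (size p <= N)%N ->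
  E1 (fun x => sqm p.[ecis x]) = \sum_(n < N) sqm p`_n.
Proof.
move=> pN; have d1 := q_u_density R.
pose a n := Re p`_n; pose b n := Im p`_n.
pose ph (n m : nat) (x : R) := 2 * pi * (n%:Z - m%:Z)%:~R * x.
pose t (n m : nat) (x : R) := (a n * a m + b n * b m) * cos (ph n m x)
  + (a n * b m - b n * a m) * sin (ph n m x).
have mph n m : measurable_fun (Tor : set (measurableTypeR R)) (ph n m).
  by apply: measurable_funM.
have bc n m : bmeas (fun x => cos (ph n m x)) by exact: bmeas_cos.
have bs n m : bmeas (fun x => sin (ph n m x)) by exact: bmeas_sin.
have bt n m : bmeas (t n m) by apply: bmeasD; exact: bmeasZ.
transitivity (E1 (fun x => \sum_(n < N) \sum_(m < N) t n m x)).
  apply: Ex_eq => x _; rewrite /sqm (Re_horner_ecis _ pN) (Im_horner_ecis _ pN).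
  rewrite !expr2 !mulr_suml -big_split; apply: eq_bigr => n _ /=.
  rewrite !mulr_sumr -big_split; apply: eq_bigr => m _ /=.
  have phE : ph n m x = 2 * pi * n%:R * x - 2 * pi * m%:R * x.
    by rewrite /ph intrB -!pmulrn; ring.
  rewrite /t phE cosB sinB -/(a n) -/(a m) -/(b n) -/(b m).
  rewrite -/(cs n x) -/(cs m x) -/(sn n x) -/(sn m x).
  by move: (cs n x) (cs m x) (sn n x) (sn m x) => *; ring.
rewrite /E1 Ex_sum//; last by move=> n _; exact: bmeas_sum.
apply: eq_bigr => n _; rewrite Ex_sum//.
rewrite (bigD1 n)//= big1 ?addr0 => [|m mn].
  rewrite /t Ex_D ?Ex_Z//; [|exact: bmeasZ..].
  rewrite -!/(E1 _) !E1_cosz !E1_sinz subrr eqxx mulr1 mulr0 addr0.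
  by rewrite /sqm /a /b !expr2.
rewrite /t Ex_D ?Ex_Z//; [|exact: bmeasZ..].
rewrite -!/(E1 _) !E1_cosz !E1_sinz mulr0 addr0 subr_eq0 eqz_nat.
rewrite (_ : (nat_of_ord n == m) = false) ?mulr0//.
by apply/negbTE; rewrite eq_sym; exact: mn.
Qed.

End Parseval.

(** * Convergence of the Taylor polynomials of the exponential *)

Section TexpLimit.
Variable R : realType.
Implicit Types (x y rho : R).

Lemma texp_series M x : texp M x = series (exp_coeff x) M.+1.
Proof. by rewrite /series /= big_mkord. Qed.

Lemma cvg_texp x : (fun M => texp M x) @ \oo --> expR x.
Proof.
have h : series (exp_coeff x) @ \oo --> expR x by exact: is_cvg_series_exp_coeff.
rewrite -(cvg_shiftS (series (exp_coeff x))) in h.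
by under eq_fun do rewrite texp_series.
Qed.

Lemma texp_diff x y L M : (M <= L)%N -> `|x| <= y ->
  `|texp L x - texp M x| <= texp L y - texp M y.
Proof.
move=> ML xy.
have E z : texp L z - texp M z = \sum_(M.+1 <= j < L.+1) z ^+ j / j`!%:R.
  rewrite /texp -!(big_mkord xpredT (fun j => z ^+ j / j`!%:R)).
  by rewrite [X in X - _](big_cat_nat (n := M.+1))//= addrAC subrr add0r.
rewrite !E; apply: sumr_abs_le => j _.
rewrite normrM normrX (ger0_norm (_ : 0 <= j`!%:R^-1)) ?invr_ge0//.
by rewrite ler_wpM2r ?invr_ge0// lerXn2r ?nnegrE// (le_trans _ xy).
Qed.

Lemma texp_mono x L M : 0 <= x -> (M <= L)%N -> texp M x <= texp L x.
Proof.
move=> x0 ML; have := texp_diff ML (_ : `|x| <= x); rewrite ger0_norm// => /(_ (lexx _)).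
by move/(le_trans (normr_ge0 _)); rewrite subr_ge0.
Qed.

Lemma cvg_le_shift (u v : nat -> R) (a b : R) M : u @ \oo --> a -> v @ \oo --> b ->
  (forall n, (M <= n)%N -> u n <= v n) -> a <= b.
Proof.
move=> ua vb uv; apply: (ler_cvg_to ua vb); near=> n.
by apply: uv; near: n; exact: nbhs_infty_ge.
Unshelve. all: by end_near. Qed.

Lemma texp_le_expR x M : 0 <= x -> texp M x <= expR x.
Proof.
move=> x0; have h : (fun _ : nat => texp M x) @ \oo --> texp M x by exact: cvg_cst.
by apply: (cvg_le_shift (M := M) h (cvg_texp (x := x))) => n; exact: texp_mono.
Qed.

Lemma expR_texp_diff x y M : `|x| <= y -> `|expR x - texp M x| <= expR y - texp M y.
Proof.
move=> xy.
apply: (@cvg_le_shift (fun L => `|texp L x - texp M x|) (fun L => texp L y - texp M y) _ _ M).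
- by apply: cvg_norm; apply: cvgB; [exact: cvg_texp|exact: cvg_cst].
- by apply: cvgB; [exact: cvg_texp|exact: cvg_cst].
- by move=> L ML; exact: texp_diff.
Qed.

End TexpLimit.

Section ComplexTexp.
Variable R : realType.
Local Notation C := (R[i]).
Local Notation Re := complex.Re.
Local Notation Im := complex.Im.

Lemma conjcM (z w : C) : conjc (z * w) = conjc z * conjc w.
Proof.
case: z w => a b [c d]; apply/eqP; rewrite eq_complex /=.
by apply/andP; split; apply/eqP; ring.
Qed.

Lemma conjcX n (w : C) : conjc (w ^+ n) = conjc w ^+ n.
Proof. by elim: n => [|n IH]; rewrite ?expr0 ?conjc1// !exprS conjcM IH. Qed.

Lemma conjc_texp M (w : C) : conjc (texp M w) = texp M (conjc w).
Proof.
rewrite /texp (big_morph (@conjc R) (id1 := 0) (op1 := +%R)).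
- by apply: eq_bigr => j _; rewrite conjcM conjcX conjc_inv conjc_nat.
- by move=> x y; rewrite raddfD.
- by rewrite conjc0.
Qed.

Lemma sqm_conjc (w : C) : sqm w = Re (w * conjc w).
Proof. by case: w => a b; rewrite /sqm /=; ring. Qed.

(** [|texp M w| ^ 2] is the product of [texp M] at [w] and at its conjugate, while [texp M (2 Re w)]
    is the triangular part of that product. The corner terms are dominated by those for [rho], which
    add up to [texp M rho ^+ 2 - texp M (2 * rho)]. *)
Lemma sqm_texp_ge M (w : C) (rho : R) : 0 <= rho -> sqm w <= rho ^+ 2 ->
  texp M (2 * Re w) - (texp M rho ^+ 2 - texp M (2 * rho)) <= sqm (texp M w).
Proof.
move=> r0 wr; rewrite sqm_conjc conjc_texp texpM.
have e1 : texp M (2 * Re w) = Re (texp M (w + conjc w)).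
  have -> : w + conjc w = (2 * Re w)%:C%C.
    by case: w {wr} => a b; apply/eqP; rewrite eq_complex /=; apply/andP; split; apply/eqP; ring.
  rewrite (_ : texp M (2 * Re w)%:C%C = (texp M (2 * Re w))%:C%C)//.
  rewrite /texp rmorph_sum; apply: eq_bigr => j _.
  by rewrite [RHS]rmorphM fmorphV rmorph_nat rmorphXn.
pose T (j l : nat) : C := (w ^+ j / j`!%:R) * (conjc w ^+ l / l`!%:R).
pose t (j l : nat) : R := (rho ^+ j / j`!%:R) * (rho ^+ l / l`!%:R).
have hT j l : `|Re (T j l)| <= t j l.
  have f0 n : 0 <= n`!%:R^-1 :> R by rewrite invr_ge0.
  have sf n : sqm (n`!%:R^-1 : C) = (n`!%:R^-1) ^+ 2.
    have -> : (n`!%:R^-1 : C) = (n`!%:R^-1 : R)%:C%C by rewrite fmorphV rmorph_nat.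
    by rewrite /sqm /= expr0n addr0.
  apply: abs_Re_le; first by rewrite !mulr_ge0// exprn_ge0.
  have cw : sqm (conjc w) = sqm w by case: (w) => a b; rewrite /sqm /= sqrrN.
  rewrite /T /t !sqmM !sqmX !sf cw !exprMn -!exprM ![(_ * 2)%N]mulnC !exprM.
  have pw n : sqm w ^+ n <= (rho ^+ 2) ^+ n by rewrite lerXn2r ?nnegrE ?sqm_ge0// sqr_ge0.
  by rewrite ler_pM ?mulr_ge0 ?exprn_ge0 ?sqm_ge0 ?invr_ge0// ler_wpM2r ?exprn_ge0.
pose Sum (G : nat -> nat -> R) := \sum_(j < M.+1) \sum_(l < M.+1) G j l.
pose Low (G : nat -> nat -> R) := \sum_(j < M.+1) \sum_(l < M.+1 | (j + l <= M)%N) G j l.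
pose Hig (G : nat -> nat -> R) := \sum_(j < M.+1) \sum_(l < M.+1 | ~~ (j + l <= M)%N) G j l.
have split_sum G : Sum G = Low G + Hig G.
  by rewrite -big_split; apply: eq_bigr => j _; rewrite (bigID (fun l : 'I_M.+1 => (j + l <= M)%N)).
have -> : texp M rho ^+ 2 = Sum t by rewrite expr2 texpM.
have -> : texp M (2 * rho) = Low t by rewrite mulr2n mulrDl mul1r texpD.
have -> : texp M (2 * Re w) = Low (fun j l => Re (T j l)).
  by rewrite e1 texpD Re_sum; apply: eq_bigr => j _; rewrite Re_sum.
rewrite (_ : Re _ = Sum (fun j l => Re (T j l))); last first.
  by rewrite Re_sum; apply: eq_bigr => j _; rewrite Re_sum.
have : - Hig t <= Hig (fun j l => Re (T j l)).
  rewrite -sumrN; apply: ler_sum => j _; rewrite -sumrN; apply: ler_sum => l _.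
  by have := hT j l; rewrite ler_norml => /andP[].
by rewrite !split_sum; lra.
Qed.

End ComplexTexp.

(** * The logarithmic Hardy-Littlewood-Sobolev inequality on the circle *)

Section LogHLS.
Variable R : realType.
Local Notation C := (R[i]).
Local Notation Re := complex.Re.
Local Notation Im := complex.Im.
Local Notation E1 := (@E1 R).
Local Notation Tor := (@Defs.Tor R).

Lemma sqm_horner_ecis_bound (g : {poly C}) :
  exists2 rho : R, 0 <= rho & forall x, Tor x -> sqm g.[ecis x] <= rho ^+ 2.
Proof.
have [_ [M hM]] := bmeas_sqm_horner g; exists (Num.sqrt `|M|); first exact: sqrtr_ge0.
move=> x Tx; rewrite sqr_sqrtr//; apply: le_trans (ler_norm _) _.
by apply: le_trans (hM x Tx) _; exact: ler_norm.
Qed.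

(** [exp (2 Re g) = |exp g| ^ 2], so its mean is the sum of the squared coefficients of [exp g]. The
    thresholds on [M] and [N] serve the gap estimate, where the coefficient of X^4 must be among the
    summands and its truncation order large enough. *)
Lemma E1_expR_Re_le (g : {poly C}) (B : R) (M0 : nat) :
  (forall M N, (M0 <= M)%N -> (4 < N)%N -> \sum_(n < N) sqm (ptexp M g)`_n <= B) ->
  E1 (fun x => expR (2 * Re g.[ecis x])) <= B.
Proof.
move=> hB; have [rho r0 hrho] := sqm_horner_ecis_bound g.
have d1 := q_u_density R.
pose u x := 2 * Re g.[ecis x].
have bu : bmeas u by apply: bmeasZ; exact: bmeas_Re_horner.
pose eps M := (texp M rho ^+ 2 - texp M (2 * rho)) + (expR (2 * rho) - texp M (2 * rho)).
have hu x : Tor x -> `|u x| <= 2 * rho.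
  move=> Tx; rewrite /u normrM ger0_norm// ler_wpM2l//.
  by apply: abs_Re_le => //; exact: hrho.
have key M : (M0 <= M)%N -> E1 (fun x => expR (u x)) <= B + eps M.
  move=> MM; pose P := ptexp M g.
  have bP := bmeas_sqm_horner P.
  have be : bmeas (fun x => sqm P.[ecis x] + eps M) by apply: bmeasD => //; exact: bmeas_cst.
  apply: (@le_trans _ _ (E1 (fun x => sqm P.[ecis x] + eps M))).
    apply: Ex_le => //; first exact: bmeas_expR.
    move=> x Tx; rewrite /P horner_ptexp.
    have h1 := sqm_texp_ge M r0 (hrho x Tx).
    have h2 := expR_texp_diff M (hu x Tx).
    rewrite ler_norml in h2; move: h1 h2; rewrite -/(u x) /eps; lra.
  rewrite /E1 Ex_D//; last exact: bmeas_cst.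
  rewrite Ex_cst// lerD2r -/(E1 _) (@parseval _ P (maxn (size P) 5)) ?leq_maxl//.
  by apply: hB => //; rewrite leq_max orbT.
have ceps : eps @ \oo --> 0.
  have -> : 0 = (expR rho ^+ 2 - expR (2 * rho)) + (expR (2 * rho) - expR (2 * rho)).
    by rewrite subrr addr0 mulr2n mulrDl mul1r expRD expr2 subrr.
  apply: cvgD; (apply: cvgB; last exact: cvg_texp); last exact: cvg_cst.
  by apply: (@cvg_comp _ _ _ _ (fun t : R => t ^+ 2) _ _ _ (cvg_texp (x := rho))); exact: exprn_continuous.
have c1 : (fun _ : nat => E1 (fun x => expR (u x))) @ \oo --> E1 (fun x => expR (u x)) by exact: cvg_cst.
have c2 : (fun M : nat => B + eps M) @ \oo --> B + 0 by apply: cvgD; [exact: cvg_cst|exact: ceps].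
by rewrite addr0 in c2; exact: (cvg_le_shift (M := M0) c1 c2 key).
Qed.

Section Density.
Variables (q : R -> R) (dq : is_density q).

(** The coefficient of order [k] is that of [q] divided by [k]. Division by zero, equal to 0,
    removes mode 0 here, in [hls_h] and in [hls_s]. *)
Definition hls_g N : {poly C} := \poly_(k < N) Complex (cq q k / k%:R) (- (sq q k / k%:R)).
Definition hls_h N : {poly R} := \poly_(k < N) (m2 q k / k%:R).

Lemma hls_g0 N : (hls_g N)`_0 = 0.
Proof. by rewrite coef_poly; case: ifP => // _; rewrite invr0 !mulr0 oppr0. Qed.

Lemma hls_h0 N : (hls_h N)`_0 = 0.
Proof. by rewrite coef_poly; case: ifP => // _; rewrite invr0 mulr0. Qed.

Lemma hls_gh N k : (hls_h N)`_k = k%:R * sqm (hls_g N)`_k.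
Proof.
rewrite !coef_poly; case: ifP => _; last by rewrite /sqm /= expr0n addr0 mulr0.
have [->|k0] := eqVneq k 0%N; first by rewrite invr0 mulr0 mul0r.
have k0' : k%:R != 0 :> R by rewrite pnatr_eq0.
by rewrite /sqm /= /m2 sqrrN; field.
Qed.

Definition hls_s N : R := \sum_(k < N) m2 q k / k%:R.

Lemma hls_h1 N : (hls_h N).[1] = hls_s N.
Proof. by rewrite horner_poly; apply: eq_bigr => k _; rewrite expr1n mulr1. Qed.

Lemma Re_hls_g N x : Re (hls_g N).[ecis x] =
  \sum_(k < N) (cq q k / k%:R * cs k x + sq q k / k%:R * sn k x).
Proof.
rewrite horner_poly Re_sum; apply: eq_bigr => k _.
by rewrite Re_coef_ecis /= mulNr opprK.
Qed.

Lemma Ex_hls_g N : Ex q (fun x => Re (hls_g N).[ecis x]) = hls_s N.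
Proof.
have b1 := @bmeas_cs R; have b2 := @bmeas_sn R.
rewrite (@Ex_eq _ _ _ (fun x => \sum_(k < N) (cq q k / k%:R * cs k x + sq q k / k%:R * sn k x))); last first.
  by move=> x _; exact: Re_hls_g.
rewrite Ex_sum//; last by move=> k _; apply: bmeasD; exact: bmeasZ.
apply: eq_bigr => k _; rewrite Ex_D ?Ex_Z//; [|exact: bmeasZ..].
by rewrite /m2 -!/(cq q k) -!/(sq q k); ring.
Qed.

Lemma hls_coef_ge0 N M n : 0 <= (ptexp M (hls_h N))`_n.
Proof. exact: ptexp_coef_ge0 (hls_h0 N) (hls_gh N) M n. Qed.

Lemma hls_sum_coef N M L : \sum_(n < L) (ptexp M (hls_h N))`_n <= texp M (hls_s N).
Proof.
rewrite -hls_h1 -horner_ptexp; set p := ptexp M _.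
pose K := maxn L (size p).
rewrite (@horner_coef_wide _ K); last exact: leq_maxr.
rewrite (big_ord_widen K (fun n => p`_n) (leq_maxl L (size p))) big_mkcond /=.
apply: ler_sum => n _; rewrite expr1n mulr1; case: ifP => // _.
exact: hls_coef_ge0.
Qed.

Lemma hls_s_ge0 N : 0 <= hls_s N.
Proof. by apply: sumr_ge0 => k _; rewrite divr_ge0// m2_ge0. Qed.

Lemma E1_expR_gt0 (f : R -> R) : bmeas f -> 0 < E1 (fun x => expR (f x)).
Proof.
move=> bf; have d1 := q_u_density R.
have [M Mf] := bf.2; apply: (@lt_le_trans _ _ (expR (- M))); first exact: expR_gt0.
rewrite -(Ex_cst (expR (- M)) d1); apply: Ex_le => //; first exact: bmeas_cst.
  exact: bmeas_expR.
by move=> x /Mf; rewrite ler_norml ler_expR => /andP[].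
Qed.

Lemma hls_gibbs N (B : R) :
  E1 (fun x => expR (2 * Re (hls_g N).[ecis x])) <= B ->
  ((2 * hls_s N - ln B)%:E <= entropy q)%E.
Proof.
move=> hB; have br := bmeas_Re_horner (hls_g N).
have bf : bmeas (fun x => 2 * Re (hls_g N).[ecis x]) by exact: bmeasZ.
apply: le_trans (gibbs dq bf); rewrite lee_fin Ex_Z// Ex_hls_g lerD2l lerN2.
have Z0 := E1_expR_gt0 bf.
by rewrite ler_ln// posrE//; exact: lt_le_trans hB.
Qed.

(** Gibbs with the test function [2 Re g] gives [2 s - ln Z] for [s = hls_s N], and Lebedev-Milin
    bounds [Z] by [exp s]. *)
Lemma log_hls N : ((hls_s N)%:E <= entropy q)%E.
Proof.
have := @hls_gibbs N (expR (hls_s N)); rewrite expRK mulr2n mulrDl mul1r addrK; apply.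
apply: (@E1_expR_Re_le _ _ 0) => M L _ _.
apply: le_trans (texp_le_expR M (hls_s_ge0 N)).
apply: le_trans (hls_sum_coef N M L); apply: ler_sum => n _.
exact: lebedev_milin_coef (hls_g0 N) (hls_h0 N) (hls_gh N) M n.
Qed.

Lemma hls_s3 : hls_s 3 = m2 q 1 + m2 q 2 / 2.
Proof. by rewrite /hls_s !big_ord_recr big_ord0 /= invr0 mulr0 !add0r divr1. Qed.

(** By [lebedev_milin_coef4] the coefficient of X^4 loses at least half of its bound. A loss [d]
    lowers the partition function to [exp s - d], whose logarithm is at most [s - exp (- s) * d]. *)
Lemma log_hls_gap d : 0 <= d ->
  (forall M, (4 <= M)%N -> d <= (ptexp M (hls_h 3))`_4 / 2) ->
  ((hls_s 3 + expR (- hls_s 3) * d)%:E <= entropy q)%E.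
Proof.
move=> d0 hd; set s := hls_s 3.
have hB : E1 (fun x => expR (2 * Re (hls_g 3).[ecis x])) <= expR s - d.
  apply: (@E1_expR_Re_le _ _ 4) => M L M4 L4.
  apply: (@le_trans _ _ (\sum_(n < L) (ptexp M (hls_h 3))`_n - d)); last first.
    rewrite lerD2r; apply: le_trans (texp_le_expR M (hls_s_ge0 3)).
    exact: hls_sum_coef.
  rewrite (bigD1 (Ordinal L4))//= [X in _ <= X - d](bigD1 (Ordinal L4))//=.
  rewrite [leRHS]addrAC lerD//.
    have g3 k : (3 <= k)%N -> (hls_g 3)`_k = 0 by move=> k3; rewrite coef_poly ltnNge k3.
    have h1 := lebedev_milin_coef4 (hls_g0 3) (hls_h0 3) (hls_gh 3) M g3.
    have h2 : sqm (ptexp M (hls_g 3))`_4 <= (ptexp M (hls_h 3))`_4 - d.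
      by apply: le_trans h1 _; have := hd M M4; move: ((ptexp M (hls_h 3))`_4) => b; lra.
    exact: h2.
  apply: ler_sum => n _.
  exact: lebedev_milin_coef (hls_g0 3) (hls_h0 3) (hls_gh 3) M n.
have B0 : 0 < expR s - d.
  by apply: lt_le_trans hB; apply: E1_expR_gt0; apply: bmeasZ; exact: bmeas_Re_horner.
apply: le_trans (hls_gibbs hB); rewrite lee_fin -/s.
have es := expR_gt0 s.
have BE : expR s - d = expR s * (1 + - (expR (- s) * d)).
  by rewrite mulrDr mulr1 mulrN mulrA expRN divff ?mul1r// gt_eqF.
have p0 : 0 < 1 + - (expR (- s) * d) by rewrite -(pmulr_rgt0 _ es) -BE.
rewrite BE lnM ?posrE// expRK.
have := @le_ln1Dx _ (- (expR (- s) * d)).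
have h : -1 < - (expR (- s) * d) by lra.
by move=> /(_ h); lra.
Qed.

Lemma hls_s3_le : hls_s 3 <= 3.
Proof. by rewrite hls_s3; have := m2_le2 1 dq; have := m2_le2 2 dq; lra. Qed.

Lemma log_hls_gap3 d : 0 <= d ->
  (forall M, (4 <= M)%N -> d <= (ptexp M (hls_h 3))`_4 / 2) ->
  ((m2 q 1 + m2 q 2 / 2 + expR (- 3) * d)%:E <= entropy q)%E.
Proof.
move=> d0 hd; apply: le_trans (log_hls_gap d0 hd).
by rewrite lee_fin hls_s3 lerD2l ler_wpM2r// ler_expR lerN2 -hls_s3 hls_s3_le.
Qed.

(** 48 is [2 * 4!]: half of h_1^4 / 4! with h_1 = [m2 q 1]. *)
Lemma log_hls_gap_mode1 :
  ((m2 q 1 + m2 q 2 / 2 + expR (- 3) * (m2 q 1 ^+ 4 / 48))%:E <= entropy q)%E.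
Proof.
apply: log_hls_gap3; first by rewrite divr_ge0// exprn_ge0// m2_ge0.
case=> [|[|[|[|M]]]]// _.
have := ptexp_coef4_ge1 (hls_h0 3) (hls_gh 3) M.
by rewrite coef_poly /= divr1; lra.
Qed.

(** Half of h_2^2 / 2 with h_2 = [m2 q 2 / 2]. *)
Lemma log_hls_gap_mode2 :
  ((m2 q 1 + m2 q 2 / 2 + expR (- 3) * (m2 q 2 ^+ 2 / 16))%:E <= entropy q)%E.
Proof.
apply: log_hls_gap3; first by rewrite divr_ge0// exprn_ge0// m2_ge0.
case=> [|[|[|[|M]]]]// _.
have := ptexp_coef4_ge2 (hls_h0 3) (hls_gh 3) M.+2.
by rewrite coef_poly /= expr_div_n; lra.
Qed.

End Density.
End LogHLS.

(** * A test density *)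

Section TestDensity.
Variable R : realType.
Local Notation E1 := (@E1 R).
Local Notation Tor := (@Defs.Tor R).
Local Notation leb := (@Defs.leb R).
Local Notation q_u := (@Defs.q_u R).
Implicit Types (q f : R -> R) (t x : R).

Lemma bmeas_density q : bmeas q -> (forall x, Tor x -> 0 <= q x) -> E1 q = 1 -> is_density q.
Proof.
move=> bq q0; rewrite E1E /Rintegral => q1; split; first exact: bq.1.
split=> //; rewrite -q1 fineK//; apply: integrable_fin_num (bmeas_integrable bq).
exact: measurable_Tor.
Qed.

Lemma Ex_E1 q f : Ex q f = E1 (fun x => q x * f x).
Proof. by rewrite E1E. Qed.

Lemma entropy_le q f : is_density q -> bmeas f ->
  (forall x, Tor x -> q x * ln (q x) <= f x) -> (entropy q <= (E1 f)%:E)%E.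
Proof.
move=> dq bf h; have mT := @measurable_Tor R.
have i1 := bmeas_integrable bf.
have i2 := integrable_sub1 dq.
(* The integrand lies between [q - 1] and [f], which excludes infinite entropy. *)
have ix : leb.-integrable Tor (EFin \o (fun x => q x * ln (q x))).
  apply: (le_integrable mT _ _ (integrableD mT (integrable_norm i1) i2)).
    by apply/measurable_EFinP; exact: measurable_xlnx.
  move=> x Tx /=; rewrite lee_fin [leRHS]ger0_norm ?addr_ge0//.
  have h1 := h x Tx; have h2 := xlnx_ge 0 (dq.2.1 x Tx); rewrite expR0 mulr0 add0r in h2.
  have := ler_norm (f x); have := ler_norm (- (q x - 1)); rewrite normrN.
  have := normr_ge0 (f x); have := normr_ge0 (q x - 1).
  by rewrite ler_norml; lra.
by rewrite entropyE// lee_fin E1E; apply: le_Rintegral.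
Qed.

(** The difference of the two sides has derivative [s ^+ 5 / (1 + s)], of the sign of [s]; odd order
    makes the Taylor polynomial an upper bound on both sides of 0. *)
Lemma ln1D_le5 t : -1 < t ->
  ln (1 + t) <= t - t ^+ 2 / 2 + t ^+ 3 / 3 - t ^+ 4 / 4 + t ^+ 5 / 5.
Proof.
pose p (t : R) := t - t ^+ 2 / 2 + t ^+ 3 / 3 - t ^+ 4 / 4 + t ^+ 5 / 5.
move=> t1; rewrite -/(p t) -subr_ge0; pose F (t : R) := p t - ln (1 + t).
have dF (s : R) : -1 < s -> is_derive s 1 F (s ^+ 5 / (1 + s)).
  move=> s1; have s0 : 0 < 1 + s by lra.
  have h1 : is_derive s 1 (fun s : R => 1 + s) 1 by apply: is_derive_eq; rewrite add0r mulr1.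
  have h2 : is_derive s 1 (fun s : R => ln (1 + s)) ((1 + s)^-1).
    have := @is_derive1_comp _ (@ln R) (fun s : R => 1 + s) s _ _ (is_derive1_ln s0) h1.
    by rewrite mulr1.
  rewrite /F /p; apply: is_derive_eq; rewrite /GRing.scale /=; field.
  by rewrite gt_eqF.
have F0 : F 0 = 0 by rewrite /F /p addr0 ln1; ring.
rewrite -[leRHS]/(F t) -F0; clearbody F; clear p.
have cF a b : -1 < a -> {within `[a, b], continuous F}.
  move=> a1; apply: continuous_in_subspaceT => s /set_mem /=; rewrite in_itv /= => /andP[as_ _].
  apply: differentiable_continuous; apply/derivable1_diffP; apply: ex_derive.
  by apply: dF; exact: lt_le_trans as_.
have mvt a b : -1 < a -> a < b ->
    exists2 c, a < c < b & F b - F a = c ^+ 5 / (1 + c) * (b - a).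
  move=> a1 ab; have d s : s \in `]a, b[ -> is_derive s 1 F (s ^+ 5 / (1 + s)).
    by rewrite in_itv /= => /andP[as_ _]; apply: dF; exact: lt_trans as_.
  have [c cab E] := MVT ab d (cF _ _ a1).
  by exists c => //; rewrite in_itv /= in cab.
have [t0|t0|->] := ltgtP t 0; last exact: lexx.
  have [c /andP[tc c0] E] := mvt _ _ t1 t0.
  rewrite -subr_le0 E mulr_le0_ge0 ?subr_ge0 ?(ltW t0)//.
  rewrite mulr_le0_ge0 ?invr_ge0//; last by lra.
  rewrite exprSr mulr_ge0_le0 ?(ltW c0)//.
  by rewrite (exprM c 2 2) sqr_ge0.
have m1 : -1 < 0 :> R by lra.
have [c /andP[c0 ct] E] := mvt _ _ m1 t0.
rewrite -subr_ge0 E mulr_ge0 ?subr_ge0 ?(ltW t0)// divr_ge0 ?exprn_ge0 ?(ltW c0)//.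
by lra.
Qed.

Lemma xlnx_le4 t : `|t| <= 1 / 2 ->
  (1 + t) * ln (1 + t) <= t + t ^+ 2 / 2 - t ^+ 3 / 6 + t ^+ 4 / 12 + `|t| ^+ 5.
Proof.
move=> ht; have := ht; rewrite ler_norml => /andP[t1 t2].
have h1 : -1 < t by lra.
have h2 : 0 <= 1 + t by lra.
apply: le_trans (ler_wpM2l h2 (ln1D_le5 h1)) _.
have -> : (1 + t) * (t - t ^+ 2 / 2 + t ^+ 3 / 3 - t ^+ 4 / 4 + t ^+ 5 / 5) =
  t + t ^+ 2 / 2 - t ^+ 3 / 6 + t ^+ 4 / 12 + (t ^+ 5 * (t / 5 - 20^-1)) by field.
rewrite lerD2l; apply: le_trans (ler_norm _) _.
rewrite normrM normrX -{2}[`|t| ^+ 5]mulr1 ler_wpM2l ?exprn_ge0//.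
by rewrite ler_norml; lra.
Qed.

(** With coefficients [a], [b] on modes 1 and 2 the entropy is [a^2 + b^2 - a^2 b + a^4 / 2] up to
    higher order. Against an interaction [a^2 + b^2 / 2], the borderline ratio at the threshold,
    [b = a^2] is the optimal choice; it makes the density the Poisson kernel cut after mode 2. *)
Definition qtest (rho : R) (x : R) : R := 1 + (2 * rho * cs 1 x + 2 * rho ^+ 2 * cs 2 x).

Section Rho.
Variables (rho : R) (Hrho : 0 < rho <= 1 / 8).

Let r0 : 0 < rho. Proof. by case/andP: Hrho. Qed.

Let r8 : rho <= 1 / 8. Proof. by case/andP: Hrho. Qed.

Definition ttest (x : R) : R := 2 * rho * cs 1 x + 2 * rho ^+ 2 * cs 2 x.

Lemma ttest_abs x : `|ttest x| <= 4 * rho.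
Proof.
have := abs_cs 1 x; have := abs_cs 2 x; rewrite /ttest.
move: (cs 1 x) (cs 2 x) => a b hb ha.
apply: le_trans (ler_normD _ _) _.
have p1 : 0 <= 2 * rho by rewrite mulr_ge0// ltW.
have p2 : 0 <= 2 * rho ^+ 2 by rewrite mulr_ge0// sqr_ge0.
rewrite (normrM (2 * rho)) (normrM (2 * rho ^+ 2)) (ger0_norm p1) (ger0_norm p2).
have h1 : 2 * rho * `|a| <= 2 * rho by rewrite ler_piMr// mulr_ge0// ltW.
have h2 : 2 * rho ^+ 2 * `|b| <= 2 * rho ^+ 2 by rewrite ler_piMr// mulr_ge0// sqr_ge0.
have h3 : rho ^+ 2 <= rho by rewrite expr2 ler_piMr ?(ltW r0)//; have := r8; lra.
by have := r0; lra.
Qed.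

Lemma ttest_half x : `|ttest x| <= 1 / 2.
Proof. by have := ttest_abs x; have := r8; lra. Qed.

Lemma bmeas_qtest : bmeas (qtest rho).
Proof.
apply: bmeasD; first exact: bmeas_cst.
by apply: bmeasD; apply: bmeasZ; exact: bmeas_cs.
Qed.

Lemma qtest_density : is_density (qtest rho).
Proof.
have d1 := q_u_density R; have bc := @bmeas_cs R.
apply: bmeas_density; first exact: bmeas_qtest.
  by move=> x _; have := ttest_half x; rewrite ler_norml /qtest -/(ttest x); lra.
rewrite /qtest /E1 Ex_D//; [|exact: bmeas_cst|by apply: bmeasD; exact: bmeasZ].
rewrite Ex_cst// Ex_D//; [|exact: bmeasZ|exact: bmeasZ].
by rewrite !Ex_Z// -!/(E1 _) !E1_cs// !mulr0 !addr0.
Qed.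

Lemma cq_qtest k : (0 < k)%N -> cq (qtest rho) k = rho * (k == 1)%:R + rho ^+ 2 * (k == 2)%:R.
Proof.
move=> k0; have d1 := q_u_density R; have bc := @bmeas_cs R.
have bcc i j : bmeas (fun x => cs i x * cs j x) by exact: bmeasM.
rewrite /cq Ex_E1 [LHS](@Ex_eq _ _ _ (fun x => cs k x + (2 * rho * (cs 1 x * cs k x) + 2 * rho ^+ 2 * (cs 2 x * cs k x)))); last first.
  by move=> x _; rewrite /qtest; ring.
rewrite Ex_D//; [|by apply: bmeasD; exact: bmeasZ].
rewrite Ex_D//; [|exact: bmeasZ|exact: bmeasZ].
rewrite !Ex_Z// -!/(E1 _) E1_cs// !E1_cscs// add0r (eq_sym k) (eq_sym k).
by field.
Qed.

Lemma Aq_qtest (r : R) : 0 < r <= pi ->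
  wh r 1 * rho ^+ 2 + wh r 2 * rho ^+ 4 <= Aq r (qtest rho).
Proof.
move=> Hr; apply: le_trans (AN_le_Aq Hr 3 qtest_density).
rewrite /AN big_ltn// big_ltn// big_geq// addr0 /m2 !cq_qtest//= !mulr0 !mulr1 addr0 add0r.
apply: lerD.
  by rewrite ler_wpM2l ?(ltW (wh_gt0 Hr _))// lerDl sqr_ge0.
by rewrite ler_wpM2l ?(ltW (wh_gt0 Hr _))// -exprM lerDl sqr_ge0.
Qed.

(** The terms of degree at most 4 in [rho] of the bound [xlnx_le4], with [cs 1 x ^+ 2] replaced by
    [(1 + cs 2 x) / 2], so that only single cosines and products of two are left to integrate. *)
Let G (x : R) : R :=
  2 * rho * cs 1 x + 2 * rho ^+ 2 * cs 2 x + rho ^+ 2 * (1 + cs 2 x)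
  + 4 * rho ^+ 3 * (cs 1 x * cs 2 x) + 2 * rho ^+ 4 * (cs 2 x * cs 2 x)
  - 2 / 3 * rho ^+ 3 * (cs 1 x + cs 1 x * cs 2 x)
  - 2 * rho ^+ 4 * (cs 2 x + cs 2 x * cs 2 x)
  + rho ^+ 4 / 3 * (1 + 2 * cs 2 x + cs 2 x * cs 2 x).

Lemma cs2E x : cs 2 x = 2 * cs 1 x ^+ 2 - 1.
Proof.
rewrite /cs (_ : 2 * pi * 2 * x = (2 * pi * 1 * x) *+ 2); last by rewrite mulr2n; ring.
by rewrite cos_mulr2n mulr2n; ring.
Qed.

(* [1024 * rho ^+ 5] comes from [`|ttest x| <= 4 * rho], the rest from the terms of
   degree at least 5 in the expansion. *)
Lemma xlnx_qtest_le x : qtest rho x * ln (qtest rho x) <= G x + 1100 * rho ^+ 5.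
Proof.
apply: le_trans (xlnx_le4 (ttest_half x)) _.
have h5 : `|ttest x| ^+ 5 <= 1024 * rho ^+ 5.
  have -> : 1024 * rho ^+ 5 = (4 * rho) ^+ 5 by ring.
  by rewrite lerXn2r ?nnegrE ?ttest_abs// mulr_ge0// ltW.
have a1 := abs_cs 1 x; have a2 := abs_cs 2 x; have c2 := cs2E x.
rewrite /ttest /G; move: h5; rewrite /ttest; move: `|_ + _| => T.
move: (cs 1 x) (cs 2 x) a1 a2 c2 => a b a1 a2 c2 h5.
have e2 : a ^+ 2 = (1 + b) / 2 by lra.
have b2 i j : `|a ^+ i * b ^+ j| <= 1.
  by rewrite normrM !normrX mulr_ile1 ?exprn_ge0// exprn_ile1.
pose rem := 4 / 3 * (- (3 * (a ^+ 1 * b ^+ 2) + rho * (a ^+ 0 * b ^+ 3))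
  + (4 * (a ^+ 3 * b ^+ 1) + 6 * rho * (a ^+ 2 * b ^+ 2) + 4 * rho ^+ 2 * (a ^+ 1 * b ^+ 3) + rho ^+ 3 * (a ^+ 0 * b ^+ 4))).
have hrem : rem <= 30.
  have m i j : - 1 <= a ^+ i * b ^+ j <= 1 by rewrite -ler_norml.
  have := m 1%N 2%N; have := m 0%N 3%N; have := m 3%N 1%N; have := m 2%N 2%N.
  have := m 1%N 3%N; have := m 0%N 4%N; rewrite /rem.
  have rho2 : 0 <= rho ^+ 2 <= 1 by rewrite sqr_ge0 exprn_ile1//; have := r0; have := r8; lra.
  have rho3 : 0 <= rho ^+ 3 <= 1 by rewrite exprn_ge0 ?exprn_ile1//; have := r0; have := r8; lra.
  have := r0; have := r8; move: (rho ^+ 2) (rho ^+ 3) rho2 rho3.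
  move: (a ^+ 0 * b ^+ 4) (a ^+ 1 * b ^+ 3) (a ^+ 2 * b ^+ 2) (a ^+ 3 * b ^+ 1) (a ^+ 0 * b ^+ 3) (a ^+ 1 * b ^+ 2).
  move=> x1 x2 x3 x4 x5 x6 s2 s3 h2 h3 h8 h0 y1 y2 y3 y4 y5 y6.
  have z1 : - (rho * x5) <= 1 by nra.
  have z2 : rho * x3 <= 1 by nra.
  have z3 : s2 * x2 <= 1 by nra.
  have z4 : s3 * x1 <= 1 by nra.
  by lra.
have -> : 2 * rho * a + 2 * rho ^+ 2 * b + (2 * rho * a + 2 * rho ^+ 2 * b) ^+ 2 / 2 -
    (2 * rho * a + 2 * rho ^+ 2 * b) ^+ 3 / 6 + (2 * rho * a + 2 * rho ^+ 2 * b) ^+ 4 / 12 =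
  (2 * rho * a + 2 * rho ^+ 2 * b + rho ^+ 2 * (2 * a ^+ 2)
  + 4 * rho ^+ 3 * (a * b) + 2 * rho ^+ 4 * (b * b)
  - 4 / 3 * rho ^+ 3 * (a * a ^+ 2)
  - 4 * rho ^+ 4 * (a ^+ 2 * b)
  + rho ^+ 4 * (4 / 3) * (a ^+ 2 * a ^+ 2)) + rho ^+ 5 * rem.
  by rewrite /rem; field.
have hr : rho ^+ 5 * rem <= rho ^+ 5 * 30 by rewrite ler_wpM2l// exprn_ge0// ltW.
rewrite !e2; have r5 : 0 <= rho ^+ 5 by rewrite exprn_ge0// ltW.
move: hr h5 r5; clear -e2; move: (rho ^+ 5) (rem) => s5 rm hr h5 r5; lra.
Qed.

Lemma E1_G : E1 G = rho ^+ 2 + rho ^+ 4 / 2.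
Proof.
have d1 := q_u_density R; have bc := @bmeas_cs R.
have bcc i j : bmeas (fun x => cs i x * cs j x) by exact: bmeasM.
pose c0 := rho ^+ 2 + rho ^+ 4 / 3.
pose c1 := 2 * rho - 2 / 3 * rho ^+ 3.
pose c2 := 3 * rho ^+ 2 - 4 / 3 * rho ^+ 4.
pose c12 := 10 / 3 * rho ^+ 3.
pose c22 := rho ^+ 4 / 3.
rewrite [LHS](@Ex_eq _ _ _ (fun x => c0 + (c1 * cs 1 x + (c2 * cs 2 x + (c12 * (cs 1 x * cs 2 x) + c22 * (cs 2 x * cs 2 x)))))); last first.
  by move=> x _; rewrite /G /c0 /c1 /c2 /c12 /c22; field.
rewrite Ex_D//; [rewrite Ex_cst//|exact: bmeas_cst|by repeat (exact: bmeasZ || apply: bmeasD)].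
rewrite Ex_D//; [|exact: bmeasZ|by repeat (exact: bmeasZ || apply: bmeasD)].
rewrite Ex_D//; [|exact: bmeasZ|by repeat (exact: bmeasZ || apply: bmeasD)].
rewrite Ex_D//; [|exact: bmeasZ|exact: bmeasZ].
rewrite !Ex_Z// -!/(E1 _) !E1_cs// !E1_cscs//=.
by rewrite /c0 /c22; field.
Qed.

Lemma entropy_qtest : (entropy (qtest rho) <= (rho ^+ 2 + rho ^+ 4 / 2 + 1100 * rho ^+ 5)%:E)%E.
Proof.
have d1 := q_u_density R; have bc := @bmeas_cs R.
have bcc i j : bmeas (fun x => cs i x * cs j x) by exact: bmeasM.
have bG : bmeas G.
  by rewrite /G; repeat (apply: bmeasD || apply: bmeasB || apply: bmeasN || apply: bmeasZ || apply: bc || apply: bcc || apply: bmeas_cst).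
have bG' : bmeas (fun x => G x + 1100 * rho ^+ 5) by apply: bmeasD => //; exact: bmeas_cst.
apply: le_trans (entropy_le qtest_density bG' (fun x _ => xlnx_qtest_le x)) _.
by rewrite lee_fin /E1 Ex_D ?Ex_cst//; [rewrite -/(E1 _) E1_G|exact: bmeas_cst].
Qed.

End Rho.

(** 1200 exceeds [1100 + 1 / 2], the total weight of the error terms to be absorbed. *)
Lemma small_scale (d : R) : 0 < d -> exists2 rho, 0 < rho <= 1 / 8 & rho <= d / 1200.
Proof.
move=> d0; exists (Num.min (1 / 8) (d / 1200)); last by rewrite ge_min lexx orbT.
have d1 : 0 < d / 1200 by lra.
have e1 : (0 : R) < 1 / 8 by lra.
by rewrite lt_min ge_min lexx d1 e1.
Qed.

(** Applied with [a = 2 K wh 1] and [b = 2 K wh 2]. Above [Ksharp] the gain is of order [rho ^+ 2];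
    at [Ksharp] this order cancels and [b > 1 / 2] wins at order [rho ^+ 4]. *)
Lemma test_polynomial_lt (a b : R) : 0 <= b -> (1 < a) || ((a == 1) && (1 / 2 < b)) ->
  exists2 rho : R, 0 < rho <= 1 / 8 &
    rho ^+ 2 + rho ^+ 4 / 2 + 1100 * rho ^+ 5 < a * rho ^+ 2 + b * rho ^+ 4.
Proof.
move=> b0 hab.
have red (p : R) : 0 < p -> 1 + p ^+ 2 / 2 + 1100 * p ^+ 3 < a + b * p ^+ 2 ->
    p ^+ 2 + p ^+ 4 / 2 + 1100 * p ^+ 5 < a * p ^+ 2 + b * p ^+ 4.
  move=> p0 h; have p2 : 0 < p ^+ 2 by rewrite exprn_gt0.
  rewrite -(ltr_pM2l p2) in h.
  have -> : p ^+ 2 + p ^+ 4 / 2 + 1100 * p ^+ 5 = p ^+ 2 * (1 + p ^+ 2 / 2 + 1100 * p ^+ 3) by field.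
  by have -> : a * p ^+ 2 + b * p ^+ 4 = p ^+ 2 * (a + b * p ^+ 2) by ring.
case/orP: hab => [h|/andP[/eqP a1 h2]].
  have [p /andP[p0 p8] pd] : exists2 p, 0 < p <= 1 / 8 & p <= (a - 1) / 1200.
    by apply: small_scale; rewrite subr_gt0.
  exists p; first by rewrite p0.
  apply: red => //; apply: (@lt_le_trans _ _ a); last by rewrite lerDl mulr_ge0// sqr_ge0.
  have e2 : p ^+ 2 <= p by rewrite expr2 ler_piMl ?(ltW p0)//; lra.
  have e3 : p ^+ 3 <= p by rewrite exprS ler_piMr ?(ltW p0)// exprn_ile1 ?(ltW p0)//; lra.
  by lra.
have [p /andP[p0 p8] pd] : exists2 p, 0 < p <= 1 / 8 & p <= (b - 1 / 2) / 1200.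
  by apply: small_scale; rewrite subr_gt0.
exists p; first by rewrite p0.
apply: red => //; rewrite a1.
have p2 : 0 < p ^+ 2 by rewrite exprn_gt0.
have e : 1100 * p < b - 1 / 2 by lra.
have : p ^+ 2 * (1100 * p) < p ^+ 2 * (b - 1 / 2) by rewrite ltr_pM2l.
rewrite (_ : p ^+ 3 = p ^+ 2 * p); last by ring.
by lra.
Qed.

Lemma qtest_excess_lt0 (r K : R) : 0 < r <= pi -> 0 <= K ->
  (1 < 2 * K * wh r 1) || ((2 * K * wh r 1 == 1) && (1 / 2 < 2 * K * wh r 2)) ->
  exists q, is_density q /\ (entropy q < (2 * K * Aq r q)%:E)%E.
Proof.
move=> Hr K0 hK.
have kw : 0 <= 2 * K * wh r 2.
  by apply: mulr_ge0; [exact: mulr_ge0|apply: ltW; exact: wh_gt0].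
have [rho Hrho hlt] := test_polynomial_lt kw hK.
exists (qtest rho); split; first exact: qtest_density.
apply: le_lt_trans (entropy_qtest Hrho) _; rewrite lte_fin; apply: lt_le_trans hlt _.
rewrite -(mulrA (2 * K) (wh r 1)) -(mulrA (2 * K) (wh r 2)) -mulrDr.
by rewrite ler_wpM2l ?mulr_ge0// Aq_qtest.
Qed.

End TestDensity.

(** * Existence of minimizers *)

Section Existence.
Variable R : realType.
Local Notation E1 := (@E1 R).
Local Notation Tor := (@Defs.Tor R).
Local Notation q_u := (@Defs.q_u R).
Implicit Types (q p : R -> R) (x : R).

Lemma cauchy_rate (u : nat -> R) (C : R) :
  (forall N M, (0 < N)%N -> (N <= M)%N -> `|u M - u N| <= C / N%:R) ->
  forall N, (0 < N)%N -> `|limn u - u N| <= C / N%:R.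
Proof.
move=> h.
have cu : cvgn u.
  apply/cauchy_cvgP; apply: cauchy_exP => e e0.
  have C0 : 0 <= C by have := h 1%N 1%N isT isT; rewrite subrr normr0 divr1.
  pose N := (Num.bound (C / e)).+1.
  have N0 : 0 < N%:R :> R by rewrite ltr0n.
  have CN : C / N%:R < e.
    rewrite ltr_pdivrMr// mulrC -ltr_pdivrMr//.
    apply: lt_le_trans (archi_boundP _) _; last by rewrite ler_nat.
    by rewrite divr_ge0// ltW.
  have hN : \forall n \near \oo, ball (u N) e (u n).
    near=> n; rewrite -ball_normE /ball_ /= distrC.
    apply: le_lt_trans CN; apply: h => //.
    by near: n; exact: nbhs_infty_ge.
  by exists (u N); exact: hN.
move=> N N0.
have c1 : (fun M => `|u M - u N|) @ \oo --> `|limn u - u N|.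
  by apply: cvg_norm; apply: cvgB; [exact: cu|exact: cvg_cst].
have c2 : (fun _ : nat => C / N%:R) @ \oo --> C / N%:R by exact: cvg_cst.
apply: (ler_cvg_to c1 c2); near=> M; apply: h => //.
by near: M; exact: nbhs_infty_ge.
Unshelve. all: by end_near. Qed.

Lemma ln_E1_expR_lip (f g : R -> R) e : bmeas f -> bmeas g ->
  (forall x, Tor x -> `|f x - g x| <= e) ->
  `|ln (E1 (fun x => expR (f x))) - ln (E1 (fun x => expR (g x)))| <= e.
Proof.
move=> bf bg fg; have d1 := q_u_density R.
have main (f' g' : R -> R) : bmeas f' -> bmeas g' -> (forall x, Tor x -> f' x <= g' x + e) ->
    ln (E1 (fun x => expR (f' x))) <= ln (E1 (fun x => expR (g' x))) + e.
  move=> bf' bg' h; have be := bmeas_expR bg'.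
  have Z1 := E1_expR_gt0 bf'; have Z2 := E1_expR_gt0 bg'.
  have -> : ln (E1 (fun x => expR (g' x))) + e = ln (expR e * E1 (fun x => expR (g' x))).
    by rewrite lnM ?posrE ?expR_gt0// expRK addrC.
  rewrite ler_ln ?posrE ?mulr_gt0 ?expR_gt0// /E1 -Ex_Z//.
  apply: Ex_le => //; [exact: bmeas_expR|exact: bmeasZ|].
  by move=> x Tx; rewrite -expRD ler_expR addrC; exact: h.
rewrite ler_norml; apply/andP; split.
  have := main g f bg bf; rewrite -lerBlDr lerBlDl -lerBlDr => H.
  rewrite lerNl opprB lerBlDl; apply: main => // x Tx.
  by have := fg x Tx; rewrite ler_norml; clear; move: (f x) (g x) => u v; lra.
rewrite lerBlDl; apply: main => // x Tx.
by have := fg x Tx; rewrite ler_norml; clear; move: (f x) (g x) => u v; lra.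
Qed.

Section Functional.
Variables (r K : R) (Hr : 0 < r <= pi) (K0 : 0 <= K).
Local Notation wh := (wh r).
Local Notation W0 := (W0 r).
Local Notation X := (prod_topology (fun _ : nat * bool => R)).
Implicit Types (c : X).

(* Candidate Fourier coefficients, [(k, false)] being the cosine and [(k, true)] the sine
   coefficient of mode [k]; compact for the product topology by Tychonoff's theorem. *)
Definition cube : set X := [set c | forall i, (`[(-1 : R), 1]%classic) (c i)].

Lemma cube_compact : compact cube.
Proof.
exact: (@tychonoff (nat * bool)%type (fun=> R) (fun=> `[(-1 : R), 1]%classic)
  (fun=> @segment_compact R (-1) 1)).
Qed.

Lemma cube_abs c i : cube c -> `|c i| <= 1.
Proof. by move=> /(_ i) /=; rewrite in_itv /= ler_norml. Qed.

Lemma wh_ge0 k : (0 < k)%N -> 0 <= wh k.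
Proof. by move=> k0; apply: ltW; exact: wh_gt0. Qed.

Lemma wsum_bound (F : nat -> R) (B : R) N M : (0 < N)%N -> 0 <= B ->
  (forall k, (0 < k)%N -> `|F k| <= B) ->
  `|\sum_(N <= k < M) wh k * F k| <= B * 8 / N%:R.
Proof.
move=> N0 B0 FB; apply: (@le_trans _ _ (\sum_(N <= k < M) B * wh k)).
  rewrite big_nat_cond [leRHS]big_nat_cond; apply: sumr_abs_le => k /andP[/andP[Nk _] _].
  have k0 := leq_trans N0 Nk; have w0 := wh_gt0 Hr k0.
  by rewrite normrM (gtr0_norm w0) mulrC ler_wpM2r ?(ltW w0)// FB.
rewrite -mulr_sumr -mulrA ler_wpM2l//.
exact: sum_wh_tail.
Qed.

Lemma wsum_cauchy (F : nat -> R) (B : R) : 0 <= B ->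
  (forall k, (0 < k)%N -> `|F k| <= B) -> forall N M, (0 < N)%N -> (N <= M)%N ->
  `|\sum_(1 <= k < M) wh k * F k - \sum_(1 <= k < N) wh k * F k| <= B * 8 / N%:R.
Proof.
move=> B0 FB N M N0 NM.
rewrite [X in `|X - _|](big_cat_nat N0 NM) /= addrAC subrr add0r.
exact: wsum_bound.
Qed.

Definition UN c N x : R :=
  \sum_(1 <= k < N) wh k * (2 * (c (k, false) * cs k x + c (k, true) * sn k x)).
(** For [c = coefs q] this is the potential [conv q - W0]. *)
Definition U c x : R := limn (fun N => UN c N x).
Definition QN c N : R := \sum_(1 <= k < N) wh k * (c (k, false) ^+ 2 + c (k, true) ^+ 2).
Definition Q c : R := limn (QN c).

Lemma U_approx c N x : cube c -> (0 < N)%N -> `|U c x - UN c N x| <= 32 / N%:R.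
Proof.
move=> cc N0; rewrite (_ : 32 = 4 * 8); last by ring.
apply: (@cauchy_rate (fun N => UN c N x)) => // n m n0 nm.
apply: wsum_cauchy => // k k0; rewrite normrM ger0_norm//.
have h1 : `|c (k, false) * cs k x| <= 1 by rewrite normrM mulr_ile1 ?cube_abs ?abs_cs.
have h2 : `|c (k, true) * sn k x| <= 1 by rewrite normrM mulr_ile1 ?cube_abs ?abs_sn.
have := ler_normD (c (k, false) * cs k x) (c (k, true) * sn k x); lra.
Qed.

Lemma Q_approx c N : cube c -> (0 < N)%N -> `|Q c - QN c N| <= 16 / N%:R.
Proof.
move=> cc N0; rewrite (_ : 16 = 2 * 8); last by ring.
apply: (@cauchy_rate (QN c)) => // n m n0 nm.
apply: wsum_cauchy => // k k0.
have h i : `|c i ^+ 2| <= 1 by rewrite normrX exprn_ile1 ?cube_abs.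
have := ler_normD (c (k, false) ^+ 2) (c (k, true) ^+ 2).
by have := h (k, false); have := h (k, true); lra.
Qed.

Lemma bmeas_UN c N : bmeas (UN c N).
Proof.
apply: bmeas_sum => k _; apply: bmeasZ; apply: bmeasZ; apply: bmeasD; apply: bmeasZ.
  exact: bmeas_cs.
exact: bmeas_sn.
Qed.

Lemma bmeas_U c : cube c -> bmeas (U c).
Proof.
move=> cc; apply: (@bmeas_lim _ _ (fun n => UN c n.+1) 32) => [n|n x _].
  exact: bmeas_UN.
exact: U_approx.
Qed.

Lemma Ex_UN q c N : is_density q -> Ex q (UN c N) =
  \sum_(1 <= k < N) wh k * (2 * (c (k, false) * cq q k + c (k, true) * sq q k)).
Proof.
move=> dq; have bc := @bmeas_cs R; have bs := @bmeas_sn R.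
have b1 k : bmeas (fun x => c (k, false) * cs k x + c (k, true) * sn k x).
  by apply: bmeasD; exact: bmeasZ.
rewrite /UN Ex_sum//; last by move=> k _; apply: bmeasZ; exact: bmeasZ.
apply: eq_bigr => k _; rewrite Ex_Z ?Ex_Z ?Ex_D ?Ex_Z//; try exact: bmeasZ.
Qed.

(** Young's inequality mode by mode, weighted by [wh k >= 0]: the convex form [Aq] lies above its
    linearization at [c]. *)
Lemma Ex_U_le q c : is_density q -> cube c -> Ex q (U c) <= Aq r q + Q c.
Proof.
move=> dq cc; apply: (@le_rate _ _ _ (32 + 16)) => n.
have h1 : `|Ex q (U c) - Ex q (UN c n.+1)| <= 32 / n.+1%:R.
  apply: Ex_dist => //; [exact: bmeas_U|exact: bmeas_UN|].
  by move=> x _; exact: U_approx.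
have h2 := Q_approx cc (ltn0Sn n); have h3 := AN_le_Aq Hr n.+1 dq.
have h4 : Ex q (UN c n.+1) <= AN r q n.+1 + QN c n.+1.
  rewrite Ex_UN// /AN /QN -big_split /= big_nat_cond [leRHS]big_nat_cond.
  apply: ler_sum => k /andP[/andP[k1 _] _]; rewrite -mulrDr ler_wpM2l ?wh_ge0// /m2.
  have := sqr_ge0 (c (k, false) - cq q k); have := sqr_ge0 (c (k, true) - sq q k); nra.
rewrite !ler_norml in h1 h2; case/andP: h1 => _ h1; case/andP: h2 => h2 _.
rewrite mulrDl; move: h1 h2 h3 h4.
move: (32 / _) (16 / _) (AN _ _ _) (QN _ _) (Ex q (UN _ _)) => a b A B E; lra.
Qed.

Definition coefs q : X := fun i => if i.2 then sq q i.1 else cq q i.1.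

Lemma coefs_cube q : is_density q -> cube (coefs q).
Proof.
move=> dq [k b] /=; rewrite in_itv /= -ler_norml /coefs /=.
by case: b; [exact: sq_abs|exact: cq_abs].
Qed.

Lemma QN_coefs q N : QN (coefs q) N = AN r q N.
Proof. by []. Qed.

Lemma Q_coefs_le q : is_density q -> Q (coefs q) <= Aq r q.
Proof.
move=> dq; apply: (@le_rate _ _ _ 16) => n.
have h2 := Q_approx (coefs_cube dq) (ltn0Sn n); have h3 := AN_le_Aq Hr n.+1 dq.
rewrite QN_coefs ler_norml in h2; case/andP: h2 => _ h2.
by move: h2 h3; move: (16 / _) (AN _ _ _) => a A; lra.
Qed.

Lemma Ex_U_coefs_ge q : is_density q -> 2 * Aq r q <= Ex q (U (coefs q)).
Proof.
move=> dq; have cc := coefs_cube dq; apply: (@le_rate _ _ _ (32 + 16)) => n.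
have h1 : `|Ex q (U (coefs q)) - Ex q (UN (coefs q) n.+1)| <= 32 / n.+1%:R.
  apply: Ex_dist => //; [exact: bmeas_U|exact: bmeas_UN|].
  by move=> x _; exact: U_approx.
have h3 := Aq_le Hr dq (ltn0Sn n).
have h4 : Ex q (UN (coefs q) n.+1) = 2 * AN r q n.+1.
  by rewrite Ex_UN// /AN mulr_sumr; apply: eq_bigr => k _; rewrite /coefs /m2 /=; ring.
rewrite h4 ler_norml in h1; case/andP: h1 => h1 _.
rewrite (mulrDl 32 16) (_ : 16 / n.+1%:R = 2 * (8 / n.+1%:R)); last by ring.
by move: h1 h3; move: (32 / _) (8 / _) (AN _ _ _) => a b A; lra.
Qed.

(* Dual functional: by Gibbs' variational principle its minimizers [c] yield the
   minimizers [gibbs_density c] of the excess free energy. *)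
Definition Jf c : R := 2 * K * Q c - ln (E1 (fun x => expR (2 * K * U c x))).

(** At [c = coefs q] the linearization is tight, so Gibbs' inequality with exponent [2 K U c] bounds
    the excess below. *)
Lemma Jf_le_excess q : is_density q -> ((Jf (coefs q))%:E <= excess r K q)%E.
Proof.
move=> dq; have cc := coefs_cube dq.
have bf : bmeas (fun x => 2 * K * U (coefs q) x) by apply: bmeasZ; exact: bmeas_U.
have := gibbs dq bf; rewrite /excess /Jf Ex_Z//; last exact: bmeas_U.
have h1 := Q_coefs_le dq; have h2 := Ex_U_coefs_ge dq.
have k2 : 0 <= 2 * K by rewrite mulr_ge0.
have h3 := ler_wpM2l k2 h1; have h4 := ler_wpM2l k2 h2.
case: (entropy q) => [s| |] //=; last by move=> _; exact: leey.
rewrite -EFinB !lee_fin; move: (ln _) => l; lra.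
Qed.

Definition gibbs_density c x : R :=
  expR (2 * K * U c x) / E1 (fun x => expR (2 * K * U c x)).

Section GibbsDensity.
Variables (c : X) (cc : cube c).
Let f x : R := 2 * K * U c x.
Let Z : R := E1 (fun x => expR (f x)).

Let bf : bmeas f. Proof. by apply: bmeasZ; exact: bmeas_U. Qed.

Let Z0 : 0 < Z. Proof. exact: E1_expR_gt0. Qed.

Lemma bmeas_gibbs_density : bmeas (gibbs_density c).
Proof.
apply: (@bmeas_eq _ _ (fun x => Z^-1 * expR (f x))); first by move=> x _; exact: mulrC.
by apply: bmeasZ; exact: bmeas_expR.
Qed.

Lemma gibbs_density_density : is_density (gibbs_density c).
Proof.
apply: bmeas_density; first exact: bmeas_gibbs_density.
  by move=> x _; rewrite divr_ge0 ?expR_ge0 ?(ltW Z0).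
rewrite [LHS](@Ex_eq _ _ _ (fun x => Z^-1 * expR (f x))); last by move=> x _; exact: mulrC.
rewrite Ex_Z; [|exact: q_u_density|exact: bmeas_expR].
by rewrite mulVf// gt_eqF.
Qed.

(** For the Gibbs density the entropy equals the Gibbs bound; the linearization [Ex_U_le] then errs
    in the favourable direction. *)
Lemma excess_gibbs_density : (excess r K (gibbs_density c) <= (Jf c)%:E)%E.
Proof.
have dg := gibbs_density_density; have bg := bmeas_gibbs_density.
have bfl : bmeas (fun x => f x - ln Z) by apply: bmeasB => //; exact: bmeas_cst.
have hent : (entropy (gibbs_density c) <= (Ex (gibbs_density c) (fun x => (f x - ln Z)%R))%:E)%E.
  rewrite Ex_E1; apply: entropy_le => //; first exact: bmeasM.
  move=> x _; rewrite le_eqVlt; apply/orP; left; apply/eqP; apply: (f_equal (fun u => _ * u)).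
  by rewrite /gibbs_density -/(f x) -/Z ln_div ?posrE ?expR_gt0// expRK.
have h2 := Ex_U_le dg cc; have k2 : 0 <= 2 * K by rewrite mulr_ge0.
have h3 := ler_wpM2l k2 h2.
rewrite Ex_B// in hent; last exact: bmeas_cst.
rewrite Ex_cst// Ex_Z// in hent; last exact: bmeas_U.
apply: (@le_trans _ _ ((2 * K * Ex (gibbs_density c) (U c) - ln Z)%:E - (2 * K * Aq r (gibbs_density c))%:E)%E).
  by rewrite /excess leeB.
rewrite -EFinB lee_fin /Jf -/f -/Z; move: h3; move: (ln Z) => l; lra.
Qed.

End GibbsDensity.

(** A weighted distance that sees only the modes below [N], hence finitely many coordinates of the
    product topology. *)
Definition dist N (c c' : X) : R :=
  \sum_(1 <= k < N) wh k * (`|c (k, false) - c' (k, false)| + `|c (k, true) - c' (k, true)|).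

Lemma U_dist c c' N x : cube c -> cube c' -> (0 < N)%N ->
  `|U c x - U c' x| <= 64 / N%:R + 2 * dist N c c'.
Proof.
move=> cc cc' N0; have h1 := U_approx x cc N0; have h2 := U_approx x cc' N0.
have h3 : `|UN c N x - UN c' N x| <= 2 * dist N c c'.
  rewrite /UN -sumrB /dist mulr_sumr big_nat_cond [leRHS]big_nat_cond.
  apply: sumr_abs_le => k /andP[/andP[k1 _] _].
  have w0 := wh_gt0 Hr k1; rewrite -mulrBr normrM (gtr0_norm w0) mulrCA ler_wpM2l ?(ltW w0)//.
  rewrite -mulrBr normrM ger0_norm// ler_wpM2l//.
  rewrite (_ : _ - _ = (c (k, false) - c' (k, false)) * cs k x + (c (k, true) - c' (k, true)) * sn k x); last by ring.
  apply: le_trans (ler_normD _ _) _; rewrite !normrM.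
  by apply: lerD; rewrite ler_piMr// ?abs_cs ?abs_sn.
rewrite (_ : 64 / N%:R = 32 / N%:R + 32 / N%:R :> R); last by rewrite -mulrDl; congr (_ / _); ring.
move: h1 h2 h3; rewrite !ler_norml; move: (32 / _) (2 * _) => a b.
by move=> /andP[? ?] /andP[? ?] /andP[? ?]; apply/andP; split; lra.
Qed.

Lemma Q_dist c c' N : cube c -> cube c' -> (0 < N)%N ->
  `|Q c - Q c'| <= 64 / N%:R + 2 * dist N c c'.
Proof.
move=> cc cc' N0; have h1 := Q_approx cc N0; have h2 := Q_approx cc' N0.
have h3 : `|QN c N - QN c' N| <= 2 * dist N c c'.
  rewrite /QN -sumrB /dist mulr_sumr big_nat_cond [leRHS]big_nat_cond.
  apply: sumr_abs_le => k /andP[/andP[k1 _] _].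
  have w0 := wh_gt0 Hr k1; rewrite -mulrBr normrM (gtr0_norm w0) mulrCA ler_wpM2l ?(ltW w0)//.
  have hs i : `|c i ^+ 2 - c' i ^+ 2| <= 2 * `|c i - c' i|.
    rewrite subr_sqr normrM mulrC ler_wpM2r//.
    apply: le_trans (ler_normD _ _) _; have := cube_abs i cc; have := cube_abs i cc'; lra.
  rewrite (_ : _ - _ = (c (k, false) ^+ 2 - c' (k, false) ^+ 2) + (c (k, true) ^+ 2 - c' (k, true) ^+ 2)); last by ring.
  by apply: le_trans (ler_normD _ _) _; rewrite mulrDr lerD.
have h4 : 0 <= 16 / N%:R :> R by rewrite divr_ge0.
rewrite (_ : 64 / N%:R = 4 * (16 / N%:R) :> R); last by rewrite mulrA; congr (_ / _); ring.
move: h1 h2 h3 h4; rewrite !ler_norml; move: (16 / _) (2 * _) => a b.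
by move=> /andP[? ?] /andP[? ?] /andP[? ?] ?; apply/andP; split; lra.
Qed.

Lemma Jf_dist c c' N : cube c -> cube c' -> (0 < N)%N ->
  `|Jf c - Jf c'| <= 4 * K * (64 / N%:R + 2 * dist N c c').
Proof.
move=> cc cc' N0; set D := 64 / _ + _.
have k2 : 0 <= 2 * K by rewrite mulr_ge0.
have h1 : `|2 * K * Q c - 2 * K * Q c'| <= 2 * K * D.
  by rewrite -mulrBr normrM (ger0_norm k2) ler_wpM2l// Q_dist.
have b1 : bmeas (fun x => 2 * K * U c x) by apply: bmeasZ; exact: bmeas_U.
have b2 : bmeas (fun x => 2 * K * U c' x) by apply: bmeasZ; exact: bmeas_U.
have h2 : `|ln (E1 (fun x => expR (2 * K * U c x))) - ln (E1 (fun x => expR (2 * K * U c' x)))| <= 2 * K * D.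
  apply: ln_E1_expR_lip => // x _.
  by rewrite -mulrBr normrM (ger0_norm k2) ler_wpM2l// U_dist.
have aux (a b l l' d : R) : `|a - b| <= d -> `|l - l'| <= d -> `|a - l - (b - l')| <= d + d.
  by rewrite !ler_norml => /andP[? ?] /andP[? ?]; apply/andP; split; lra.
apply: le_trans (aux _ _ _ _ _ h1 h2) _.
by rewrite -mulrDl -mulrDl -natrD.
Qed.

(** The tail beyond [N] is small uniformly on the cube and takes [e / 2]; closeness [eta] in the
    finitely many coordinates below [N] takes the other half. *)
Lemma Jf_continuous : {within cube, continuous Jf}.
Proof.
apply/subspace_continuousP => c cc; apply/cvgrPdist_le => e e0.
pose C := 4 * K; have C0 : 0 <= C by rewrite mulr_ge0.
pose N := (Num.bound (128 * C / e)).+1.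
have N0 : 0 < N%:R :> R by rewrite ltr0n.
have hb : 128 * C / e <= N%:R.
  apply: ltW; apply: lt_le_trans (archi_boundP _) _; last by rewrite ler_nat.
  by apply: divr_ge0; [exact: mulr_ge0|exact: ltW].
rewrite ler_pdivrMr// in hb.
have CN : C * (64 / N%:R) <= e / 2.
  rewrite (_ : C * (64 / N%:R) = 128 * C / N%:R / 2); last by field; rewrite gt_eqF.
  by rewrite ler_wpM2r// ler_pdivrMr// (mulrC e).
pose S := \sum_(1 <= k < N) wh k.
have S0 : 0 <= S.
  rewrite /S big_nat_cond; apply: sumr_ge0 => k /andP[/andP[k1 _] _].
  exact: wh_ge0.
pose eta := e / (8 * C * S + 1).
have den0 : 0 < 8 * C * S + 1.
  apply: ltr_wpDl => //; apply: mulr_ge0 => //; exact: mulr_ge0.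
have eta0 : 0 < eta by rewrite divr_gt0.
have near1 (i : nat * bool) : \forall c' \near (c : X), `|c i - c' i| <= eta.
  have pc : (fun c' : X => c' i : R) @ nbhs c --> (c i : R).
    exact: (@proj_continuous (nat * bool)%type (fun=> (R : topologicalType)) i c).
  by have /cvgrPdist_le/(_ eta eta0) := pc.
have nearN : \forall c' \near (c : X), forall j : 'I_N * bool, `|c (j.1 : nat, j.2) - c' (j.1 : nat, j.2)| <= eta.
  apply: (@filter_forall X ('I_N * bool)%type
    (fun j => [set c' : X | `|c (j.1 : nat, j.2) - c' (j.1 : nat, j.2)| <= eta]) (nbhs c)).
  by move=> j; exact: near1.
have h c' : (forall j : 'I_N * bool, `|c (j.1 : nat, j.2) - c' (j.1 : nat, j.2)| <= eta) ->
    cube c' -> `|Jf c - Jf c'| <= e.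
  move=> hc' cc'; apply: le_trans (Jf_dist cc cc' (isT : (0 < N)%N)) _.
  have hd : dist N c c' <= S * (2 * eta).
    rewrite /dist /S mulr_suml big_nat_cond [leRHS]big_nat_cond.
    apply: ler_sum => k /andP[/andP[k1 kN] _]; rewrite ler_wpM2l ?wh_ge0//.
    have h1 := hc' (Ordinal kN, false); have h2 := hc' (Ordinal kN, true).
    by rewrite mulr2n mulrDl mul1r; exact: lerD.
  rewrite -/C mulrDr.
  have h1 : C * (2 * dist N c c') <= C * (2 * (S * (2 * eta))).
    by rewrite ler_wpM2l// ler_wpM2l.
  have h2 : C * (2 * (S * (2 * eta))) <= e / 2.
    rewrite (_ : C * (2 * (S * (2 * eta))) = 4 * C * S * eta); last by ring.
    rewrite /eta mulrA ler_pdivrMr//.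
    rewrite (_ : e / 2 * (8 * C * S + 1) = 4 * C * S * e + e / 2); last by field.
    by rewrite lerDl ltW// divr_gt0.
  by apply: le_trans (lerD CN (le_trans h1 h2)) _; rewrite -splitr.
exact: (@filterS _ (nbhs (c : X)) _ _ _ h nearN).
Qed.

(** A minimizer [c] of [Jf] on the cube yields the chain [excess (gibbs_density c) <= Jf c <= Jf
    (coefs p) <= excess p]. *)
Lemma global_min_exists : exists q, global_min (W_HK r) K q.
Proof.
have c0 : cube (fun=> 0) by move=> i /=; rewrite in_itv /= ; lra.
have cn : cube !=set0 by exists (fun=> 0).
have [c ccube cmin] := compact_EVT_min cn cube_compact Jf_continuous.
have cc : cube c := set_mem ccube.
exists (gibbs_density c); apply/(global_minP Hr); split; first exact: gibbs_density_density.
move=> p dp; apply: le_trans (excess_gibbs_density cc) _.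
apply: le_trans (Jf_le_excess dp); rewrite lee_fin.
by apply: cmin; apply/mem_set; exact: coefs_cube.
Qed.

End Functional.
End Existence.

(** * Local stability of the uniform density *)

Section LocalStability.
Variable R : realType.
Local Notation E1 := (@E1 R).
Local Notation Tor := (@Defs.Tor R).
Local Notation q_u := (@Defs.q_u R).
Implicit Types (q p : R -> R) (x y : R).

(** The difference vanishes at 0. For [0 <= t <= eta / (1 + eta)] the bound [exp t <= 1 / (1 - t)]
    makes its derivative nonnegative; for [t < 0] the bound [1 + t <= exp t] makes it
    nonpositive. *)
Lemma expR_le_quadratic (eta y : R) : 0 < eta -> y * (1 + eta) <= eta ->
  expR y <= 1 + y + (1 + eta) / 2 * y ^+ 2.
Proof.
move=> eta0 yeta.
pose g (y : R) := 1 + y + (1 + eta) / 2 * y ^+ 2 - expR y.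
have dg (t : R) : is_derive t 1 g (1 + (1 + eta) * t - expR t).
  by rewrite /g; apply: is_derive_eq; rewrite /GRing.scale /=; field.
have g0 : g 0 = 0 by rewrite /g expR0 expr0n /= mulr0; ring.
rewrite -subr_ge0 -[leRHS]/(g y) -g0; clearbody g.
have [y0|y0] := leP 0 y.
  apply: (derive_ge0_le y0 dg) => t /andP[t0 ty].
  have t1 : t * (1 + eta) <= eta.
    by apply: le_trans yeta; rewrite ler_wpM2r ?(ltW ty)//; lra.
  have tlt : t < 1 by nra.
  have ht : 0 < 1 - t by lra.
  have he : expR t * (1 - t) <= 1.
    have := expR_ge1Dx (- t); rewrite -(ler_pM2l (expR_gt0 t)) -expRD subrr expR0.
    by [].
  rewrite subr_ge0 -(ler_pM2r ht); apply: le_trans he _.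
  have : 0 <= t * (eta - t * (1 + eta)) by rewrite mulr_ge0 ?(ltW t0)//; lra.
  by lra.
have dgN (t : R) : is_derive t 1 (fun t => - g t) (- (1 + (1 + eta) * t - expR t)).
  by have := dg t => h; apply: is_derive_eq.
rewrite -lerN2; apply: (derive_ge0_le (ltW y0) dgN) => t /andP[yt t0].
have := expR_ge1Dx t; have : 0 <= eta * - t by rewrite mulr_ge0//; lra.
lra.
Qed.

Section FixedRadius.
Variables (r : R) (Hr : 0 < r <= pi).
Local Notation wh := (wh r).

Lemma E1_cs_UN c N k : (0 < k < N)%N -> E1 (fun x => cs k x * UN r c N x) = wh k * c (k, false).
Proof.
case/andP=> k0 kN; have d1 := q_u_density R.
have b1 j : bmeas (fun x : R => cs k x * cs j x) by apply: bmeasM; exact: bmeas_cs.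
have b2 j : bmeas (fun x : R => sn j x * cs k x) by apply: bmeasM; [exact: bmeas_sn|exact: bmeas_cs].
rewrite [LHS](@Ex_eq _ _ _ (fun x => \sum_(1 <= j < N) (wh j * (2 * (c (j, false) * (cs k x * cs j x) + c (j, true) * (sn j x * cs k x)))))); last first.
  by move=> x _; rewrite /UN mulr_sumr; apply: eq_bigr => j _; move: (wh j) => w; ring.
have b3 j : bmeas (fun x => c (j, false) * (cs k x * cs j x) + c (j, true) * (sn j x * cs k x)).
  by apply: bmeasD; exact: bmeasZ.
rewrite Ex_sum//; last by move=> j _; apply: bmeasZ; exact: bmeasZ.
have E j : Ex q_u (fun x => wh j * (2 * (c (j, false) * (cs k x * cs j x) + c (j, true) * (sn j x * cs k x)))) =
    wh j * (2 * (c (j, false) * Ex q_u (fun x => cs k x * cs j x))).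
  rewrite Ex_Z ?Ex_Z ?Ex_D ?Ex_Z//; try exact: bmeasZ.
  by rewrite -!/(E1 _) E1_sncs mulr0 addr0.
rewrite (eq_bigr _ (fun j _ => E j)).
rewrite (bigD1_seq k) ?iota_uniq ?mem_index_iota ?k0 ?kN//= [X in _ + X]big1_seq ?addr0.
  by rewrite -!/(E1 _) E1_cscs// eqxx (_ : true%:R = 1 :> R)//; move: (wh k) => w; field.
move=> j /andP[jk]; rewrite mem_index_iota => /andP[j0 _].
by rewrite -!/(E1 _) E1_cscs// (eq_sym k) (negPf jk) mul0r !mulr0.
Qed.

Lemma E1_sn_UN c N k : (0 < k < N)%N -> E1 (fun x => sn k x * UN r c N x) = wh k * c (k, true).
Proof.
case/andP=> k0 kN; have d1 := q_u_density R.
have b1 j : bmeas (fun x : R => sn k x * sn j x) by apply: bmeasM; exact: bmeas_sn.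
have b2 j : bmeas (fun x : R => sn k x * cs j x) by apply: bmeasM; [exact: bmeas_sn|exact: bmeas_cs].
rewrite [LHS](@Ex_eq _ _ _ (fun x => \sum_(1 <= j < N) (wh j * (2 * (c (j, false) * (sn k x * cs j x) + c (j, true) * (sn k x * sn j x)))))); last first.
  by move=> x _; rewrite /UN mulr_sumr; apply: eq_bigr => j _; move: (wh j) => w; ring.
have b3 j : bmeas (fun x => c (j, false) * (sn k x * cs j x) + c (j, true) * (sn k x * sn j x)).
  by apply: bmeasD; exact: bmeasZ.
rewrite Ex_sum//; last by move=> j _; apply: bmeasZ; exact: bmeasZ.
have E j : Ex q_u (fun x => wh j * (2 * (c (j, false) * (sn k x * cs j x) + c (j, true) * (sn k x * sn j x)))) =
    wh j * (2 * (c (j, true) * Ex q_u (fun x => sn k x * sn j x))).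
  rewrite Ex_Z ?Ex_Z ?Ex_D ?Ex_Z//; try exact: bmeasZ.
  by rewrite -!/(E1 _) E1_sncs mulr0 add0r.
rewrite (eq_bigr _ (fun j _ => E j)).
rewrite (bigD1_seq k) ?iota_uniq ?mem_index_iota ?k0 ?kN//= [X in _ + X]big1_seq ?addr0.
  by rewrite -!/(E1 _) E1_snsn// eqxx (_ : true%:R = 1 :> R)//; move: (wh k) => w; field.
move=> j /andP[jk]; rewrite mem_index_iota => /andP[j0 _].
by rewrite -!/(E1 _) E1_snsn// (eq_sym k) (negPf jk) mul0r !mulr0.
Qed.

Lemma E1_UN c N : E1 (UN r c N) = 0.
Proof.
rewrite /E1 Ex_UN; last exact: q_u_density.
rewrite big_nat_cond big1// => k /andP[/andP[k1 _] _].
by rewrite /cq /sq -!/(E1 _) E1_cs// E1_sn !mulr0 addr0 !mulr0.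
Qed.

(** Orthogonality gives [2 \sum wh k ^ 2 * m2 q k], and mode 1 has the largest coefficient. *)
Lemma E1_UN_sqr q N : is_density q ->
  E1 (fun x => UN r (coefs q) N x ^+ 2) <= 2 * wh 1 * AN r q N.
Proof.
move=> dq; have d1 := q_u_density R; have bU := bmeas_UN r (coefs q) N.
have b1 k : bmeas (fun x => cs k x * UN r (coefs q) N x) by apply: bmeasM => //; exact: bmeas_cs.
have b2 k : bmeas (fun x => sn k x * UN r (coefs q) N x) by apply: bmeasM => //; exact: bmeas_sn.
rewrite [leLHS](@Ex_eq _ _ _ (fun x => \sum_(1 <= k < N) (wh k * (2 * (cq q k * (cs k x * UN r (coefs q) N x) + sq q k * (sn k x * UN r (coefs q) N x)))))); last first.
  move=> x _; rewrite expr2 {1}/UN mulr_suml; apply: eq_bigr => k _.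
  by rewrite /coefs /=; move: (wh k) (UN _ _ _ _) => w u; ring.
have b3 k : bmeas (fun x => cq q k * (cs k x * UN r (coefs q) N x) + sq q k * (sn k x * UN r (coefs q) N x)).
  by apply: bmeasD; exact: bmeasZ.
rewrite Ex_sum//; last by move=> k _; apply: bmeasZ; exact: bmeasZ.
rewrite /AN mulr_sumr big_nat_cond [leRHS]big_nat_cond; apply: ler_sum => k /andP[/andP[k1 kN] _].
rewrite Ex_Z ?Ex_Z ?Ex_D ?Ex_Z//; try exact: bmeasZ.
rewrite -!/(E1 _) E1_cs_UN ?k1// E1_sn_UN ?k1// /coefs /=.
have w0 := ltW (wh_gt0 Hr k1); have w1 := wh_le_wh1 Hr k1; have m0 := m2_ge0 q k.
rewrite /m2 in m0 *; move: (cq q k) (sq q k) (wh k) (wh 1) w0 w1 m0 => a b w v w0 w1 m0.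
have -> : w * (2 * (a * (w * a) + b * (w * b))) = 2 * (w * (w * (a ^+ 2 + b ^+ 2))) by ring.
by rewrite -mulrA ler_wpM2l// ler_wpM2r// mulr_ge0.
Qed.

Lemma UN_bound q N eps : is_density q -> 0 <= eps -> (L1dist_u q <= eps%:E)%E ->
  forall x, `|UN r (coefs q) N x| <= 32 * eps.
Proof.
move=> dq e0 hq x.
have ca k : (0 < k)%N -> `|cq q k| <= eps.
  move=> k0; have := @Ex_L1dist R q (@cs R k) eps 1 dq (@bmeas_cs R k) hq ler01 (fun x _ => abs_cs k x).
  by rewrite E1_cs// subr0 mul1r.
have sa k : `|sq q k| <= eps.
  have := @Ex_L1dist R q (@sn R k) eps 1 dq (@bmeas_sn R k) hq ler01 (fun x _ => abs_sn k x).
  by rewrite E1_sn subr0 mul1r.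
rewrite (_ : 32 * eps = 4 * eps * 8 / 1%:R); last by rewrite divr1; ring.
rewrite /UN; apply: wsum_bound => //; first exact: mulr_ge0.
move=> k k0; rewrite normrM ger0_norm// /coefs /=.
rewrite (_ : 4 * eps = 2 * (eps + eps)); last by ring.
rewrite ler_wpM2l//; apply: le_trans (ler_normD _ _) _; rewrite !normrM.
apply: lerD; rewrite -[leRHS]mulr1; apply: ler_pM => //; [exact: ca|exact: abs_cs|exact: abs_sn].
Qed.

(** Gibbs with [s] times the truncated potential of [q] itself: its mean under [q] is [2 s AN]. For
    [q] close to uniform this function is small, so its log-partition function is quadratic: mean
    zero and [E1_UN_sqr] bound it by [s AN] for this [s]. Hence [s AN <= h]. *)
Lemma local_entropy_bound (eta : R) : 0 < eta -> exists2 eps, 0 < eps &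
  forall q h, is_density q -> (L1dist_u q <= eps%:E)%E -> entropy q = h%:E ->
  Aq r q <= (1 + eta) * wh 1 * h.
Proof.
move=> eta0; have w1 := wh_gt0 Hr (isT : (0 < 1)%N).
have e1 : 0 < 1 + eta by lra.
pose s := ((1 + eta) * wh 1)^-1.
have s0 : 0 < s by rewrite invr_gt0 mulr_gt0.
(* By [UN_bound] the potential is at most [32 * eps]; this [eps] just keeps [s] times it in the
   range of [expR_le_quadratic]. *)
pose eps := eta / (32 * s * (1 + eta)).
have eps0 : 0 < eps by rewrite divr_gt0// mulr_gt0// mulr_gt0.
have sE : s * ((1 + eta) * wh 1) = 1 by rewrite mulVf// gt_eqF// mulr_gt0.
have epsE : s * (32 * eps) * (1 + eta) = eta.
  by rewrite /eps; field; rewrite !gt_eqF.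
exists eps => // q h dq hq hh; apply: (Aq_le_bound Hr) => // N.
have bU := bmeas_UN r (coefs q) N; have d1 := q_u_density R.
have bf : bmeas (fun x => s * UN r (coefs q) N x) by exact: bmeasZ.
have hg := gibbs dq bf; rewrite hh lee_fin Ex_Z// Ex_UN// in hg.
have hA : \sum_(1 <= k < N) wh k * (2 * (coefs q (k, false) * cq q k + coefs q (k, true) * sq q k)) = 2 * AN r q N.
  rewrite /AN mulr_sumr; apply: eq_bigr => k _; rewrite /coefs /m2 /=.
  by move: (wh k) => w; ring.
rewrite hA in hg.
have AN0 : 0 <= AN r q N.
  rewrite /AN big_nat_cond; apply: sumr_ge0 => k /andP[/andP[k1 _] _].
  by apply: mulr_ge0; [apply: ltW; exact: wh_gt0|exact: m2_ge0].
have hZ : E1 (fun x => expR (s * UN r (coefs q) N x)) <= 1 + s * AN r q N.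
  have bq : bmeas (fun x => s * UN r (coefs q) N x + (1 + eta) / 2 * s ^+ 2 * UN r (coefs q) N x ^+ 2).
    by apply: bmeasD => //; apply: bmeasZ; exact: bmeasX.
  apply: (@le_trans _ _ (E1 (fun x => 1 + (s * UN r (coefs q) N x + (1 + eta) / 2 * s ^+ 2 * UN r (coefs q) N x ^+ 2)))).
    apply: Ex_le => //; [exact: bmeas_expR|by apply: bmeasD => //; exact: bmeas_cst|].
    move=> x _; have := UN_bound N dq (ltW eps0) hq x; set u := UN _ _ _ _ => hu.
    have hy : s * u * (1 + eta) <= eta.
      rewrite -[leRHS]epsE ler_wpM2r ?(ltW e1)// ler_wpM2l ?(ltW s0)//.
      by apply: le_trans hu; exact: ler_norm.
    apply: le_trans (expR_le_quadratic eta0 hy) _.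
    by rewrite exprMn le_eqVlt; apply/orP; left; apply/eqP; ring.
  rewrite /E1 Ex_D//; last exact: bmeas_cst.
  rewrite Ex_cst// lerD2l Ex_D//; last by apply: bmeasZ; exact: bmeasX.
  rewrite !Ex_Z//; last exact: bmeasX.
  rewrite -!/(E1 _) E1_UN mulr0 add0r.
  have h2 : 0 <= (1 + eta) / 2 * s ^+ 2 by rewrite mulr_ge0 ?sqr_ge0// divr_ge0// ltW.
  apply: le_trans (ler_wpM2l h2 (E1_UN_sqr N dq)) _.
  have -> : (1 + eta) / 2 * s ^+ 2 * (2 * wh 1 * AN r q N) = (s * ((1 + eta) * wh 1)) * (s * AN r q N).
    by move: (wh 1) (AN _ _ _) => w a; field.
  by rewrite sE mul1r.
have Z0 := E1_expR_gt0 bf.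
have sA : 0 <= s * AN r q N by rewrite mulr_ge0// ltW.
have hl : ln (E1 (fun x => expR (s * UN r (coefs q) N x))) <= s * AN r q N.
  apply: (@le_trans _ _ (ln (1 + s * AN r q N))); last by apply: le_ln1Dx; lra.
  by rewrite ler_ln ?posrE//; exact: lt_le_trans hZ.
have hs : s * AN r q N <= h by move: hg hl; move: (ln _) (AN _ _ _) => l a; lra.
have -> : AN r q N = (1 + eta) * wh 1 * (s * AN r q N).
  by rewrite mulrA -[(1 + eta) * wh 1 * s]mulrC sE mul1r.
by rewrite ler_wpM2l// mulr_ge0 ?(ltW w1)// ltW.
Qed.

(** The hypothesis on [q] is weaker than minimality at [K] and also holds for minimizers at smaller
    nonnegative couplings, so one radius [eps] serves them all. The choice of [eta] makes
    [th * (1 + eta) < 1], which forces zero entropy. *)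
Lemma local_stability K : 0 <= K -> 2 * K * wh 1 < 1 -> exists2 eps, 0 < eps &
  forall q, is_density q -> (entropy q <= (2 * K * Aq r q)%:E)%E ->
    (L1dist_u q <= eps%:E)%E -> ae_eqT q q_u.
Proof.
move=> K0 Kw; pose th := 2 * K * wh 1; pose eta := (1 - th) / 2.
have w1 := wh_gt0 Hr (isT : (0 < 1)%N).
have th1 : th < 1 by [].
have th0 : 0 <= th by apply: mulr_ge0; [exact: mulr_ge0|exact: ltW].
have eta0 : 0 < eta by rewrite divr_gt0// subr_gt0.
have [eps eps0 heps] := local_entropy_bound eta0; exists eps => // q dq hle hq.
apply: ae_eqT_entropy => //; have hge := entropy_ge0 dq.
case E : (entropy q) hle hge => [h| |]//; rewrite !lee_fin => hle hge.
have := heps q h dq hq E => hA.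
have k2 : 0 <= 2 * K by exact: mulr_ge0.
have hA2 := ler_wpM2l k2 hA.
have : h <= th * (1 + eta) * h.
  apply: le_trans hle _; apply: le_trans hA2 _.
  by rewrite /th; move: (wh 1) => w; rewrite le_eqVlt; apply/orP; left; apply/eqP; ring.
have : th * (1 + eta) < 1.
  have -> : th * (1 + eta) = th + th * eta by ring.
  have : th * eta <= eta by rewrite ler_piMl ?(ltW eta0)// ltW.
  by rewrite /eta; lra.
move: (th * (1 + eta)) hge => t h0 t1 ht.
rewrite leNgt; apply/negP => hp.
have : t * h < h by rewrite -[ltRHS]mul1r ltr_pM2r.
by rewrite ltNge ht.
Qed.

End FixedRadius.
End LocalStability.

(** * The phase transition *)

Section PhaseTransition.
Variable R : realType.
Local Notation E1 := (@E1 R).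
Local Notation q_u := (@Defs.q_u R).
Implicit Types (q p : R -> R) (x y : R).

Section GivenRadius.
Variables (r : R) (Hr : 0 < r <= pi).
Local Notation wh := (wh r).
Local Notation W := (W_HK r).

Let w1 : 0 < wh 1. Proof. exact: wh_gt0. Qed.

(** A minimizer at [K] satisfies [2 K' Aq <= entropy <= 2 K Aq]; as [K < K'], its interaction and
    then its entropy vanish. *)
Lemma unique_min_below K K' : 0 <= K -> K < K' -> global_min W K' q_u ->
  unique_min_uniform W K.
Proof.
move=> K0 KK' /(global_min_uniformP Hr) gK'.
have K'0 : 0 < K' := le_lt_trans K0 KK'.
split.
  apply/(global_min_uniformP Hr) => p dp; apply: le_trans (gK' p dp).
  by rewrite lee_fin ler_wpM2r ?(Aq_ge0 Hr)// ler_wpM2l// ltW.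
move=> q gq; have dq := gq.1; apply: ae_eqT_entropy => //.
have hle := global_min_entropy_le Hr gq; have hge := gK' q dq.
case E : (entropy q) hle hge => [h| |]//; rewrite !lee_fin => hle hge.
have A0 := Aq_ge0 Hr dq.
have h1 : 2 * K' * Aq r q <= 2 * K * Aq r q := le_trans hge hle.
have AE : Aq r q = 0.
  apply/eqP; rewrite eq_le A0 andbT leNgt; apply/negP => A1.
  by move: h1; rewrite ler_pM2r// ler_pM2l// leNgt KK'.
by move: hle; rewrite AE mulr0.
Qed.

Lemma Aq_ae_uniform q : is_density q -> ae_eqT q q_u -> Aq r q = 0.
Proof.
move=> dq hq; have hl : (L1dist_u q <= 0%:E)%E by rewrite L1dist_ae_eqT.
apply/eqP; rewrite eq_le Aq_ge0// andbT; apply: Aq_le_bound => // N.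
rewrite /AN big_nat_cond big1// => k /andP[/andP[k1 _] _].
have hc := @Ex_L1dist R q (@cs R k) 0 1 dq (@bmeas_cs R k) hl ler01 (fun x _ => abs_cs k x).
have hs := @Ex_L1dist R q (@sn R k) 0 1 dq (@bmeas_sn R k) hl ler01 (fun x _ => abs_sn k x).
rewrite E1_cs// subr0 mulr0 normr_le0 in hc.
rewrite E1_sn subr0 mulr0 normr_le0 in hs.
by rewrite /m2 /cq /sq (eqP hc) (eqP hs) expr0n addr0 mulr0.
Qed.

Lemma nonuniform_min K p : 0 <= K -> is_density p -> (entropy p < (2 * K * Aq r p)%:E)%E ->
  exists q, global_min W K q /\ ~ ae_eqT q q_u.
Proof.
move=> K0 dp hp; have [q gq] := global_min_exists Hr K0; exists q; split => // hq.
have := (global_minP Hr K q).1 gq => -[dq /(_ p dp)]; apply/negP; rewrite -ltNge.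
apply: (@lt_le_trans _ _ 0%E).
  by rewrite /excess sube_lt0// orbT.
by rewrite /excess (Aq_ae_uniform dq hq) mulr0 sube0; exact: entropy_ge0.
Qed.

Lemma not_min_uniform K : ~ global_min W K q_u ->
  exists p, is_density p /\ (entropy p < (2 * K * Aq r p)%:E)%E.
Proof.
move=> h; apply: contrapT => hn; apply: h; apply/(global_min_uniformP Hr) => p dp.
by rewrite leNgt; apply/negP => hp; apply: hn; exists p.
Qed.

Lemma KsharpE2 : 2 * Ksharp W * wh 1 = 1.
Proof. by rewrite (KsharpE Hr); move: (wh 1) w1 => w w0; field; rewrite gt_eqF. Qed.

Lemma Ksharp_gt0 : 0 < Ksharp W.
Proof. by rewrite (KsharpE Hr) invr_gt0 mulr_gt0. Qed.

Lemma above_Ksharp K : Ksharp W < K -> exists p, is_density p /\ (entropy p < (2 * K * Aq r p)%:E)%E.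
Proof.
move=> hK; have K0 := lt_trans Ksharp_gt0 hK.
apply: (qtest_excess_lt0 Hr (ltW K0)); apply/orP; left.
have h : 2 * Ksharp W * wh 1 < 2 * K * wh 1 by rewrite ltr_pM2r// ltr_pM2l.
by rewrite KsharpE2 in h.
Qed.

Section Continuous.
Hypotheses (w2 : wh 2 <= wh 1 / 2)
  (wk : forall k, (3 <= k)%N -> wh k <= 8 / 9 * (wh 1 / k%:R)).

Let tail q N : R := \sum_(3 <= k < N) m2 q k / k%:R.

(** [d] is the excess at [Ksharp]. With [T] the tail over modes from 3 on, [h >= x + y / 2 + T],
    while the interaction is at most [x + y / 2 + 8 / 9 * T]; the spare [T / 9] explains the factor
    9 in the bound on [h]. For the last two bounds, take 8/9 of this inequality and 1/9 of the gap
    inequality: the tail cancels and a ninth of the gap remains. *)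
Lemma deficit_bounds q h : is_density q -> entropy q = h%:E ->
  let d := h - Aq r q / wh 1 in
  [/\ 0 <= d, h <= 9 * d + m2 q 1 + m2 q 2 / 2,
      expR (- 3) * (m2 q 1 ^+ 4 / 48) <= 9 * d & expR (- 3) * (m2 q 2 ^+ 2 / 16) <= 9 * d].
Proof.
move=> dq hE d; pose x := m2 q 1; pose y := m2 q 2.
pose e n : R := 8 / wh 1 / n.+3%:R.
have key n : exists T, [/\ 0 <= T, x + y / 2 + T <= h & Aq r q / wh 1 <= x + y / 2 + 8 / 9 * T + e n].
  exists (tail q n.+3); split.
  - by rewrite /tail; apply: sumr_ge0 => k _; rewrite divr_ge0// m2_ge0.
  - have := log_hls dq n.+3; rewrite hE lee_fin; apply: le_trans.
    rewrite /hls_s -(big_mkord xpredT (fun k => m2 q k / k%:R)) /= /tail.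
    rewrite big_ltn// big_ltn// big_ltn// invr0 mulr0 add0r divr1 addrA.
    by rewrite le_eqVlt; apply/orP; left; apply/eqP.
  rewrite ler_pdivrMr//; apply: le_trans (Aq_le Hr dq (ltn0Sn n.+2)) _.
  rewrite (mulrDl (x + y / 2 + 8 / 9 * tail q n.+3) (e n)); apply: lerD; last first.
    by rewrite /e; move: (wh 1) w1 (n.+3%:R^-1 : R) => w w0 u; rewrite le_eqVlt; apply/orP; left; apply/eqP; field; rewrite gt_eqF.
  rewrite /AN big_ltn// big_ltn// (mulrDl (x + y / 2)) (mulrDl x) addrA; apply: lerD; first apply: lerD.
  - by rewrite mulrC.
  - by rewrite mulrC -mulrA [_ * wh 1]mulrC ler_wpM2l ?m2_ge0.
  rewrite /tail mulr_sumr mulr_suml big_nat_cond [leRHS]big_nat_cond.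
  apply: ler_sum => k /andP[/andP[k3 _] _].
  rewrite (_ : 8 / 9 * (m2 q k / k%:R) * wh 1 = 8 / 9 * (wh 1 / k%:R) * m2 q k).
    by rewrite ler_wpM2r ?m2_ge0// wk.
  by move: (wh 1) (m2 q k) (k%:R^-1 : R) => w m u; ring.
have ege n : 0 <= e n by rewrite /e divr_ge0// divr_ge0// ltW.
have g1 := log_hls_gap_mode1 dq; have g2 := log_hls_gap_mode2 dq.
rewrite hE !lee_fin -/x -/y in g1 g2.
have eE n C : C * e n = (C * (8 / wh 1)) / n.+3%:R by rewrite /e mulrA.
have lim (a b C : R) : 0 <= C -> (forall n, a <= b + C * e n) -> a <= b.
  move=> C0 hn; apply: (@le_rate _ _ _ (C * (8 / wh 1))) => n; apply: le_trans (hn n) _.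
  rewrite lerD2l eE ler_wpM2l//; first by rewrite mulr_ge0// divr_ge0// ltW.
  by rewrite lef_pV2 ?posrE ?ltr0n// ler_nat (ltnW (leqnSn _)).
move: (expR (- 3) * (x ^+ 4 / 48)) (expR (- 3) * (y ^+ 2 / 16)) g1 g2 => c1 c2 g1 g2.
rewrite /d -/x -/y; move: (Aq r q / wh 1) key => a key.
clear d eE; clearbody x y e.
by split; [apply: (lim _ _ 1)|apply: (lim _ _ 9)..] => // n;
  have [T [T0 h1]] := key n; have := ege n; move: (e n) => u u0 h2; lra.
Qed.

Lemma deficit_stability eps : 0 < eps -> exists2 delta, 0 < delta &
  forall q h, is_density q -> entropy q = h%:E -> h - Aq r q / wh 1 <= delta -> h <= eps.
Proof.
move=> e0; pose k := expR (- 3) : R; have k0 : 0 < k by exact: expR_gt0.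
pose t := eps / 4; have t0 : 0 < t by rewrite divr_gt0.
(* Dividing by 18 makes [9 * d1] and [9 * d2] half of the gaps at [t], so a mode larger than [t]
   contradicts the deficit bounds. *)
pose d1 := k * (t ^+ 4 / 48) / 18; pose d2 := k * (t ^+ 2 / 16) / 18.
have d10 : 0 < d1 by rewrite divr_gt0// mulr_gt0// divr_gt0// exprn_gt0.
have d20 : 0 < d2 by rewrite divr_gt0// mulr_gt0// divr_gt0// exprn_gt0.
exists (Num.min (eps / 36) (Num.min d1 d2)).
  by rewrite !lt_min d10 d20 divr_gt0.
move=> q h dq hE; have [hd0 hb h1 h2] := deficit_bounds dq hE.
rewrite !le_min => /andP[l0 /andP[l1 l2]].
move: hd0 hb h1 h2 l0 l1 l2; move: (h - _) (m2_ge0 q 1) (m2_ge0 q 2) => d.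
move: (m2 q 1) (m2 q 2) => x y x0 y0 hd0 hb h1 h2 l0 l1 l2.
have hx : x <= t.
  rewrite leNgt; apply/negP => tx.
  have : k * (t ^+ 4 / 48) < k * (x ^+ 4 / 48).
    by rewrite ltr_pM2l// ltr_pM2r// ltrXn2r// ?nnegrE ?(ltW t0).
  move: l1 h1 d10; rewrite /d1 -/k.
  by move: (k * (t ^+ 4 / 48)) (k * (x ^+ 4 / 48)) => u v; lra.
have hy : y <= t.
  rewrite leNgt; apply/negP => ty.
  have : k * (t ^+ 2 / 16) < k * (y ^+ 2 / 16).
    by rewrite ltr_pM2l// ltr_pM2r// ltrXn2r// ?nnegrE ?(ltW t0).
  move: l2 h2 d20; rewrite /d2 -/k.
  by move: (k * (t ^+ 2 / 16)) (k * (y ^+ 2 / 16)) => u v; lra.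
by move: hx hy; rewrite /t; lra.
Qed.

Lemma Ksharp_min : global_min W (Ksharp W) q_u.
Proof.
apply/(global_min_uniformP Hr) => p dp.
case E : (entropy p) (entropy_ge0 dp) => [h| |]// _; last exact: leey.
have [d0 _ _ _] := deficit_bounds dp E; rewrite lee_fin.
suff -> : 2 * Ksharp W * Aq r p = Aq r p / wh 1 by rewrite -subr_ge0.
by rewrite (KsharpE Hr); move: (wh 1) w1 => w w0; field; rewrite gt_eqF.
Qed.

Lemma continuous_case : exists Kc : R, critical_coupling W Kc /\
  continuous_PT W Kc /\ Kc = Ksharp W.
Proof.
exists (Ksharp W); split; last split=> //.
  split; first exact: ltW Ksharp_gt0.
  split; first by move=> K K0 KK; exact: unique_min_below K0 KK Ksharp_min.
  split; first exact: Ksharp_min.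
  move=> K hK; have [p [dp hp]] := above_Ksharp hK.
  exact: nonuniform_min (ltW (lt_trans Ksharp_gt0 hK)) dp hp.
have KsA q : 2 * Ksharp W * Aq r q = Aq r q / wh 1.
  by rewrite (KsharpE Hr); move: (wh 1) w1 => w w0; field; rewrite gt_eqF.
have small eps : 0 < eps -> exists2 delta, 0 < delta & forall K q,
    Ksharp W <= K -> K <= Ksharp W + delta -> global_min W K q -> (entropy q <= eps%:E)%E.
  move=> eps0; have [d d0 hd] := deficit_stability eps0.
  have AqB q : is_density q -> Aq r q <= 16.
    move=> dq; apply: (Aq_le_bound Hr) => // N.
    apply: le_trans (ler_norm _) _; rewrite (_ : 16 = 2 * 8 / 1%:R); last by rewrite divr1; ring.
    apply: wsum_bound => // k k0; rewrite ger0_norm ?m2_ge0//.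
    exact: m2_le2.
  (* As [Aq <= 16], raising the coupling by [d / 32] changes [2 * K * Aq] by at most [d]. *)
  exists (d / 32); first by rewrite divr_gt0.
  move=> K q hK1 hK2 gq; have dq := gq.1.
  have hle := global_min_entropy_le Hr gq.
  case E : (entropy q) hle (entropy_ge0 dq) => [h| |]//; rewrite !lee_fin => hle _.
  apply: (hd _ _ dq E); rewrite -KsA.
  have A0 := Aq_ge0 Hr dq; have A16 := AqB q dq.
  have h1 : 2 * (K - Ksharp W) * Aq r q <= 2 * (d / 32) * 16.
    by apply: ler_pM => //; [rewrite mulr_ge0// subr_ge0|rewrite ler_pM2l//; lra].
  move: h1 hle; move: (Aq r q) (Ksharp W) => A Ks; lra.
split.
  exists q_u; split; first exact: Ksharp_min.
  move=> p gp; have dp := gp.1; apply: ae_eqT_entropy => //.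
  apply/lee_addgt0Pr => e e0; rewrite add0e.
  have [d d0 hd] := small e e0; apply: hd gp => //.
  by rewrite lerDl ltW.
move=> qf hqf eps eps0.
(* With [l = eps / 4] and [h = eps ^+ 2 / 8] the bound [2 * l + h / l] equals [eps]. *)
have e2 : 0 < eps ^+ 2 / 8 by rewrite divr_gt0// exprn_gt0.
have [d d0 hd] := small _ e2; exists d; split=> // K /andP[K1 K2].
have gq := hqf K K1; have hent := hd K _ (ltW K1) (ltW K2) gq.
have e4 : 0 < eps / 4 by rewrite divr_gt0.
apply: le_trans (L1dist_le_entropy gq.1 e4 hent) _; rewrite lee_fin.
by rewrite le_eqVlt; apply/orP; left; apply/eqP; field; rewrite gt_eqF.
Qed.

End Continuous.

Section Discontinuous.
Hypothesis w2 : wh 1 / 2 < wh 2.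

Lemma at_Ksharp : exists p, is_density p /\ (entropy p < (2 * Ksharp W * Aq r p)%:E)%E.
Proof.
apply: (qtest_excess_lt0 Hr (ltW Ksharp_gt0)); apply/orP; right.
rewrite KsharpE2 eqxx /=.
have K2 : 0 < 2 * Ksharp W by rewrite mulr_gt0// Ksharp_gt0.
have h : 2 * Ksharp W * (wh 1 / 2) < 2 * Ksharp W * wh 2 by rewrite ltr_pM2l.
by rewrite mulrA KsharpE2 in h.
Qed.

Lemma discontinuous_case : exists Kc : R, critical_coupling W Kc /\
  discontinuous_PT W Kc /\ Kc < Ksharp W.
Proof.
pose S : set R := [set K | 0 <= K /\ global_min W K q_u].
have noS K : (exists p, is_density p /\ (entropy p < (2 * K * Aq r p)%:E)%E) -> ~ S K.
  move=> [p [dp hp]] [K0 /(global_min_uniformP Hr)/(_ p dp)].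
  by rewrite leNgt hp.
have S0 : S 0.
  split; [exact: lexx|apply/(global_min_uniformP Hr) => p dp].
  by rewrite mulr0 mul0r; exact: entropy_ge0.
have ubS : ubound S (Ksharp W).
  by move=> K SK; rewrite leNgt; apply/negP => hK; exact: noS (above_Ksharp hK) SK.
have hS : has_sup S by split; [exists 0|exists (Ksharp W)].
pose Kc := sup S.
have Kc0 : 0 <= Kc by apply: ub_le_sup S0; exists (Ksharp W).
(* For each fixed [p] the condition is an upper bound on [K], so it passes to the supremum. *)
have minKc : global_min W Kc q_u.
  apply/(global_min_uniformP Hr) => p dp.
  case E : (entropy p) (entropy_ge0 dp) => [h| |]// h0; last exact: leey.
  rewrite lee_fin; have := Aq_ge0 Hr dp; rewrite le_eqVlt => /predU1P[<-|A0].
    by rewrite mulr0.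
  rewrite -ler_pdivlMr// -ler_pdivlMl//; apply: ge_sup; first by exists 0.
  move=> K [_ /(global_min_uniformP Hr)/(_ p dp)]; rewrite E lee_fin.
  by rewrite -ler_pdivlMr// -ler_pdivlMl.
have SKc : S Kc by [].
have KcK : Kc < Ksharp W.
  rewrite lt_neqAle; apply/andP; split; last exact: ubS.
  by apply/eqP => hK; apply: (noS (Ksharp W) at_Ksharp); rewrite -hK.
have above K : Kc < K -> exists q, global_min W K q /\ ~ ae_eqT q q_u.
  move=> hK; have K0 := le_trans Kc0 (ltW hK).
  have nK : ~ global_min W K q_u.
    move=> gK; have : K <= Kc by apply: ub_le_sup; [exists (Ksharp W)|split].
    by rewrite leNgt hK.
  have [p [dp hp]] := not_min_uniform nK.
  exact: nonuniform_min K0 dp hp.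
exists Kc; split.
  split; [exact: Kc0|split; last by split; [exact: minKc|exact: above]].
  by move=> K K0 KK; exact: unique_min_below K0 KK minKc.
split=> // -[_ cont].
(* A choice of nonuniform minimizers; the default [q_u] is never taken above [Kc]. *)
pose qf (K : R) : R -> R :=
  if pselect (exists q, global_min W K q /\ ~ ae_eqT q q_u) is left e then projT1 (cid e) else q_u.
have qfP K : Kc < K -> global_min W K (qf K) /\ ~ ae_eqT (qf K) q_u.
  by move=> /above hK; rewrite /qf; case: pselect => [e|//]; exact: projT2 (cid e).
(* The stability radius is fixed at [K1], strictly below [Ksharp], before continuity supplies
   [delta]; it then applies to any coupling between [Kc] and [K1]. *)
pose K1 := (Kc + Ksharp W) / 2.
have hK1 : Kc < K1 < Ksharp W by rewrite /K1; lra.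
have /andP[K1a K1b] := hK1.
have K10 : 0 <= K1 := le_trans Kc0 (ltW K1a).
have K1w : 2 * K1 * wh 1 < 1.
  have h : 2 * K1 * wh 1 < 2 * Ksharp W * wh 1 by rewrite ltr_pM2r// ltr_pM2l.
  by rewrite KsharpE2 in h.
have [eps eps0 stab] := local_stability Hr K10 K1w.
have [delta [d0 hd]] := cont qf (fun K hK => (qfP K hK).1) eps eps0.
pose K := Num.min K1 (Kc + delta / 2).
have hdelta : 0 < delta / 2 by rewrite divr_gt0.
have hK : Kc < K < Kc + delta.
  rewrite lt_min K1a ltrDl hdelta /= gt_min; apply/orP; right.
  by rewrite ltrD2l ltr_pdivrMr// ltr_pMr// ltr1n.
have [gq nq] := qfP K (andP hK).1; apply: nq; apply: stab (hd K hK); first exact: gq.1.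
apply: le_trans (global_min_entropy_le Hr gq) _.
rewrite lee_fin ler_wpM2r ?(Aq_ge0 Hr gq.1)// ler_wpM2l//.
by rewrite /K ge_min lexx.
Qed.

End Discontinuous.
End GivenRadius.
End PhaseTransition.

Theorem theorem1p10 (R : realType) (Rstar : R)
  (HRstar : 0 < Rstar < pi) (HRstar_eq : Rstar = sin Rstar * (2 - cos Rstar))
  (r : R) (Hr : 0 < r <= pi) :
  (r < Rstar ->
     exists Kc : R, critical_coupling (W_HK r) Kc /\
       discontinuous_PT (W_HK r) Kc /\ Kc < Ksharp (W_HK r)) /\
  (Rstar <= r ->
     exists Kc : R, critical_coupling (W_HK r) Kc /\
       continuous_PT (W_HK r) Kc /\ Kc = Ksharp (W_HK r)).
Proof.
split=> rR.
  exact: (discontinuous_case Hr (wh2_gt Hr HRstar HRstar_eq rR)).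
apply: (continuous_case Hr (wh2_le Hr HRstar HRstar_eq rR)) => k k3.
exact: (whk_le Hr HRstar HRstar_eq rR k3).
Qed.
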